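(* Assume: (i) $\mathcal X\subseteq\mathcal D$; (ii) $F^\star>-\infty$, $\mathbf x_0=\mathbf x_1\in\mathcal X$ and $F(\mathbf x_1)-F^\star\le B_1$; (iii) for every $\boldsymbol\xi$, $f(\cdot,\boldsymbol\xi)$ is $L$-smooth and $G$-Lipschitz; (iv) all $h_i$ $(1\le i\le I)$ and all $g_j$ $(1\le j\le J)$ are $L$-smooth and $G$-Lipschitz; (v) $\mathbb E[\|\nabla f(\mathbf x,\boldsymbol\xi)-\nabla U(\mathbf x)\|^2]\le\sigma^2$ for all $\mathbf x\in\mathcal X$; (vi) (parameterized $(\chi,\rho)$-MFCQ) $\chi\ge 0$ and $\rho>0$ are such that for every $\tilde{\mathbf x}\in\mathcal X$ there is $\mathbf d\in\mathbb R^n$ with $\|\mathbf d\|=1$, $\langle\nabla g_j(\tilde{\mathbf x}),\mathbf d\rangle\le-\rho$ for every $j$ with $g_j(\tilde{\mathbf x})\ge-\chi$, and $\langle\nabla h_i(\tilde{\mathbf x}),\mathbf d\rangle\le-\rho$ for every $i$ with $h_i(\tilde{\mathbf x})\ge-\chi$; moreover $\chi\ge\frac{\rho}{L}(G+\rho/2)$; (vii) for each $\mathbf y\in\mathcal X$ and each $\boldsymbol\xi$, the surrogate $\hat f(\cdot,\mathbf y,\boldsymbol\xi)$ is $\mu$-strongly convex and $L$-smooth, and $\nabla\hat f(\mathbf x,\mathbf x,\boldsymbol\xi)=\nabla f(\mathbf x,\boldsymbol\xi)$ for all $\mathbf x\in\mathcal X$ (gradient in the first argument); (viii) for each $\mathbf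 y\in\mathcal X$ and each $j$, the surrogate $\tilde g_j(\cdot,\mathbf y)$ is convex, $L$-smooth and $G$-Lipschitz in $\mathcal X$, $\nabla\tilde g_j(\mathbf y,\mathbf y)=\nabla g_j(\mathbf y)$, and $g_j(\mathbf x)\le\tilde g_j(\mathbf x,\mathbf y)$ for all $\mathbf x\in\mathcal X$ with equality at $\mathbf x=\mathbf y$; (ix) for all $t\ge1$ and all $\mathbf x\in\mathcal X$, $\tilde f(\mathbf x,\mathbf x_t,\mathbf z_t,\boldsymbol\xi_t)+u(\mathbf x)-\min_{\mathbf x'\in\mathcal X(\mathbf x_t)}\big(\tilde f(\mathbf x',\mathbf x_t,\mathbf z_t,\boldsymbol\xi_t)+u(\mathbf x')\big)\le B_U$; (x) $0<\bar k\le w^{1/3}$, $\frac{w^{2/3}}{4\bar k^2}\ge c> 8L^2+\frac{G^2}{3\bar k^3}$, $\mu>\frac34$ and $w\ge\max\{(\frac{2L\bar k}{4\mu-3})^3,2G^2\}$. Then, for the CoSTA algorithm with adaptive step sizes, for every $\epsilon\in(0,1)$ there exist some $t$ with $1\le t\le\tilde{\mathcal O}(\epsilon^{-3/2})$ and $\hat{\boldsymbol\lambda}_t\in\mathbb R^J_+$, $\hat{\boldsymbol\nu}_t\in\mathbb R^I_+$ such that $(\hat{\mathbf x}_t,\hat{\boldsymbol\lambda}_t,\hat{\boldsymbol\nu}_t)$ is $\epsilon$-KKT optimal.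
   Context: Problem. $U(\mathbf x)=\mathbb E[f(\mathbf x,\boldsymbol\xi)]$ with $f(\cdot,\boldsymbol\xi)$ differentiable, possibly non-convex, and $\boldsymbol\xi$ a random variable; $u$ is convex (possibly non-smooth); $h_1,\dots,h_I$ are smooth convex functions and $g_1,\dots,g_J$ smooth, possibly non-convex functions on $\mathbb R^n$. Let $F=U+u$, $\mathcal K=\{\mathbf x\in\mathbb R^n: h_i(\mathbf x)\le0\ \forall i\}$, $\mathcal X=\mathcal K\cap\{\mathbf x: g_j(\mathbf x)\le0\ \forall j\}$, $F^\star=\min_{\mathbf x\in\mathcal X}F(\mathbf x)$, and $\mathcal D=\mathrm{dom}(F)\cap\bigcap_j\mathrm{dom}(g_j)\cap\bigcap_i\mathrm{dom}(h_i)$. $L$-smooth means differentiable with $L$-Lipschitz gradient; norms are Euclidean. CoSTA algorithm with adaptive step sizes. Parameters $\bar k,w,c>0$; i.i.d. samples $\boldsymbol\xi_1,\boldsymbol\xi_2,\dots$ of $\boldsymbol\xi$; start $\mathbf x_0=\mathbf x_1\in\mathcal X$ and $\mathbf z_1=\nabla f(\mathbf x_0,\boldsymbol\xi_1)$. With $G_t=\|\nabla f(\mathbf x_t,\boldsymbol\xi_t)\|$ put $\eta_0=\bar k/w^{1/3}$, $\eta_t=\bar k/(w+\sum_{i=1}^tG_i^2)^{1/3}$ for $t\ge1$, and $\beta_{t+1}=c\eta_t^2$ for $t\ge 0$. For $t=1,2,\dots$: $\mathbf z_{t+1}=\nabla f(\mathbf x_t,\boldsymbol\xi_t)+(1-\beta_t)(\mathbf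 z_t-\nabla f(\mathbf x_{t-1},\boldsymbol\xi_t))$; $\hat{\mathbf x}_t=\arg\min_{\mathbf x\in\mathcal X(\mathbf x_t)}\tilde f(\mathbf x,\mathbf x_t,\mathbf z_t,\boldsymbol\xi_t)+u(\mathbf x)$, where $\tilde f(\mathbf x,\mathbf x_t,\mathbf z_t,\boldsymbol\xi_t)=\hat f(\mathbf x,\mathbf x_t,\boldsymbol\xi_t)+(1-\beta_t)\langle\mathbf x-\mathbf x_t,\mathbf z_t-\nabla f(\mathbf x_{t-1},\boldsymbol\xi_t)\rangle$ and $\mathcal X(\mathbf y)=\mathcal K\cap\{\mathbf x:\tilde g_j(\mathbf x,\mathbf y)\le0\ \forall j\}$; $\mathbf x_{t+1}=(1-\eta_t)\mathbf x_t+\eta_t\hat{\mathbf x}_t$. Here $\hat f(\cdot,\mathbf y,\boldsymbol\xi)$ and $\tilde g_j(\cdot,\mathbf y)$ are user-chosen surrogates of $f(\cdot,\boldsymbol\xi)$ and $g_j$. The subproblem is a convex problem: $\mathcal X(\mathbf y)$ is a convex set and $\mathcal X(\mathbf y)\subseteq\mathcal X$ for $\mathbf y\in\mathcal X$. $\epsilon$-KKT optimality. A (random) triple $(\tilde{\mathbf x},\tilde{\boldsymbol\lambda},\tilde{\boldsymbol\nu})$ with $\tilde{\mathbf x}\in\mathcal X$, $\tilde{\boldsymbol\lambda}\in\mathbb R^J_+$, $\tilde{\boldsymbol\nu}\in\mathbb R^I_+$ is $\epsilon$-KKT optimal if for some $\mathbf v\in\partial u(\tilde{\mathbf x})$: $\mathbb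 E\big[\|\nabla U(\tilde{\mathbf x})+\sum_j\tilde\lambda_j\nabla g_j(\tilde{\mathbf x})+\sum_i\tilde\nu_i\nabla h_i(\tilde{\mathbf x})+\mathbf v\|\big]\le\sqrt\epsilon$, $\mathbb E[\sum_j\tilde\lambda_jg_j(\tilde{\mathbf x})]\ge-\epsilon$, and $\mathbb E[\sum_i\tilde\nu_ih_i(\tilde{\mathbf x})]\ge-\epsilon$. $t\le\tilde{\mathcal O}(\epsilon^{-3/2})$ means $t\le C\epsilon^{-3/2}(\log(e/\epsilon))^p$ for constants $C,p>0$ not depending on $\epsilon$ (depending only on the problem and algorithm parameters). *)

(* Defs.v *)
From HB Require Import structures.
From mathcomp Require Import all_boot all_order all_algebra.
From mathcomp Require Import all_classical all_reals all_analysis.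

Set Implicit Arguments.
Unset Strict Implicit.
Unset Printing Implicit Defensive.

Import Order.TTheory GRing.Theory Num.Theory.
Import numFieldNormedType.Exports.

Local Open Scope classical_set_scope.
Local Open Scope ring_scope.

(* The library norm on 'rV[R]_n is the sup norm, hence the Euclidean norm
   below; differentiability does not depend on this choice. *)
Definition dotv (R : realType) (n : nat) (x y : 'rV[R]_n) : R :=
  \sum_i x 0 i * y 0 i.

Definition enorm (R : realType) (n : nat) (x : 'rV[R]_n) : R :=
  Num.sqrt (dotv x x).

Definition grad (R : realType) (n : nat) (phi : 'rV[R]_n -> R) (x : 'rV[R]_n) :
  'rV[R]_n := \row_i 'D_(delta_mx 0 i) phi x.

(* Differentiability is meant in R^n, at every point of A. *)
Definition Lsmooth_on (R : realType) (n : nat) (L : R) (A : set 'rV[R]_n)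
    (phi : 'rV[R]_n -> R) : Prop :=
  (forall x, A x -> differentiable phi x) /\
  (forall x y, A x -> A y ->
     enorm (grad phi x - grad phi y) <= L * enorm (x - y)).

Definition Lipschitz_on (R : realType) (n : nat) (G : R) (A : set 'rV[R]_n)
    (phi : 'rV[R]_n -> R) : Prop :=
  forall x y, A x -> A y -> `|phi x - phi y| <= G * enorm (x - y).

Definition strongly_convex (R : realType) (n : nat) (mu : R)
    (phi : 'rV[R]_n -> R) : Prop :=
  forall (x y : 'rV[R]_n) (l : R), 0 <= l <= 1 ->
    phi (l *: x + (1 - l) *: y) <=
      l * phi x + (1 - l) * phi y - mu / 2 * l * (1 - l) * enorm (x - y) ^+ 2.

(* Extended-valued convex functions take values in ]-oo, +oo]. *)
Definition convex_ext (R : realType) (n : nat) (phi : 'rV[R]_n -> \bar R) : Prop :=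
  (forall x, -oo < phi x)%E /\
  (forall (x y : 'rV[R]_n) (l : R), 0 <= l <= 1 ->
     (phi (l *: x + (1 - l) *: y)%R <= l%:E * phi x + (1 - l)%:E * phi y)%E).

Definition effdom (R : realType) (n : nat) (phi : 'rV[R]_n -> \bar R) :
  set 'rV[R]_n := [set x | (phi x < +oo)%E].

Definition subdiff (R : realType) (n : nat) (phi : 'rV[R]_n -> \bar R)
    (x : 'rV[R]_n) : set 'rV[R]_n :=
  [set v | phi x \is a fin_num /\
           forall y, (phi x + (dotv v (y - x)%R)%:E <= phi y)%E].

Definition argmin_on (R : realType) (T : Type) (A : set T) (phi : T -> \bar R) :
  set T := [set a | A a /\ forall b, A b -> (phi a <= phi b)%E].

Definition borel (R : realType) (n : nat) := g_sigma_algebraType (@open 'rV[R]_n).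

Definition random_vector (R : realType) (d : measure_display)
    (T : measurableType d) (n : nat) (V : T -> 'rV[R]_n) : Prop :=
  measurable_fun [set: T] (V : T -> borel R n).

(* xi 0 is unused: the samples are xi 1, xi 2, etc. *)
Definition iid_samples (R : realType) (dO dS : measure_display)
    (Om : measurableType dO) (Xi : measurableType dS) (P : probability Om R)
    (D : probability Xi R) (xi : nat -> {RV P >-> Xi}) : Prop :=
  (forall t, (1 <= t)%N -> forall B : set Xi, measurable B ->
     distribution P (xi t) B = D B) /\
  (forall (T : seq nat) (B : nat -> set Xi), uniq T -> all (leq 1) T ->
     (forall t, measurable (B t)) ->
     P (\bigcap_(t in [set` T]) (xi t @^-1` B t)) =
       (\prod_(t <- T) P (xi t @^-1` B t))%E).

(* loss is f, reg is u, gcon and hcon are the families g and h;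
   xi_law is the distribution of the random variable xi. *)
Record problem (R : realType) (d : measure_display) (Xi : measurableType d)
    (n J I : nat) := Problem {
  xi_law : probability Xi R;
  loss : 'rV[R]_n -> Xi -> R;
  reg : 'rV[R]_n -> \bar R;
  gcon : 'I_J -> 'rV[R]_n -> R;
  hcon : 'I_I -> 'rV[R]_n -> R
}.

(* loss_sur x y s is \hat f(x, y, s); gcon_sur j x y is \tilde g_j(x, y). *)
Record surrogates (R : realType) (d : measure_display) (Xi : measurableType d)
    (n J : nat) := Surrogates {
  loss_sur : 'rV[R]_n -> 'rV[R]_n -> Xi -> R;
  gcon_sur : 'I_J -> 'rV[R]_n -> 'rV[R]_n -> R
}.

Section Problem.
Context (R : realType) (d : measure_display) (Xi : measurableType d) (n J I : nat).
Implicit Types (pb : problem R Xi n J I) (sur : surrogates R Xi n J).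

Definition Uobj pb (x : 'rV[R]_n) : R := fine ('E_(xi_law pb)[loss pb x])%E.

Definition Fobj pb (x : 'rV[R]_n) : \bar R := ((Uobj pb x)%:E + reg pb x)%E.

Definition Kset pb : set 'rV[R]_n := [set x | forall i, hcon pb i x <= 0].

Definition Xset pb : set 'rV[R]_n :=
  Kset pb `&` [set x | forall j, gcon pb j x <= 0].

Definition Fstar pb : \bar R := ereal_inf (Fobj pb @` Xset pb).

Definition Dset pb : set 'rV[R]_n :=
  effdom (Fobj pb)
  `&` \bigcap_(j in [set: 'I_J]) effdom (EFin \o gcon pb j)
  `&` \bigcap_(i in [set: 'I_I]) effdom (EFin \o hcon pb i).

(* Standing assumptions: the expectation U is well defined, u and the h_i are
   convex. *)
Definition well_posed pb : Prop :=
  [/\ forall x, (xi_law pb).-integrable setT (EFin \o loss pb x),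
      convex_ext (reg pb) &
      forall i, convex_function setT (hcon pb i)].

Definition bounded_variance pb (sigma : R) : Prop :=
  forall x, Xset pb x ->
    ('E_(xi_law pb)[fun s =>
        (enorm (grad (loss pb ^~ s) x - grad (Uobj pb) x) ^+ 2)%R]
     <= (sigma ^+ 2)%:E)%E.

Definition MFCQ pb (chi rho : R) : Prop :=
  forall x, Xset pb x -> exists v : 'rV[R]_n,
    [/\ enorm v = 1,
        forall j, - chi <= gcon pb j x -> dotv (grad (gcon pb j) x) v <= - rho &
        forall i, - chi <= hcon pb i x -> dotv (grad (hcon pb i) x) v <= - rho].

Definition Xsur pb sur (y : 'rV[R]_n) : set 'rV[R]_n :=
  Kset pb `&` [set x | forall j, gcon_sur sur j x y <= 0].

(* Joint Borel measurability, without which the iterates need not be random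
   variables. *)
Definition measurable_surrogates pb sur : Prop :=
  measurable_fun ([set: borel R n] `*` (Xset pb : set (borel R n)) `*` [set: Xi])
    (fun p : borel R n * borel R n * Xi => loss_sur sur p.1.1 p.1.2 p.2) /\
  forall j,
    measurable_fun ([set: borel R n] `*` (Xset pb : set (borel R n)))
      (fun p : borel R n * borel R n => gcon_sur sur j p.1 p.2).

Definition convex_subproblem pb sur : Prop :=
  forall y, Xset pb y ->
    convex_set (Xsur pb sur y) /\ Xsur pb sur y `<=` Xset pb.

Definition loss_surrogate pb sur (mu L : R) : Prop :=
  (forall y s, Xset pb y ->
     strongly_convex mu (fun x => loss_sur sur x y s) /\
     Lsmooth_on L setT (fun x => loss_sur sur x y s)) /\
  (forall x s, Xset pb x ->
     grad (fun x' => loss_sur sur x' x s) x = grad (loss pb ^~ s) x).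

Definition gcon_surrogate pb sur (L G : R) : Prop :=
  forall y j, Xset pb y ->
    [/\ convex_function (Xset pb) (fun x => gcon_sur sur j x y),
        Lsmooth_on L (Xset pb) (fun x => gcon_sur sur j x y),
        Lipschitz_on G (Xset pb) (fun x => gcon_sur sur j x y),
        grad (fun x => gcon_sur sur j x y) y = grad (gcon pb j) y &
        (forall x, Xset pb x -> gcon pb j x <= gcon_sur sur j x y) /\
        gcon pb j y = gcon_sur sur j y y].

Section KKT.
Context (dO : measure_display) (Om : measurableType dO) (P : probability Om R).

Definition eps_KKT pb (eps : R) (xt : Om -> 'rV[R]_n) (lam : Om -> 'rV[R]_J)
    (nu : Om -> 'rV[R]_I) : Prop :=
  [/\ [/\ random_vector xt, random_vector lam & random_vector nu],
      forall om, [/\ Xset pb (xt om), forall j, 0 <= lam om 0 j &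
                     forall i, 0 <= nu om 0 i],
      exists v : Om -> 'rV[R]_n,
        [/\ random_vector v,
            forall om, subdiff (reg pb) (xt om) (v om) &
            ('E_P[fun om => (enorm (grad (Uobj pb) (xt om)
                + \sum_j lam om 0 j *: grad (gcon pb j) (xt om)
                + \sum_i nu om 0 i *: grad (hcon pb i) (xt om)
                + v om))%R] <= (Num.sqrt eps)%:E)%E],
      ((- eps)%:E <= 'E_P[fun om => (\sum_j lam om 0 j * gcon pb j (xt om))%R])%E &
      ((- eps)%:E <= 'E_P[fun om => (\sum_i nu om 0 i * hcon pb i (xt om))%R])%E].

End KKT.

Section Algorithm.
Context (Om : Type) (kbar w c : R) (xi : nat -> Om -> Xi).
Variables (x xhat z : nat -> Om -> 'rV[R]_n).

Definition stepsize pb (t : nat) (om : Om) : R :=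
  kbar / (w + \sum_(1 <= i < t.+1)
                enorm (grad (loss pb ^~ (xi i om)) (x i om)) ^+ 2) `^ (1 / 3).

(* Only used for t >= 1. *)
Definition momentum pb (t : nat) (om : Om) : R := c * stepsize pb t.-1 om ^+ 2.

Definition sub_loss pb sur (t : nat) (om : Om) (y : 'rV[R]_n) : R :=
  loss_sur sur y (x t om) (xi t om)
  + (1 - momentum pb t om) *
    dotv (y - x t om) (z t om - grad (loss pb ^~ (xi t om)) (x t.-1 om)).

Definition sub_obj pb sur (t : nat) (om : Om) (y : 'rV[R]_n) : \bar R :=
  ((sub_loss pb sur t om y)%:E + reg pb y)%E.

(* Every realization (x_t, \hat x_t, z_t) of the iterates, started at x0. *)
Definition CoSTA pb sur (x0 : 'rV[R]_n) : Prop :=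
  forall om : Om,
    [/\ x 0%N om = x0 /\ x 1%N om = x0,
        z 1%N om = grad (loss pb ^~ (xi 1%N om)) (x 0%N om) &
        forall t, (1 <= t)%N ->
          [/\ z t.+1 om = grad (loss pb ^~ (xi t om)) (x t om)
                + (1 - momentum pb t om) *:
                  (z t om - grad (loss pb ^~ (xi t om)) (x t.-1 om)),
              argmin_on (Xsur pb sur (x t om)) (sub_obj pb sur t om)
                (xhat t om) &
              x t.+1 om = (1 - stepsize pb t om) *: x t om
                + stepsize pb t om *: xhat t om]].

Definition bounded_gap pb sur (BU : R) : Prop :=
  forall (t : nat) (om : Om) (y : 'rV[R]_n), (1 <= t)%N -> Xset pb y ->
    (sub_obj pb sur t om y
     - ereal_inf (sub_obj pb sur t om @` Xsur pb sur (x t om)) <= BU%:E)%E.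

End Algorithm.
End Problem.

(* Main.v *)
(* Let D_t = |xhat_t - x_t| and E_t = |z_(t+1) - grad U(x_t)|. Strong convexity of the surrogate gives
   a descent of F by eta_t (3/4 D_t^2 - E_t D_t), while E_t^2 / eta_(t-1) decreases by a multiple of
   eta_t E_t^2 up to eta_t D_t^2, a term that sums to a logarithm, and a martingale difference. A
   combination of F and this potential therefore bounds the expected sum of D_t^2 + E_t^2 over t <= T
   by O(T^(1/3) log T), since eta_t >= const * T^(-1/3); some t <= T has expected squared error
   O(T^(-2/3) log T). The MFCQ yields a uniform Slater point for the subproblem, hence KKT multipliers
   bounded independently of t, and their residual and complementarity gap at xhat_t are controlled by
   D_t + E_t and D_t^2.

   The inequalities are pathwise; only the vanishing mean of the martingale differences needs the
   iterates to be measurable with respect to the past samples. Measurability of xhat_t and of the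
   multipliers rests on characterizing them by countably many inequalities, indexed by rational
   points, that are continuous in the unknown. *)

(* The step sizes are random and correlated with the samples, and this dictates the form of the
   estimates. The squared error at time t + 1 is divided by eta_t, not by eta_(t+1): eta_t and
   beta_(t+1) = c eta_t^2 depend on the samples up to t only, so they stay outside the average over
   the fresh sample t + 1. For the same reason the random weights eta_t are replaced by the
   deterministic lower bound kbar / (w + T G^2)^(1/3) before expectations are taken; otherwise the
   sum of martingale differences would be multiplied by a factor that depends on later samples. A
   run is described over a bare type of outcomes, so that the same iterates can be read over Om with
   its own sigma-algebra or with that generated by the past. The regularizer u is not assumed
   continuous or measurable. Assumption (i) makes it finite on X, where only its convexity and the
   bound (ix) are used: the MFCQ yields a ball inside the surrogate feasible set on which u is
   bounded above, and contraction towards that ball makes rational points dense in objective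
   value. *)
Require Import Defs.
From HB Require Import structures.
From mathcomp Require Import all_boot all_order all_algebra.
From mathcomp Require Import all_classical all_reals all_analysis.
From mathcomp Require Import measurable_realfun.
From mathcomp Require Import ring lra.

Set Implicit Arguments.
Unset Strict Implicit.
Unset Printing Implicit Defensive.

Import Order.TTheory GRing.Theory Num.Theory.
Import numFieldNormedType.Exports.

Local Open Scope classical_set_scope.
Local Open Scope ring_scope.

(** * Euclidean geometry and calculus *)

Section VectorAlgebra.
Context (R : realType) (n : nat).
Implicit Types (x y v : 'rV[R]_n) (a : R).

Lemma dotvC x y : dotv x y = dotv y x.
Proof. by apply: eq_bigr => i _; rewrite mulrC. Qed.

Lemma dotvDl x y v : dotv (x + y) v = dotv x v + dotv y v.
Proof. by rewrite -big_split; apply: eq_bigr => i _; rewrite mxE mulrDl. Qed.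

Lemma dotvZl a x y : dotv (a *: x) y = a * dotv x y.
Proof. by rewrite big_distrr; apply: eq_bigr => i _; rewrite mxE /= mulrA. Qed.

Lemma dotvDr x y v : dotv v (x + y) = dotv v x + dotv v y.
Proof. by rewrite dotvC dotvDl !(dotvC _ v). Qed.

Lemma dotvZr a x y : dotv x (a *: y) = a * dotv x y.
Proof. by rewrite dotvC dotvZl dotvC. Qed.

Lemma dotvNl x y : dotv (- x) y = - dotv x y.
Proof. by rewrite -scaleN1r dotvZl mulN1r. Qed.

Lemma dotvNr x y : dotv x (- y) = - dotv x y.
Proof. by rewrite dotvC dotvNl dotvC. Qed.

Lemma dotvBl x y v : dotv (x - y) v = dotv x v - dotv y v.
Proof. by rewrite dotvDl dotvNl. Qed.

Lemma dotvBr x y v : dotv v (x - y) = dotv v x - dotv v y.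
Proof. by rewrite dotvDr dotvNr. Qed.

Lemma dotv0l x : dotv 0 x = 0.
Proof. by rewrite -(scale0r x) dotvZl mul0r. Qed.

Lemma dotv0r x : dotv x 0 = 0.
Proof. by rewrite dotvC dotv0l. Qed.

Lemma dotv_suml (I : finType) (F : I -> 'rV[R]_n) x :
  dotv (\sum_i F i) x = \sum_i dotv (F i) x.
Proof.
rewrite (big_morph (fun u => dotv u x) (id1 := 0) (op1 := +%R)) ?dotv0l//.
by move=> u v; rewrite dotvDl.
Qed.

Lemma dotv_delta x i : dotv x (delta_mx 0 i) = x 0 i.
Proof.
rewrite /dotv (bigD1 i)//= mxE !eqxx mulr1 big1 ?addr0// => j /negPf ji.
by rewrite mxE ji andbF mulr0.
Qed.

Lemma dotvv_ge0 x : 0 <= dotv x x.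
Proof. by apply: sumr_ge0 => i _; rewrite -expr2 sqr_ge0. Qed.

Lemma enorm_ge0 x : 0 <= enorm x.
Proof. exact: sqrtr_ge0. Qed.

Lemma enorm_sqr x : enorm x ^+ 2 = dotv x x.
Proof. by rewrite sqr_sqrtr// dotvv_ge0. Qed.

Lemma enorm0 : enorm (0 : 'rV[R]_n) = 0.
Proof. by rewrite /enorm dotv0l sqrtr0. Qed.

Lemma enormZ a x : enorm (a *: x) = `|a| * enorm x.
Proof. by rewrite /enorm dotvZl dotvZr mulrA -expr2 sqrtrM ?sqr_ge0// sqrtr_sqr. Qed.

Lemma enormN x : enorm (- x) = enorm x.
Proof. by rewrite -scaleN1r enormZ normrN1 mul1r. Qed.

Lemma enormB x y : enorm (x - y) = enorm (y - x).
Proof. by rewrite -enormN opprB. Qed.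

Lemma coord_le_enorm x i : `|x 0 i| <= enorm x.
Proof.
rewrite -sqrtr_sqr ler_sqrt ?dotvv_ge0// /dotv (bigD1 i)//= -expr2 lerDl.
by apply: sumr_ge0 => j _; rewrite -expr2 sqr_ge0.
Qed.

Lemma enorm_eq0 x : enorm x = 0 -> x = 0.
Proof.
move=> x0; apply/rowP => i; rewrite mxE; apply/eqP.
by rewrite -normr_le0 -x0 coord_le_enorm.
Qed.

Lemma dotv_le_enorm x y : dotv x y <= enorm x * enorm y.
Proof.
have [y0|y0] := eqVneq (enorm y) 0.
  by rewrite (enorm_eq0 y0) dotv0r enorm0 mulr0.
have [x0|x0] := eqVneq (enorm x) 0.
  by rewrite (enorm_eq0 x0) dotv0l enorm0 mul0r.
have yp : 0 < enorm y by rewrite lt_def y0 enorm_ge0.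
have xp : 0 < enorm x by rewrite lt_def x0 enorm_ge0.
have := dotvv_ge0 (enorm y *: x - enorm x *: y).
rewrite !(dotvBl, dotvBr, dotvZl, dotvZr) (dotvC y x) -!enorm_sqr.
set s := enorm x in xp *; set t := enorm y in yp *; set p := dotv x y.
rewrite (_ : _ - _ = 2 * (s * t) * (s * t - p)); last by ring.
by rewrite pmulr_rge0 ?subr_ge0// !mulr_gt0.
Qed.

Lemma normr_dotv_le x y : `|dotv x y| <= enorm x * enorm y.
Proof.
rewrite ler_norml dotv_le_enorm andbT lerNl -dotvNl -(enormN x).
exact: dotv_le_enorm.
Qed.

Lemma enorm_triangle x y : enorm (x + y) <= enorm x + enorm y.
Proof.
rewrite -(ler_pXn2r (n := 2))// ?nnegrE ?addr_ge0 ?enorm_ge0//.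
rewrite sqrrD !enorm_sqr !(dotvDl, dotvDr) (dotvC y x).
have := dotv_le_enorm x y; lra.
Qed.

Lemma enorm_sum (I : finType) (F : I -> 'rV[R]_n) :
  enorm (\sum_i F i) <= \sum_i enorm (F i).
Proof.
elim/big_ind2 : _ => [|x a y b xa yb|//]; first by rewrite enorm0.
by rewrite (le_trans (enorm_triangle _ _))// lerD.
Qed.

Lemma enorm_sqrD_le x y : enorm (x + y) ^+ 2 <= 2 * enorm x ^+ 2 + 2 * enorm y ^+ 2.
Proof.
have := dotvv_ge0 (x - y); rewrite !enorm_sqr !(dotvBl, dotvBr, dotvDl, dotvDr).
rewrite (dotvC y x); lra.
Qed.

Lemma norm_le_enorm x : `|x| <= enorm x.
Proof.
rewrite [`|x|]mx_normrE; apply/bigmax_leP; split; first exact: enorm_ge0.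
by move=> [i j] _ /=; rewrite ord1 coord_le_enorm.
Qed.

Lemma enorm_le_sum x : enorm x <= \sum_i `|x 0 i|.
Proof.
have S0 : 0 <= \sum_i `|x 0 i| by apply: sumr_ge0.
rewrite -(ler_pXn2r (n := 2))// ?nnegrE ?enorm_ge0// enorm_sqr expr2 mulr_suml.
apply: ler_sum => i _; rewrite (le_trans (ler_norm _))// normrM ler_wpM2l//.
by rewrite (bigD1 i)//= lerDl; apply: sumr_ge0.
Qed.

Lemma coord_le_norm x i : `|x 0 i| <= `|x|.
Proof.
rewrite [`|x|]mx_normrE.
exact: (@le_bigmax _ _ _ 0 (fun ij => `|x ij.1 ij.2|) (0, i)).
Qed.

Lemma enorm_le_norm x : enorm x <= n%:R * `|x|.
Proof.
rewrite (le_trans (enorm_le_sum x))// -[n in n%:R]card_ord mulr_natl -sumr_const.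
by apply: ler_sum => i _; exact: coord_le_norm.
Qed.

End VectorAlgebra.

(** * Directional derivatives and quadratic bounds for smooth functions *)

Section Calculus.
Context (R : realType) (n : nat).
Implicit Types (x y v m : 'rV[R]_n) (phi : 'rV[R]_n -> R).

Lemma derive_grad phi x v : differentiable phi x -> 'D_v phi x = dotv (grad phi x) v.
Proof.
move=> dphi; rewrite deriveE// {1}(row_sum_delta v) linear_sum/=.
apply: eq_bigr => i _; rewrite linearZ/= /GRing.scale/= mulrC mxE -deriveE//.
Qed.

Lemma is_derive_line phi x v (s : R) : differentiable phi (x + s *: v) ->
  is_derive s 1 (fun s => phi (x + s *: v)) (dotv (grad phi (x + s *: v)) v).
Proof.
move=> dphi; have E : (fun h => h^-1 *: (((fun s => phi (x + s *: v)) \o shift s) (h *: 1) -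
    phi (x + s *: v))) = (fun h => h^-1 *: ((phi \o shift (x + s *: v)) (h *: v) - phi (x + s *: v))).
  apply/funext => h /=; congr (_ *: (phi _ - _)).
  by rewrite [h *: 1]mulr1 scalerDl addrCA.
have dv := @diff_derivable _ _ _ _ _ v dphi; rewrite /derivable -E in dv.
by apply: DeriveDef dv _; rewrite /derive E -derive_grad.
Qed.

Lemma dirdiff_cvg phi x v : differentiable phi x ->
  s^-1 * (phi (x + s *: v) - phi x) @[s --> 0^'] --> dotv (grad phi x) v.
Proof.
move=> dphi; have := @diff_derivable _ _ _ _ _ v dphi.
rewrite -derive_grad// /derivable /derive.
rewrite [X in X @ _](_ : _ = fun s : R => s^-1 * (phi (x + s *: v) - phi x))//.
by apply/funext => s; rewrite (addrC x).
Qed.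

Lemma dirdiff_lt phi x v (c : R) : differentiable phi x -> dotv (grad phi x) v < c ->
  \forall s \near 0^'+, phi (x + s *: v) - phi x < c * s.
Proof.
move=> /(@dirdiff_cvg _ _ v)/cvg_dnbhs_at_right/cvgr_lt h /h; apply: filterS2; last first.
  exact: nbhs_right_gt.
by move=> s s0; rewrite ltr_pdivrMl// mulrC.
Qed.

Lemma dirdiff_gt phi x v (c : R) : differentiable phi x -> c < dotv (grad phi x) v ->
  \forall s \near 0^'+, c * s < phi (x + s *: v) - phi x.
Proof.
move=> /(@dirdiff_cvg _ _ v)/cvg_dnbhs_at_right/cvgr_gt h /h; apply: filterS2; last first.
  exact: nbhs_right_gt.
by move=> s s0; rewrite ltr_pdivlMl// mulrC.
Qed.

Lemma dirdiff_ge phi x v (c : R) : differentiable phi x ->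
  (\forall s \near 0^'+, c * s <= phi (x + s *: v) - phi x) -> c <= dotv (grad phi x) v.
Proof.
move=> dphi lc; rewrite leNgt; apply/negP => /(dirdiff_lt dphi) hl.
have [s []] := filter_ex (filterI lc hl).
by move=> /le_lt_trans h /h; rewrite ltxx.
Qed.

Lemma dirdiff_le phi x v (c : R) : differentiable phi x ->
  (\forall s \near 0^'+, phi (x + s *: v) - phi x <= c * s) -> dotv (grad phi x) v <= c.
Proof.
move=> dphi lc; rewrite leNgt; apply/negP => /(dirdiff_gt dphi) hl.
have [s []] := filter_ex (filterI lc hl).
by move=> /= s1 /lt_le_trans /(_ s1); rewrite ltxx.
Qed.

Lemma near_right01 (P : R -> Prop) : (forall s, 0 < s <= 1 -> P s) ->
  \forall s \near 0^'+, P s.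
Proof.
move=> h; near=> s; apply: h; apply/andP; split; near: s.
  exact: nbhs_right_gt.
exact: nbhs_right_le.
Unshelve. all: by end_near. Qed.

(** Its main use is to differentiate under the expectation: a quadratic remainder that is uniform in
    the sample survives averaging and identifies the mean gradient as the gradient of the mean. *)
Lemma quadratic_grad phi x m (K : R) :
  (forall v, `|phi (x + v) - phi x - dotv m v| <= K * enorm v ^+ 2) -> grad phi x = m.
Proof.
move=> h; apply/rowP => i; rewrite mxE; apply/cvg_lim => //.
rewrite -(dotv_delta m i); set e := delta_mx 0 i.
have K0 : 0 <= K * enorm e ^+ 2 by apply: le_trans (h e).
apply/cvgrPdist_le => /= eps eps0; near=> s.
have s0 : s != 0 by near: s; exact: nbhs_dnbhs_neq.
have := h (s *: e); rewrite enormZ dotvZr exprMn => hs.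
rewrite distrC [_ *: _]/(_ * _) -[X in _ - X](mulKf s0) -mulrBr normrM.
rewrite normfV ler_pdivrMl ?normr_gt0// (addrC (s *: e)) (le_trans hs)//.
rewrite mulrCA expr2 -mulrA ler_wpM2l//.
have : `|s| * (1 + K * enorm e ^+ 2) <= eps.
  rewrite -ler_pdivlMr ?ltr_pwDl//; near: s; apply: dnbhs0_le.
  by rewrite divr_gt0// ltr_pwDl.
by apply: le_trans; rewrite ler_wpM2l// lerDr.
Unshelve. all: by end_near. Qed.

(** Mean value theorem for [h] minus the quadratic [dh 0 * s + K / 2 * s ^+ 2], a function with
    nonpositive derivative; no integration is involved. *)
Lemma quadratic_upper (h dh : R -> R) (K : R) :
  (forall s : R, 0 <= s <= 1 -> is_derive s 1 h (dh s)) ->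
  (forall s, 0 <= s <= 1 -> dh s - dh 0 <= K * s) -> h 1 - h 0 - dh 0 <= K / 2.
Proof.
move=> hd hK; pose g := h - (dh 0 *: id + (K / 2) *: (id ^+ 2)) : R -> R.
have gd (s : R) : 0 <= s <= 1 -> is_derive s 1 g (dh s - (dh 0 + K * s)).
  move=> /hd hs.
  have := is_deriveB hs (is_deriveD (is_deriveZ (dh 0) (is_derive_id s 1))
    (is_deriveZ (K / 2) (is_deriveX 2 (is_derive_id s 1)))).
  by congr is_derive; rewrite /GRing.scale/= expr1; field.
have [|||c] := @MVT R g (fun s => dh s - (dh 0 + K * s)) 0 1 => //.
- by move=> s; rewrite in_itv/= => /andP[/ltW s0 /ltW s1]; apply: gd; rewrite s0.
- apply: derivable_within_continuous => s; rewrite in_itv/= => s01.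
  by have := gd s s01 => /@ex_derive.
rewrite in_itv/= => /andP[/ltW c0 /ltW c1]; rewrite subr0 mulr1 => gE.
have := hK c; rewrite c0 c1 => /(_ isT).
have : g 1 - g 0 = h 1 - h 0 - dh 0 - K / 2.
  by rewrite /g !fctE /GRing.scale /=; ring.
lra.
Qed.

Definition segment_in (A : set 'rV[R]_n) x y :=
  forall s : R, 0 <= s <= 1 -> A (x + s *: (y - x)).

(** Only the segment has to lie in [A], because the constraint surrogates are smooth on the feasible
    set alone. *)
Lemma descent_upper (L : R) (A : set 'rV[R]_n) phi x y : Lsmooth_on L A phi ->
  segment_in A x y ->
  phi y - phi x - dotv (grad phi x) (y - x) <= L / 2 * enorm (y - x) ^+ 2.
Proof.
move=> [dphi Lphi] xyA; pose h s := phi (x + s *: (y - x)).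
pose dh s := dotv (grad phi (x + s *: (y - x))) (y - x).
have A0 := xyA 0; rewrite lexx ler01 scale0r addr0 in A0.
have := @quadratic_upper h dh (L * enorm (y - x) ^+ 2).
rewrite /h /dh scale0r scale1r addr0 subrKC => /(_ _ _)/le_trans; apply.
- by move=> s s01; apply: is_derive_line; apply/dphi/xyA.
- move=> s /[dup] s01 /andP[s0 s1]; rewrite -dotvBl.
  rewrite (le_trans (dotv_le_enorm _ _))// mulrAC expr2 mulrA ler_wpM2r ?enorm_ge0//.
  rewrite (le_trans (Lphi _ _ (xyA s s01) (A0 isT)))//.
  by rewrite (addrC x) addrK enormZ ger0_norm// mulrA.
- lra.
Qed.

Lemma descent_lower (L : R) (A : set 'rV[R]_n) phi x y : Lsmooth_on L A phi ->
  segment_in A x y ->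
  - (L / 2 * enorm (y - x) ^+ 2) <= phi y - phi x - dotv (grad phi x) (y - x).
Proof.
move=> [dphi Lphi] xyA; pose h s := - phi (x + s *: (y - x)).
pose dh s := - dotv (grad phi (x + s *: (y - x))) (y - x).
have A0 := xyA 0; rewrite lexx ler01 scale0r addr0 in A0.
have := @quadratic_upper h dh (L * enorm (y - x) ^+ 2).
rewrite /h /dh scale0r scale1r addr0 subrKC => H.
suff : - phi y - - phi x - - dotv (grad phi x) (y - x) <= L * enorm (y - x) ^+ 2 / 2 by lra.
apply: H.
- move=> s s01; apply: is_deriveN; apply: is_derive_line; apply/dphi/xyA => //.
- move=> s /[dup] s01 /andP[s0 s1]; rewrite -opprD -dotvBl -dotvNl opprB.
  rewrite (le_trans (dotv_le_enorm _ _))// mulrAC expr2 mulrA ler_wpM2r ?enorm_ge0//.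
  rewrite (le_trans (Lphi _ _ (A0 isT) (xyA s s01)))//.
  by rewrite opprD addNKr enormN enormZ ger0_norm// mulrA.
Qed.

End Calculus.

(** * Convexity and Lagrange multipliers *)

Section Convexity.
Context (R : realType) (n : nat).
Implicit Types (x y z v : 'rV[R]_n) (phi u p a : 'rV[R]_n -> R) (C D : set 'rV[R]_n).

(** Stands in for passages to the limit with an error linear in [e]. If [A] were negative, the
    chosen [e] would keep the error below [- A / 2]. *)
Lemma ge0_affine_lim (A B : R) : (forall e, 0 < e <= 1 -> 0 <= A + e * B) -> 0 <= A.
Proof.
move=> h; have [|A0] := leP 0 A => //.
have B0 : 0 < B by have := h 1; rewrite ltr01 lexx => /(_ isT); lra.
pose e := Num.min 1 (- A / (2 * B)).
have e0 : 0 < e by rewrite /e lt_min ltr01 divr_gt0// ?oppr_gt0// mulr_gt0.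
have e1 : e <= 1 by rewrite /e ge_min lexx.
have : e * B <= - A / 2.
  by rewrite -ler_pdivlMr// -mulrA -invfM /e ge_min lexx orbT.
have := h e; rewrite e0 e1 => /(_ isT); lra.
Qed.

Lemma convexE x y (s : R) : x + s *: (y - x) = s *: y + (1 - s) *: x.
Proof. by rewrite scalerBr scalerBl scale1r addrCA. Qed.

(** Convexity is required on the single segment from [x] to [y], so that the bound also covers
    surrogates that are convex on the feasible set only. *)
Lemma convex_first_order (mu : R) phi x y : 0 <= mu -> differentiable phi x ->
  (forall l, 0 <= l <= 1 -> phi (l *: y + (1 - l) *: x) <=
     l * phi y + (1 - l) * phi x - mu / 2 * l * (1 - l) * enorm (y - x) ^+ 2) ->
  phi x + dotv (grad phi x) (y - x) + mu / 2 * enorm (y - x) ^+ 2 <= phi y.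
Proof.
move=> mu0 dphi h; set Q := enorm _ ^+ 2 in h *.
have Q0 : 0 <= Q by exact: sqr_ge0.
suff : 0 <= phi y - (phi x + dotv (grad phi x) (y - x) + mu / 2 * Q) by lra.
apply: (@ge0_affine_lim _ (mu / 2 * Q)) => e /andP[e0 e1].
suff : dotv (grad phi x) (y - x) <= phi y - phi x - mu / 2 * Q + e * (mu / 2 * Q) by lra.
apply: dirdiff_le => //; near=> s.
have s0 : 0 < s by near: s; exact: nbhs_right_gt.
have se : s <= e by near: s; exact: nbhs_right_le.
rewrite convexE; have := h s; rewrite (ltW s0) (le_trans se e1) => /(_ isT).
have es0 : 0 <= e - s by rewrite subr_ge0.
have := mulr_ge0 (mulr_ge0 (mulr_ge0 mu0 Q0) (ltW s0)) es0; nra.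
Unshelve. all: by end_near. Qed.

Definition convex_closed D := forall x y (l : R), D x -> D y -> 0 <= l <= 1 ->
  D (l *: x + (1 - l) *: y).

Definition convex_on D u := forall x y (l : R), D x -> D y -> 0 <= l <= 1 ->
  u (l *: x + (1 - l) *: y) <= l * u x + (1 - l) * u y.

(** Compare [x] with the point at a fraction [e] of the way to [y], divide by [e], and let [e] tend
    to 0. *)
Lemma argmin_growth (mu : R) C phi u x y : 0 <= mu -> convex_closed C -> convex_on C u ->
  strongly_convex mu phi -> C x -> C y ->
  (forall z, C z -> phi x + u x <= phi z + u z) ->
  phi x + u x + mu / 2 * enorm (y - x) ^+ 2 <= phi y + u y.
Proof.
move=> mu0 cC cu cphi Cx Cy xmin; set Q := enorm _ ^+ 2.
have Q0 : 0 <= Q by exact: sqr_ge0.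
suff : 0 <= phi y + u y - (phi x + u x + mu / 2 * Q) by lra.
apply: (@ge0_affine_lim _ (mu / 2 * Q)) => e /andP[e0 e1].
have e01 : 0 <= e <= 1 by rewrite (ltW e0).
have := xmin _ (cC y x e Cy Cx e01).
have := cu y x e Cy Cx e01; have := cphi y x e e01; rewrite -/Q => h1 h2 h3.
have : 0 <= e * (phi y + u y - (phi x + u x + mu / 2 * Q) + e * (mu / 2 * Q)) by nra.
by rewrite pmulr_rge0.
Qed.

Lemma affine_convex_on D (b : R) v x : convex_on D (fun y => b + dotv v (y - x)).
Proof.
move=> y z l _ _ _; rewrite le_eqVlt; apply/orP; left; apply/eqP.
by rewrite !dotvBr dotvDr !dotvZr; ring.
Qed.

Lemma convex_onD D p q : convex_on D p -> convex_on D q -> convex_on D (fun y => p y + q y).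
Proof. by move=> cp cq x y l Dx Dy l01; have := cp x y l Dx Dy l01; have := cq x y l Dx Dy l01; lra. Qed.

Lemma convex_onZ D p (l : R) : 0 <= l -> convex_on D p -> convex_on D (fun y => l * p y).
Proof.
move=> l0 cp x y t Dx Dy t01.
have := ler_wpM2l l0 (cp x y t Dx Dy t01); lra.
Qed.

Lemma convex_on_sub D E u : E `<=` D -> convex_on D u -> convex_on E u.
Proof. by move=> ED cu x y l /ED Dx /ED Dy; exact: cu. Qed.

Lemma lagrange1_claim D p a y z : convex_closed D -> convex_on D p -> convex_on D a ->
  (forall y, D y -> a y < 0 -> 0 <= p y) -> D y -> D z -> 0 <= a y -> a z < 0 ->
  0 <= - a z * p y + a y * p z.
Proof.
move=> cD cp ca pa Dy Dz ay az.
apply: (@ge0_affine_lim _ (- a z * (p z - p y))) => e /andP[e0 e1].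
have AB : 0 < a y - a z by lra.
(* This weight makes the interpolated value of [a] equal to [e * a z], which is negative, so that
   [pa] applies; [e = 0] would be the zero crossing. *)
pose l := (1 - e) * (- a z) / (a y - a z).
have lE : l * (a y - a z) = (1 - e) * (- a z) by rewrite /l divfK// gt_eqF.
have l0 : 0 <= l by rewrite /l mulr_ge0 ?invr_ge0 ?(ltW AB)// mulr_ge0//; lra.
have l1 : l <= 1 by rewrite -(ler_pM2r AB) lE; nra.
have l01 : 0 <= l <= 1 by rewrite l0.
have := ca _ _ _ Dy Dz l01; have := cp _ _ _ Dy Dz l01.
have := pa _ (cD _ _ _ Dy Dz l01) => h hp ha.
have {}/h h : a (l *: y + (1 - l) *: z) < 0.
  apply: le_lt_trans ha _; have := mulr_gt0 e0 (_ : 0 < - a z); lra.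
have := mulr_ge0 (le_trans h hp) (ltW AB).
rewrite (_ : _ * _ = l * (a y - a z) * p y + (a y - a z - l * (a y - a z)) * p z);
  last by ring.
rewrite lE; lra.
Qed.

(** A multiplier must be at least [- p y / a y] where [0 < a y] and at most [p z / - a z] where
    [a z < 0]. By the preceding claim every lower bound is below every upper bound, so the supremum
    of the lower bounds and 0 is a multiplier. The Slater point [y0] makes it finite and settles the
    points with [a y = 0]. *)
Lemma lagrange1 D p a y0 : convex_closed D -> convex_on D p -> convex_on D a ->
  (forall y, D y -> a y < 0 -> 0 <= p y) -> D y0 -> a y0 < 0 ->
  exists2 lam, 0 <= lam & forall y, D y -> 0 <= p y + lam * a y.
Proof.
move=> cD cp ca pa Dy0 ay0; have H := lagrange1_claim cD cp ca pa.
pose S := [set r | r = 0 \/ exists y, [/\ D y, 0 < a y & r = - p y / a y]].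
have ubS z : D z -> a z < 0 -> ubound S (p z / - a z).
  move=> Dz az r [->|[y [Dy ay ->]]]; first by rewrite divr_ge0 ?pa// oppr_ge0 ltW.
  rewrite ler_pdivrMr// mulrAC ler_pdivlMr ?oppr_gt0//.
  by have := H y z Dy Dz (ltW ay) az; lra.
have supS : has_sup S by split; [exists 0; left|exists (p y0 / - a y0); exact: ubS].
exists (sup S); first by apply: ub_le_sup; [case: supS|left].
move=> y Dy; have [ay|ay|ay] := ltgtP (a y) 0.
- have : sup S <= p y / - a y by apply: ge_sup; [case: supS|exact: ubS].
  by rewrite ler_pdivlMr ?oppr_gt0//; lra.
- have : - p y / a y <= sup S by apply: ub_le_sup; [case: supS|right; exists y].
  by rewrite ler_pdivrMr//; lra.
- rewrite ay mulr0 addr0; have := H y y0 Dy Dy0; rewrite ay lexx mul0r addr0 => /(_ isT ay0).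
  by rewrite pmulr_rge0// oppr_gt0.
Qed.

(** Induction on the number of constraints: the first one is dualized over the part of [D] where the
    others hold strictly, and its term then joins the objective. The same Slater point serves at
    every stage. *)
Lemma lagrange m (a : 'I_m -> 'rV[R]_n -> R) D p y0 :
  convex_closed D -> convex_on D p -> (forall k, convex_on D (a k)) ->
  (forall y, D y -> (forall k, a k y < 0) -> 0 <= p y) -> D y0 -> (forall k, a k y0 < 0) ->
  exists2 lam : 'I_m -> R, forall k, 0 <= lam k &
    forall y, D y -> 0 <= p y + \sum_k lam k * a k y.
Proof.
elim: m a p => [|m IH] a p cD cp ca pa Dy0 ay0.
  exists (fun=> 0) => // y Dy; rewrite big_ord0 addr0; apply: pa => //; by case.
pose D' := D `&` [set y | forall k, a (lift ord0 k) y < 0].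
have D'D : D' `<=` D by move=> y [].
have cD' : convex_closed D'.
  move=> x y l [Dx ax] [Dy ay] l01; split; first exact: cD.
  move=> k /=; apply: le_lt_trans (ca _ _ _ _ Dx Dy l01) _.
  have := ax k; have := ay k; move: l01 => /andP[l0 l1].
  have [->|ln0] := eqVneq l 0; first by lra.
  have lp : 0 < l by rewrite lt_def ln0.
  by nra.
have [|||lam0 lam00 h0] := @lagrange1 D' p (a ord0) y0 cD' (convex_on_sub D'D cp)
  (convex_on_sub D'D (ca ord0)).
- move=> y [Dy ay] ay0'; apply: pa => // k; case: (unliftP ord0 k) => [j ->|->//].
  exact: ay.
- by split => // k; exact: ay0.
- exact: ay0.
have [|||||lam lam_ge0 h] := IH (fun k => a (lift ord0 k)) (fun y => p y + lam0 * a ord0 y) cD.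
- exact/convex_onD/convex_onZ.
- by move=> k; exact: ca.
- by move=> y Dy ay; apply: h0.
- exact: Dy0.
- by move=> k; exact: ay0.
exists (fun k => if unlift ord0 k is Some j then lam j else lam0).
  by move=> k; case: (unlift ord0 k).
move=> y Dy; rewrite big_ord_recl unlift_none addrA.
by under eq_bigr do rewrite liftK; exact: h.
Qed.

(** The objective part [phi] and the constraints are linearized at [x], while [u] is kept. Where all
    linearized constraints are negative, short steps from [x] in that direction stay feasible, so
    minimality bounds the directional derivative of [phi] and [lagrange] applies to convex data. *)
Lemma kkt_multipliers m (con : 'I_m -> 'rV[R]_n -> R) D phi u x y0 :
  convex_closed D -> convex_on D u -> differentiable phi x ->
  (forall k, differentiable (con k) x) -> D x -> (forall k, con k x <= 0) ->
  (forall y, D y -> (forall k, con k y <= 0) -> phi x + u x <= phi y + u y) ->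
  D y0 -> (forall k, con k x + dotv (grad (con k) x) (y0 - x) < 0) ->
  exists2 lam : 'I_m -> R, forall k, 0 <= lam k &
    forall y, D y -> 0 <= dotv (grad phi x) (y - x) + (u y - u x) +
      \sum_k lam k * (con k x + dotv (grad (con k) x) (y - x)).
Proof.
move=> cD cu dphi dcon Dx conx xmin Dy0 cony0.
apply: (lagrange (y0 := y0)) => //.
- have -> : (fun y => dotv (grad phi x) (y - x) + (u y - u x)) =
    (fun y => (- u x + dotv (grad phi x) (y - x)) + u y) by apply/funext => y; ring.
  by apply: convex_onD => //; exact: affine_convex_on.
- by move=> k; exact: affine_convex_on.
move=> y Dy cony; suff : u x - u y <= dotv (grad phi x) (y - x) by lra.
apply: dirdiff_ge => //.
have : \forall s \near 0^'+, forall k, con k (x + s *: (y - x)) - con k x < - con k x * s.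
  by apply: filter_forall => k; apply: dirdiff_lt => //; have := cony k; lra.
apply: filterS2 (@near_right01 _ (fun s => 0 < s <= 1) (fun _ => id)) => s /andP[s0 s1] hs.
have s01 : 0 <= s <= 1 by rewrite ltW.
have := xmin (x + s *: (y - x)); rewrite {1 4}convexE => /(_ (cD _ _ _ Dy Dx s01)) h.
have {}/h : forall k, con k (x + s *: (y - x)) <= 0.
  move=> k; have := hs k; have := conx k => c0 ck.
  have : con k x * (1 - s) <= 0 by rewrite mulr_le0_ge0// subr_ge0.
  lra.
have := cu _ _ _ Dy Dx s01; lra.
Qed.

End Convexity.

(** * Measurability of random vectors and selections *)

Section Measurability.
Context (R : realType).

Definition ratv n (q : 'rV[rat]_n) : 'rV[R]_n := map_mx ratr q.

Lemma ratv_dense n (x : 'rV[R]_n) (e : R) : 0 < e ->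
  exists q, forall i, `|ratv q 0 i - x 0 i| < e.
Proof.
move=> e0; have H i : exists q : rat, `|ratr q - x 0 i| < e.
  have : x 0 i - e < x 0 i + e by lra.
  move=> /rat_in_itvoo[q]; rewrite in_itv/= => /andP[q1 q2]; exists q.
  by rewrite ltr_norml; apply/andP; split; lra.
have [f fP] := choice H.
by exists (\row_i f i) => i; rewrite !mxE.
Qed.

Lemma ratv_dense_norm n (x : 'rV[R]_n) (e : R) : 0 < e -> exists q, `|ratv q - x| < e.
Proof.
move=> e0; have [q qe] := ratv_dense x e0; exists q.
rewrite [`|_|]mx_normrE; apply/bigmax_ltP; split => // -[i j] _ /=.
by rewrite ord1 !mxE; have := qe j; rewrite mxE.
Qed.

Context d (T : measurableType d).

Lemma measurable_ex (I : countType) (A : I -> set T) :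
  (forall i, measurable (A i)) -> measurable [set w | exists i, A i w].
Proof.
move=> mA; rewrite (_ : [set _ | _] = \bigcup_i A i).
  exact: countable_bigcupT_measurable.
by apply/seteqP; split=> [w [i Ai]|w [i _ Ai]]; exists i.
Qed.

Lemma measurable_all (I : countType) (A : I -> set T) :
  (forall i, measurable (A i)) -> measurable [set w | forall i, A i w].
Proof.
move=> mA; rewrite (_ : [set _ | _] = ~` [set w | exists i, ~ A i w]).
  by apply/measurableC/measurable_ex => i; exact: measurableC.
by apply/seteqP; split=> [w h [i]|w /forallNP h i]; [exact|exact: contrapT].
Qed.

Lemma measurable_le_set (f g : T -> R) : measurable_fun setT f -> measurable_fun setT g ->
  measurable [set w | f w <= g w].
Proof. by move=> mf mg; rewrite -[X in measurable X]setTI; exact: measurable_fun_le. Qed.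

Lemma measurable_lt_set (f g : T -> R) : measurable_fun setT f -> measurable_fun setT g ->
  measurable [set w | f w < g w].
Proof.
move=> mf mg; rewrite (_ : [set _ | _] = ~` [set w | g w <= f w]).
  exact/measurableC/measurable_le_set.
by apply/seteqP; split => w /=; rewrite ltNge => /negP.
Qed.

Lemma measurable_imply (P : Prop) (A : set T) : measurable A -> measurable [set w | P -> A w].
Proof.
move=> mA; have [p|np] := pselect P.
  by rewrite (_ : [set _ | _] = A)//; apply/seteqP; split => w /=; auto.
by rewrite (_ : [set _ | _] = setT)//; apply/seteqP; split=> // w _ /np.
Qed.

Lemma measurable_fun_of_le (f : T -> R) : (forall a, measurable [set w | f w <= a]) ->
  measurable_fun setT f.
Proof.
move=> mf; apply: (measurability _ (RGenOInfty.measurableE R)) => _ [_ [a ->] <-].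
rewrite setTI (_ : _ @^-1` _ = ~` [set w | f w <= a]); first exact: measurableC.
by apply/seteqP; split => w /=; rewrite in_itv/= andbT ltNge => /negP.
Qed.

Lemma measurable_fun_of_lt (f : T -> R) : (forall a, measurable [set w | f w < a]) ->
  measurable_fun setT f.
Proof.
move=> mf; apply: (measurability _ (RGenCInfty.measurableE R)) => _ [_ [a ->] <-].
rewrite setTI (_ : _ @^-1` _ = ~` [set w | f w < a]); first exact: measurableC.
by apply/seteqP; split => w /=; rewrite in_itv/= andbT leNgt => /negP.
Qed.

Lemma random_vector_open n (V : T -> 'rV[R]_n) (B : set 'rV[R]_n) : random_vector V ->
  open B -> measurable [set w | B (V w)].
Proof.
move=> mV oB; have := mV measurableT B; rewrite setTI; apply.
exact: sub_sigma_algebra.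
Qed.

Lemma open_lt_comp n (f : 'rV[R]_n -> R) (a : R) : continuous f -> open [set v | f v < a].
Proof.
move=> cf; apply: (@open_comp _ _ f [set r | r < a]); last exact: open_lt.
by move=> v _; exact: cf.
Qed.

Lemma random_vectorP n (V : T -> 'rV[R]_n) :
  random_vector V <-> forall i, measurable_fun setT (fun w => V w 0 i).
Proof.
split=> [mV i|mV].
  apply: measurable_fun_of_lt => a.
  apply: (@random_vector_open _ _ [set v | v 0 i < a] mV).
  by apply: (@open_lt_comp _ (fun v => v 0 i)); exact: coord_continuous.
apply: (@measurability _ _ T (borel R n) setT V (@open 'rV[R]_n)) => // _ [B oB <-]; rewrite setTI.
(* An open set is the countable union of the balls with rational center and radius [1 / (k + 1)]
   that it contains, and such a ball is a product of intervals. *)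
rewrite (_ : _ @^-1` _ = [set w | exists qk : 'rV[rat]_n * nat,
    (ball (ratv qk.1) (qk.2.+1%:R^-1) `<=` B) /\ ball (ratv qk.1) (qk.2.+1%:R^-1) (V w)]).
  apply: measurable_ex => -[q k] /=.
  have [qB|qB] := pselect (ball (ratv q) k.+1%:R^-1 `<=` B); last first.
    by rewrite [X in measurable X](_ : _ = set0)//; apply/seteqP; split=> // w [].
  rewrite [X in measurable X](_ : _ = [set w | forall i, `|ratv q 0 i - V w 0 i| < k.+1%:R^-1]).
    apply: measurable_all => i; apply: measurable_lt_set => //.
    by apply: measurableT_comp => //; exact: measurable_funB.
  apply/seteqP; split=> [w [_ [_ h]] i|w h]; first exact: h.
  split=> //; split; first by rewrite invr_gt0.
  by move=> i j; rewrite ord1; exact: h.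
apply/seteqP; split=> w /=; last by move=> [[q k]/= [h]]; exact: h.
move=> BV; have /nbhs_ballP[e /= e0 eB] : nbhs (V w) B by exact: open_nbhs_nbhs.
have [k] : exists k : nat, 0 + k.+1%:R^-1 < e / 2 by apply: ltr_add_invr; exact: divr_gt0.
rewrite add0r => ke; have k0 : 0 < k.+1%:R^-1 :> R by rewrite invr_gt0.
have [q qV] := ratv_dense (V w) k0; exists (q, k) => /=.
have bq : ball (ratv q) k.+1%:R^-1 (V w) by split => // i j; rewrite ord1; exact: qV.
split=> // v qv; apply: eB; apply: (@ball_splitl _ _ (ratv q)).
  by apply: ball_sym; apply: le_ball bq; exact: ltW.
by apply: ball_sym; apply: le_ball qv; exact: ltW.
Qed.

Lemma measurable_comp_continuous n (f : 'rV[R]_n -> R) (V : T -> 'rV[R]_n) : continuous f ->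
  random_vector V -> measurable_fun setT (fun w => f (V w)).
Proof.
move=> cf mV; apply: measurable_fun_of_lt => a.
by apply: (@random_vector_open _ _ [set v | f v < a] mV); exact: open_lt_comp.
Qed.

Lemma random_vector_cst n (v : 'rV[R]_n) : random_vector (fun _ : T => v).
Proof. exact: measurable_cst. Qed.

Lemma random_vectorD n (V W : T -> 'rV[R]_n) : random_vector V -> random_vector W ->
  random_vector (fun w => V w + W w).
Proof.
move=> /random_vectorP mV /random_vectorP mW; apply/random_vectorP => i.
by under eq_fun do rewrite mxE; exact: measurable_funD.
Qed.

Lemma random_vectorZ n (f : T -> R) (V : T -> 'rV[R]_n) : measurable_fun setT f ->
  random_vector V -> random_vector (fun w => f w *: V w).
Proof.
move=> mf /random_vectorP mV; apply/random_vectorP => i.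
by under eq_fun do rewrite mxE; exact: measurable_funM.
Qed.

Lemma random_vectorN n (V : T -> 'rV[R]_n) : random_vector V -> random_vector (fun w => - V w).
Proof.
move=> mV; under eq_fun do rewrite -scaleN1r; exact: random_vectorZ.
Qed.

Lemma random_vectorB n (V W : T -> 'rV[R]_n) : random_vector V -> random_vector W ->
  random_vector (fun w => V w - W w).
Proof. by move=> mV mW; apply: random_vectorD => //; exact: random_vectorN. Qed.

Lemma random_vector_sum n (I : finType) (V : I -> T -> 'rV[R]_n) :
  (forall i, random_vector (V i)) -> random_vector (fun w => \sum_i V i w).
Proof.
move=> mV; apply/random_vectorP => j; under eq_fun do rewrite summxE.
by apply: measurable_sum => i; move: j; apply/random_vectorP.
Qed.

Lemma measurable_dotv n (V W : T -> 'rV[R]_n) : random_vector V -> random_vector W ->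
  measurable_fun setT (fun w => dotv (V w) (W w)).
Proof.
move=> /random_vectorP mV /random_vectorP mW.
by apply: measurable_sum => i; exact: measurable_funM.
Qed.

Lemma measurable_sqrt (f : T -> R) : measurable_fun setT f ->
  measurable_fun setT (fun w => Num.sqrt (f w)).
Proof.
by move=> mf; apply: measurableT_comp => //; apply: continuous_measurable_fun; exact: sqrt_continuous.
Qed.

Lemma measurable_enorm n (V : T -> 'rV[R]_n) : random_vector V ->
  measurable_fun setT (fun w => enorm (V w)).
Proof. by move=> mV; apply: measurable_sqrt; exact: measurable_dotv. Qed.

End Measurability.

Section RowContinuity.
Context (R : realType) (m : nat).

Lemma continuous_sum (I : finType) (f : I -> 'rV[R]_m -> R) :
  (forall i, continuous (f i)) -> continuous (fun p => \sum_i f i p).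
Proof.
move=> cf p; have Fp := nbhs_filter p.
by apply: (@cvg_big _ _ _ _ _ _ _ _ _ f) => [|i _]; [exact: add_continuous|exact: cf].
Qed.

Lemma dotv_continuous : continuous (fun p : 'rV[R]_m => dotv p p).
Proof.
by apply: continuous_sum => i p; apply: (cvgM (@coord_continuous _ _ _ _ _ p)); exact: coord_continuous.
Qed.

Lemma dotvr_continuous (v : 'rV[R]_m) : continuous (fun p : 'rV[R]_m => dotv p v).
Proof.
apply: continuous_sum => i p; exact: (cvgM (@coord_continuous _ _ _ _ _ p) (cvg_cst _)).
Qed.

Lemma enorm_subr_continuous (v : 'rV[R]_m) : continuous (fun p : 'rV[R]_m => enorm (v - p) ^+ 2).
Proof.
have -> : (fun p => enorm (v - p) ^+ 2) = (fun p => dotv p p - dotv p (2 *: v) + dotv v v).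
  by apply/funext => p; rewrite enorm_sqr !(dotvBl, dotvBr, dotvZr) (dotvC v p); ring.
move=> p; exact: (cvgD (cvgB (@dotv_continuous p) (@dotvr_continuous _ p)) (cvg_cst _)).
Qed.

End RowContinuity.

(** * Solutions of countable systems of continuous inequalities depending measurably on a
    parameter *)

Section ImplicitMeasurability.
Context (R : realType) d (T : measurableType d) (m : nat).
Implicit Types (p : 'rV[R]_m).

Let box (M : R) := [set v : 'rV[R]_m | forall i, v 0 i \in `[- M, M]].

Let box_compact M : compact (box M).
Proof. by apply: (@rV_compact R m (fun=> `[- M, M]%classic)) => _; exact: segment_compact. Qed.

Let normr_box M v : `|v| <= M -> box M v.
Proof.
move=> vM i; rewrite in_itv/= -ler_norml; exact: le_trans (coord_le_norm _ _) vM.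
Qed.

(** Trades an uncountable quantifier for countable ones: rational solutions up to a vanishing slack,
    in a fixed compact box, cluster at an exact solution. *)
Let solution_slack (F : nat -> 'rV[R]_m -> R) : (forall k, continuous (F k)) ->
  (exists p, forall k, F k p <= 0) <->
  (exists M : nat, forall N : nat, exists q, (`|ratv R q : 'rV[R]_m| <= M%:R) /\
     forall k, (k <= N)%N -> F k (ratv R q) <= N.+1%:R^-1).
Proof.
move=> cF; split=> [[p Fp]|[M /choice[f fP]]].
  have [M pM] : exists M : nat, `|p| + 1 <= M%:R.
    by exists (Num.bound (`|p| + 1)); rewrite ltW// archi_boundP// addr_ge0.
  exists M => N.
  have /filter_forall : forall k : 'I_N.+1, nbhs p [set x | F k x < N.+1%:R^-1].
    by move=> k; have /cvgr_lt := cF k p; apply; rewrite (le_lt_trans (Fp _))// invr_gt0.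
  move=> /nbhs_ballP[e /= e0 eN].
  have e10 : 0 < Num.min e 1 by rewrite lt_min e0 ltr01.
  have [q] := ratv_dense_norm p e10; rewrite lt_min => /andP[qe q1].
  exists q; split; first by have := ler_normD p (ratv R q - p); rewrite subrKC; lra.
  move=> k kN; have := eN (ratv R q); rewrite -ball_normE /= distrC => /(_ qe (inord k)).
  by rewrite inordK// => /ltW.
have [p [_ clp]] : box M%:R `&` cluster ((ratv R (f N) : 'rV[R]_m) @[N --> \oo]) !=set0.
  have fbox N : box M%:R (ratv R (f N)) by apply: normr_box; have [] := fP N.
  by apply: box_compact; exists 0 => // N _; exact: fbox.
exists p => k; rewrite leNgt; apply/negP => Fkp.
have : nbhs p [set x | F k p / 2 < F k x].
  have /cvgr_gt := cF k p; apply; lra.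
have : \forall N \near \oo, F k (ratv R (f N)) <= F k p / 2.
  near=> N; have [_ /(_ k) h] := fP N; apply: le_trans (h _) _.
    by near: N; exact: nbhs_infty_ge.
  apply: ltW; near: N.
  have Fkp2 : 0 < F k p / 2 by lra.
  exact: (near_infty_natSinv_lt (PosNum Fkp2)).
move=> h1 h2; have [x [/= hx1]] := clp [set x | F k x <= F k p / 2] _ h1 h2.
by rewrite ltNge hx1.
Unshelve. all: by end_near. Qed.

Lemma continuous_subr (f : 'rV[R]_m -> R) (a : R) : continuous f ->
  continuous (fun p => f p - a).
Proof. by move=> cf p; exact: (cvgB (cf p) (cvg_cst a)). Qed.

Lemma measurable_exists_solution (I : countType) (F : I -> T -> 'rV[R]_m -> R) :
  (forall i w, continuous (F i w)) -> (forall i p, measurable_fun setT (F i ^~ p)) ->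
  measurable [set w | exists p, forall i, F i w p <= 0].
Proof.
move=> cF mF; pose F' k w := if unpickle k is Some i then F i w else fun=> 0.
have cF' w k : continuous (F' k w).
  by rewrite /F'; case: (unpickle k) => [i|]; [exact: cF|exact: cst_continuous].
have mF' k p : measurable_fun setT (F' k ^~ p).
  by rewrite /F'; case: (unpickle k) => [i|]; [exact: mF|exact: measurable_cst].
rewrite (_ : [set _ | _] = [set w | exists M : nat, forall N : nat,
    exists q : 'rV[rat]_m, (`|ratv R q : 'rV[R]_m| <= M%:R) /\
     forall k, (k <= N)%N -> F' k w (ratv R q) <= N.+1%:R^-1]).
  apply: measurable_ex => M; apply: measurable_all => N; apply: measurable_ex => q.
  apply: measurableI; last first.
    by apply: measurable_all => k; apply: measurable_imply; exact: measurable_le_set.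
  exact: (@measurable_le_set _ _ _ (cst _) (cst _)).
apply/seteqP; split=> w /=; rewrite -(solution_slack (cF' w)).
  by move=> [p Fp]; exists p => k; rewrite /F'; case: (unpickle k).
by move=> [p Fp]; exists p => i; have := Fp (pickle i); rewrite /F' pickleK.
Qed.

(** Adding the inequality [p 0 j <= a] gives a system of the same kind which, by uniqueness, is
    solvable exactly when the [j]-th coordinate of [V] is at most [a]. *)
Lemma measurable_unique_solution (I : countType) (F : I -> T -> 'rV[R]_m -> R)
    (V : T -> 'rV[R]_m) :
  (forall i w, continuous (F i w)) -> (forall i p, measurable_fun setT (F i ^~ p)) ->
  (forall i w, F i w (V w) <= 0) ->
  (forall w p, (forall i, F i w p <= 0) -> p = V w) -> random_vector V.
Proof.
move=> cF mF FV uV; apply/random_vectorP => j; apply: measurable_fun_of_le => a.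
pose F' (i : option I) w p := if i is Some i then F i w p else p 0 j - a.
rewrite (_ : [set _ | _] = [set w | exists p, forall i, F' i w p <= 0]).
  apply: measurable_exists_solution => [[i w|w]|[i p|p]].
  - exact: cF.
  - apply: (@continuous_subr (fun p => p 0 j)); exact: coord_continuous.
  - exact: mF.
  - exact: measurable_cst.
apply/seteqP; split=> w /= [].
  by move=> Va; exists (V w) => -[i|] /=; rewrite ?subr_le0.
by move=> p Fp; rewrite -(uV w p) => [|i]; [rewrite -subr_le0; exact: (Fp None)|exact: (Fp (Some i))].
Qed.

(** The solution of least Euclidean norm is selected. Its squared norm is measurable, since its
    sublevel sets are again solvability conditions; bounding the squared norm by this value then
    makes the solution unique. *)
Lemma measurable_selection (I : countType) (F : I -> T -> 'rV[R]_m -> R) :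
  (forall i w, continuous (F i w)) -> (forall i p, measurable_fun setT (F i ^~ p)) ->
  (forall i w, convex_on setT (F i w)) ->
  (forall w, exists p, forall i, F i w p <= 0) ->
  exists2 V : T -> 'rV[R]_m, random_vector V & forall i w, F i w (V w) <= 0.
Proof.
move=> cF mF vF exF.
have /choice[V VP] w : exists p, (forall i, F i w p <= 0) /\
    forall p', (forall i, F i w p' <= 0) -> dotv p p <= dotv p' p'.
  have [p0 Fp0] := exF w.
  pose S := box (enorm p0) `&` \bigcap_i [set p | F i w p <= 0].
  have cS : compact S.
    apply: compact_closedI => //; apply: closed_bigI => i _.
    by have /continuous_closedP/(_ _ (@closed_le R 0)) := cF i w.
  have S0 : S p0.
    by split=> // [|i _]; [apply: normr_box; exact: norm_le_enorm|exact: Fp0].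
  have [||p] := @compact_EVT_min _ _ (fun p => dotv p p) S _ cS; first by exists p0.
    by apply: continuous_subspaceT; exact: dotv_continuous.
  rewrite inE => -[_ Fp] pmin; exists p; split=> [i|p' Fp']; first exact: Fp.
  have [pp|/ltW pp] := leP (dotv p' p') (dotv p0 p0); last first.
    by apply: le_trans pp; apply: pmin; rewrite inE.
  apply: pmin; rewrite inE; split=> [|i _]; last exact: Fp'.
  by apply: normr_box; rewrite (le_trans (norm_le_enorm _))// ler_sqrt// dotvv_ge0.
exists V; last by move=> i w; have [] := VP w.
pose r w := dotv (V w) (V w).
have mr : measurable_fun setT r.
  apply: measurable_fun_of_le => a.
  pose F' (i : option I) w p := if i is Some i then F i w p else dotv p p - a.
  rewrite (_ : [set _ | _] = [set w | exists p, forall i, F' i w p <= 0]).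
    apply: measurable_exists_solution => [[i w|w]|[i p|p]].
    - exact: cF.
    - apply: (@continuous_subr (fun p => dotv p p)); exact: dotv_continuous.
    - exact: mF.
    - exact: measurable_cst.
  apply/seteqP; split=> w /= [].
    by move=> Va; exists (V w) => -[i|] /=; rewrite ?subr_le0//; have [] := VP w.
  move=> p Fp; have [_ /(_ p)] := VP w.
  move=> /(_ (fun i => Fp (Some i)))/le_trans; apply.
  by rewrite -subr_le0; exact: (Fp None).
pose F' (i : option I) w p := if i is Some i then F i w p else dotv p p - r w.
apply: (@measurable_unique_solution _ F').
- move=> [i w|w]; first exact: cF.
  apply: (@continuous_subr (fun p => dotv p p)); exact: dotv_continuous.
- move=> [i p|p]; first exact: mF.
  by apply: measurable_funB.
- by move=> [i|] w /=; [have [] := VP w|rewrite subrr].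
move=> w p Fp; have [FV Vmin] := VP w.
have h01 : 0 <= (2^-1 : R) <= 1 by lra.
(* The midpoint of two solutions of least norm is again a solution, so the parallelogram law forces
   them to coincide. *)
have Fmid : (forall i, F i w (2^-1 *: p + (1 - 2^-1) *: V w) <= 0).
  move=> i; apply: le_trans (vF i w p (V w) _ _ _ h01) _ => //.
  by have := FV i; have := Fp (Some i) => /=; lra.
have := Fp None; rewrite /F' /r => h1; have := Vmin _ Fmid => h2.
apply/eqP; rewrite -subr_eq0; apply/eqP; apply: enorm_eq0; apply/eqP; rewrite -sqrf_eq0.
rewrite enorm_sqr; apply/eqP/le_anti; rewrite dotvv_ge0 andbT.
move: h1 h2; rewrite !(dotvDl, dotvDr, dotvNl, dotvNr, dotvZl, dotvZr) (dotvC (V w) p); lra.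
Qed.

End ImplicitMeasurability.

(** * Expectations of bounded random variables *)

Section Mean.
Context d (T : measurableType d) (R : realType) (P : probability T R).
Implicit Types (X Y : T -> R).

Definition mean X : R := \int[P]_w X w.

(** The quantities of the run that get averaged are bounded at each fixed time, so this replaces
    their integrability conditions. *)
Definition bounded_rv X := measurable_fun setT X /\ exists M, forall w, `|X w| <= M.

Lemma bounded_rv_integrable X : bounded_rv X -> P.-integrable setT (EFin \o X).
Proof.
move=> [mX [M XM]]; apply: (@le_integrable _ _ _ P setT measurableT _ (EFin \o cst M)) => //.
- exact/measurable_EFinP.
- by move=> w _ /=; rewrite lee_fin (le_trans (XM w))// ler_norm.
- exact: finite_measure_integrable_cst.
Qed.

Lemma bounded_rv_cst r : bounded_rv (fun=> r).
Proof. by split; [exact: measurable_cst|exists `|r|]. Qed.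

Lemma bounded_rvD X Y : bounded_rv X -> bounded_rv Y -> bounded_rv (fun w => X w + Y w).
Proof.
move=> [mX [M XM]] [mY [N YN]]; split; first exact: measurable_funD.
by exists (M + N) => w; rewrite (le_trans (ler_normD _ _))// lerD.
Qed.

Lemma bounded_rvM X Y : bounded_rv X -> bounded_rv Y -> bounded_rv (fun w => X w * Y w).
Proof.
move=> [mX [M XM]] [mY [N YN]]; split; first exact: measurable_funM.
by exists (M * N) => w; rewrite normrM ler_pM.
Qed.

Lemma bounded_rvN X : bounded_rv X -> bounded_rv (fun w => - X w).
Proof.
move=> bX; rewrite (_ : (fun _ => _) = fun w => -1 * X w).
  by apply: bounded_rvM => //; exact: bounded_rv_cst.
by apply/funext => w; rewrite mulN1r.
Qed.

Lemma bounded_rvB X Y : bounded_rv X -> bounded_rv Y -> bounded_rv (fun w => X w - Y w).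
Proof. by move=> bX bY; apply: bounded_rvD => //; exact: bounded_rvN. Qed.

Lemma bounded_rv_sum (I : Type) (r : seq I) (p : pred I) (X : I -> T -> R) :
  (forall i, bounded_rv (X i)) -> bounded_rv (fun w => \sum_(i <- r | p i) X i w).
Proof.
move=> bX; elim: r => [|i r IH].
  by under eq_fun do rewrite big_nil; exact: bounded_rv_cst.
under eq_fun do rewrite big_cons; case: (p i) => //.
exact: bounded_rvD.
Qed.

Lemma bounded_rv_le X Y : measurable_fun setT X -> (forall w, `|X w| <= Y w) ->
  bounded_rv Y -> bounded_rv X.
Proof.
move=> mX XY [_ [M YM]]; split=> //; exists M => w.
by rewrite (le_trans (XY w))// (le_trans _ (YM w))// ler_norm.
Qed.

Lemma meanD X Y : bounded_rv X -> bounded_rv Y -> mean (fun w => X w + Y w) = mean X + mean Y.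
Proof. by move=> bX bY; apply: RintegralD => //; exact: bounded_rv_integrable. Qed.

Lemma meanB X Y : bounded_rv X -> bounded_rv Y -> mean (fun w => X w - Y w) = mean X - mean Y.
Proof. by move=> bX bY; apply: RintegralB => //; exact: bounded_rv_integrable. Qed.

Lemma meanZ (r : R) X : bounded_rv X -> mean (fun w => r * X w) = r * mean X.
Proof. by move=> bX; apply: RintegralZl => //; exact: bounded_rv_integrable. Qed.

Lemma mean_cst (r : R) : mean (fun=> r) = r.
Proof. by rewrite /mean Rintegral_cst//= (@probability_setT _ _ _ P) mulr1. Qed.

Lemma mean_le X Y : bounded_rv X -> bounded_rv Y -> (forall w, X w <= Y w) -> mean X <= mean Y.
Proof. by move=> bX bY XY; apply: le_Rintegral => //; exact: bounded_rv_integrable. Qed.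

Lemma mean_sum (I : Type) (r : seq I) (p : pred I) (X : I -> T -> R) :
  (forall i, bounded_rv (X i)) ->
  mean (fun w => \sum_(i <- r | p i) X i w) = \sum_(i <- r | p i) mean (X i).
Proof.
move=> bX; elim: r => [|i r IH].
  by under [in LHS]eq_fun do rewrite big_nil; rewrite mean_cst big_nil.
under [in LHS]eq_fun do rewrite big_cons; rewrite big_cons; case: (p i) => //.
by rewrite meanD ?IH//; exact: bounded_rv_sum.
Qed.

Lemma normr_mean_le X (M : R) : measurable_fun setT X -> (forall w, `|X w| <= M) ->
  `|mean X| <= M.
Proof.
move=> mX XM; have bX : bounded_rv X by split => //; exists M.
have XM' w : - M <= X w <= M by rewrite -ler_norml.
rewrite ler_norml; apply/andP; split.
  rewrite -[leLHS]mean_cst; apply: mean_le => //; first exact: bounded_rv_cst.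
  by move=> w; have /andP[] := XM' w.
rewrite -[leRHS]mean_cst; apply: mean_le => //; first exact: bounded_rv_cst.
by move=> w; have /andP[] := XM' w.
Qed.

Lemma expectation_mean X : bounded_rv X -> ('E_P[X] = (mean X)%:E)%E.
Proof.
move=> bX; rewrite unlock /mean /Rintegral fineK//.
by apply: integrable_fin_num => //; exact: bounded_rv_integrable.
Qed.

End Mean.

(** * Averaging over an independent variable *)

Section Independence.
Context dO dQ dS (Om : measurableType dO) (Q : measurableType dQ) (Xi : measurableType dS).
Context (R : realType) (P : probability Om R) (D : probability Xi R).
Context (past : {RV P >-> Q}) (zeta : {RV P >-> Xi}).
Hypothesis indep : forall A B, measurable A -> measurable B ->
  P (past @^-1` A `&` zeta @^-1` B) = (P (past @^-1` A) * D B)%E.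

Lemma bounded_rv_section (h : Q * Xi -> R) q : bounded_rv h -> bounded_rv (fun s => h (q, s)).
Proof.
move=> [mh [M hM]]; split; last by exists M => s; exact: hM.
by apply: measurableT_comp => //; exact: pair1_measurable.
Qed.

Lemma EFin_mean_section (h : Q * Xi -> R) q : bounded_rv h ->
  (mean D (fun s => h (q, s)))%:E = (\int[D]_s (h (q, s))%:E)%E.
Proof.
move=> bh; rewrite /mean /Rintegral fineK//; apply: integrable_fin_num => //.
exact: (bounded_rv_integrable D (bounded_rv_section _ bh)).
Qed.

Lemma bounded_rv_mean_section (h : Q * Xi -> R) : bounded_rv h ->
  bounded_rv (fun q => mean D (fun s => h (q, s))).
Proof.
move=> bh; have [mh [M hM]] := bh; split; last first.
  by exists M => q; apply: normr_mean_le => [|s]; [case: (bounded_rv_section q bh)|exact: hM].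
apply/measurable_EFinP.
rewrite (_ : _ \o _ = (fun q => \int[D]_s (EFin \o h) (q, s))%E); last first.
  by apply/funext => q /=; exact: EFin_mean_section.
apply: (@measurable_fubini_F _ _ _ _ _ (distribution P past) D (EFin \o h)).
exact: (@bounded_rv_integrable _ _ _ (distribution P past \x D)%E h).
Qed.

(** Independence identifies the joint law with the product of the marginals; Fubini then averages
    over [zeta] first. *)
Lemma mean_indep (h : Q * Xi -> R) : bounded_rv h ->
  mean P (fun w => h (past w, zeta w)) = mean P (fun w => mean D (fun s => h (past w, s))).
Proof.
move=> bh; have [mh [M hM]] := bh.
have mj : measurable_fun setT (fun w => (past w, zeta w)).
  by apply: measurable_fun_pair.
pose joint : {RV P >-> (Q * Xi)%type} :=
  HB.pack (fun w => (past w, zeta w)) (isMeasurableFun.Build _ _ _ _ _ mj).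
have jE A : measurable A -> (distribution P past \x D)%E A = distribution P joint A.
  apply: product_measure_unique => B C mB mC.
  by rewrite -indep.
have mEh : measurable_fun setT (EFin \o h) by exact/measurable_EFinP.
have ih : P.-integrable setT ((EFin \o h) \o joint).
  apply: (@bounded_rv_integrable _ _ _ P (h \o joint)); split.
    exact: measurableT_comp.
  by exists M => w; exact: hM.
have iprod : (distribution P past \x D)%E.-integrable setT (EFin \o h).
  exact: (@bounded_rv_integrable _ _ _ (distribution P past \x D)%E h).
rewrite /mean /Rintegral; congr fine.
rewrite -[LHS](@integral_distribution _ _ _ _ _ P joint (EFin \o h))//.
rewrite (eq_measure_integral (distribution P past \x D)%E); last by move=> A mA _; exact/esym/jE.
rewrite -integral12_prod_meas1//.
have [mg [N gN]] := bounded_rv_mean_section bh.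
have gE : (fun w => (mean D (fun s => h (past w, s)))%:E) =
    (fun q => \int[D]_s (h (q, s))%:E)%E \o past.
  by apply/funext => w /=; exact: EFin_mean_section.
rewrite [in RHS]gE (@integral_distribution _ _ _ _ _ P past (fun q => \int[D]_s (h (q, s))%:E)%E)//.
  exact: (@measurable_fubini_F _ _ _ _ _ (distribution P past) D (EFin \o h)).
rewrite -gE; apply: (@bounded_rv_integrable _ _ _ P (fun w => mean D (fun s => h (past w, s)))).
split; last by exists N => w; exact: gN.
exact: (measurableT_comp mg).
Qed.

End Independence.

(** * Gradients as limits of difference quotients *)

Section GradientMeasurability.
Context (R : realType) (n : nat).

Lemma harmonic_dnbhs0 : @harmonic R @ \oo --> (0 : R)^'.
Proof.
move=> S /= S0.
have h : \forall k \near \oo, @harmonic R k != 0 -> S (harmonic k) := cvg_harmonic S0.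
by apply: filterS h => k; apply; rewrite /harmonic /= invr_eq0 pnatr_eq0.
Qed.

Lemma dirdiff_seq (phi : 'rV[R]_n -> R) (x v : 'rV[R]_n) : differentiable phi x ->
  (fun k => (@harmonic R k)^-1 * (phi (x + @harmonic R k *: v) - phi x)) @ \oo -->
    dotv (grad phi x) v.
Proof.
move=> dphi; have := cvg_comp _ _ harmonic_dnbhs0 (@dirdiff_cvg R n phi x v dphi).
exact.
Qed.

(** Each partial derivative is a limit of difference quotients with steps [1 / (k + 1)]. These leave
    the feasible set, which is why measurability is required at all offsets [v]. *)
Lemma random_vector_grad d (T : measurableType d) (phi : T -> 'rV[R]_n -> R)
    (V : T -> 'rV[R]_n) :
  (forall w, differentiable (phi w) (V w)) ->
  (forall v, measurable_fun setT (fun w => phi w (V w + v))) ->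
  random_vector (fun w => grad (phi w) (V w)).
Proof.
move=> dphi mphi; apply/random_vectorP => i.
apply: (@measurable_fun_cvg _ _ _ _ (fun k w => (@harmonic R k)^-1 *
  (phi w (V w + @harmonic R k *: delta_mx 0 i) - phi w (V w)))).
- move=> k; apply: measurable_funM => //; apply: measurable_funB => //.
  by have := mphi 0; under eq_fun do rewrite addr0.
- by move=> w _; rewrite -dotv_delta; exact: dirdiff_seq.
Qed.

Lemma lipschitz_continuous (K : R) (f : 'rV[R]_n -> R) :
  (forall x y, `|f x - f y| <= K * enorm (x - y)) -> continuous f.
Proof.
move=> fK x; have Fx := nbhs_filter x; apply/cvgrPdist_le => e e0.
have K1 : 0 < (`|K| + 1) * (n%:R + 1).
  by rewrite mulr_gt0// ltr_wpDl.
suff : \forall t \near x, `|f x - f t| <= e by [].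
apply/nbhs_ballP; exists (e / ((`|K| + 1) * (n%:R + 1))); first by rewrite /= divr_gt0.
move=> y; rewrite -ball_normE /= => /ltW.
rewrite ler_pdivlMr// => xye.
apply: le_trans (fK x y) (le_trans _ xye).
rewrite (@le_trans _ _ ((`|K| + 1) * enorm (x - y)))//.
  by rewrite ler_wpM2r ?enorm_ge0// (le_trans (ler_norm K))// lerDl.
rewrite mulrCA ler_wpM2l ?addr_ge0// (le_trans (enorm_le_norm _))// mulrC ler_wpM2l//.
by rewrite lerDl.
Qed.

Lemma enorm_grad_le (G : R) (phi : 'rV[R]_n -> R) x : 0 <= G -> differentiable phi x ->
  Lipschitz_on G setT phi -> enorm (grad phi x) <= G.
Proof.
move=> G0 dphi Lphi; set g := grad phi x.
have : dotv g g <= G * enorm g.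
  apply: dirdiff_le => //; apply: near_right01 => s /andP[s0 _].
  rewrite (le_trans (ler_norm _))// (le_trans (Lphi _ _ _ _))//.
  by rewrite (addrC x) addrK enormZ gtr0_norm// mulrA mulrAC.
have [-> //|g0] := eqVneq (enorm g) 0.
by rewrite -enorm_sqr expr2 ler_pM2r// lt_def g0 enorm_ge0.
Qed.

End GradientMeasurability.

(** * Smoothness of the expected loss *)

Section ExpectedLoss.
Context (R : realType) d (Xi : measurableType d) (D : probability Xi R) (n : nat).
Context (f : 'rV[R]_n -> Xi -> R) (L G : R).
Hypothesis intf : forall x, D.-integrable setT (EFin \o f x).
Hypothesis smoothf : forall s, Lsmooth_on L setT (f ^~ s) /\ Lipschitz_on G setT (f ^~ s).
Hypotheses (G_ge0 : 0 <= G) (L_ge0 : 0 <= L).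

Let U x := mean D (f x).

Lemma differentiable_loss x s : differentiable (f ^~ s) x.
Proof. by have [[+ _] _] := smoothf s; apply. Qed.

Lemma grad_loss_bound x s : enorm (grad (f ^~ s) x) <= G.
Proof.
by apply: enorm_grad_le => //; [exact: differentiable_loss|have [] := smoothf s].
Qed.

Lemma random_vector_grad_loss x : random_vector (fun s => grad (f ^~ s) x).
Proof.
apply: (@random_vector_grad _ _ _ _ (fun s => f ^~ s) (fun=> x)) => [s|v].
  exact: differentiable_loss.
by have /integrableP[/measurable_EFinP] := intf (x + v).
Qed.

Lemma bounded_rv_grad_loss x v : bounded_rv (fun s => dotv (grad (f ^~ s) x) v).
Proof.
split; first by apply: measurable_dotv; [exact: random_vector_grad_loss|exact: random_vector_cst].
exists (G * enorm v) => s; rewrite (le_trans (normr_dotv_le _ _))// ler_wpM2r ?enorm_ge0//.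
exact: grad_loss_bound.
Qed.

Let m x : 'rV[R]_n := \row_i mean D (fun s => grad (f ^~ s) x 0 i).

Let dotv_m x v : dotv (m x) v = mean D (fun s => dotv (grad (f ^~ s) x) v).
Proof.
have bi i : bounded_rv (fun s => grad (f ^~ s) x 0 i).
  by under eq_fun do rewrite -dotv_delta; exact: bounded_rv_grad_loss.
rewrite mean_sum => [|i]; last by apply: bounded_rvM => //; exact: bounded_rv_cst.
apply: eq_bigr => i _; rewrite mxE mulrC -meanZ//; congr (mean D _).
by apply/funext => s; rewrite mulrC.
Qed.

Lemma mean_lossB x y : bounded_rv (fun s => f y s - f x s) /\
  U y - U x = mean D (fun s => f y s - f x s).
Proof.
split; last by rewrite /U /mean RintegralB.
split; first by apply: measurable_funB; have /integrableP[/measurable_EFinP] := intf y;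
  have /integrableP[/measurable_EFinP] := intf x.
by exists (G * enorm (y - x)) => s; have [_ /(_ y x)] := smoothf s; apply.
Qed.

Let quadratic_m x y : `|U y - U x - dotv (m x) (y - x)| <= L / 2 * enorm (y - x) ^+ 2.
Proof.
have [bf ->] := mean_lossB x y; have bg := bounded_rv_grad_loss x (y - x).
rewrite dotv_m -meanB//; apply: normr_mean_le; first by have [] := bounded_rvB bf bg.
move=> s; have [sf _] := smoothf s; have seg : segment_in setT x y by [].
by rewrite ler_norml (descent_lower sf seg) (descent_upper sf seg).
Qed.

Let grad_m x : grad U x = m x.
Proof.
by apply: (quadratic_grad (K := L / 2)) => v; have := quadratic_m x (x + v); rewrite (addrC x v) addrK.
Qed.

Lemma dotv_grad_mean x v : dotv (grad U x) v = mean D (fun s => dotv (grad (f ^~ s) x) v).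
Proof. by rewrite grad_m dotv_m. Qed.

Lemma mean_loss_descent x y :
  U y <= U x + dotv (grad U x) (y - x) + L / 2 * enorm (y - x) ^+ 2.
Proof. by have := quadratic_m x y; rewrite ler_norml grad_m => /andP[_]; lra. Qed.

Let enorm_le_dual (v : 'rV[R]_n) (K : R) : 0 <= K -> `|dotv v v| <= K * enorm v -> enorm v <= K.
Proof.
move=> K0; rewrite -enorm_sqr ger0_norm ?sqr_ge0// expr2.
have [-> //|v0] := eqVneq (enorm v) 0.
by rewrite ler_pM2r// lt_def v0 enorm_ge0.
Qed.

Lemma grad_mean_lipschitz x y : enorm (grad U x - grad U y) <= L * enorm (x - y).
Proof.
apply: enorm_le_dual; first by rewrite mulr_ge0// enorm_ge0.
move: {2 3}(grad U x - grad U y) => v; rewrite dotvBl (dotv_grad_mean x) (dotv_grad_mean y).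
have bx := bounded_rv_grad_loss x v; have by' := bounded_rv_grad_loss y v.
rewrite -meanB//; apply: normr_mean_le; first by have [] := bounded_rvB bx by'.
move=> s; rewrite -dotvBl (le_trans (normr_dotv_le _ _))// ler_wpM2r ?enorm_ge0//.
by have [[_ +] _] := smoothf s; apply.
Qed.

Lemma grad_mean_bound x : enorm (grad U x) <= G.
Proof.
apply: enorm_le_dual => //; rewrite dotv_grad_mean; apply: normr_mean_le.
  by have [] := bounded_rv_grad_loss x (grad U x).
move=> s; rewrite (le_trans (normr_dotv_le _ _))// ler_wpM2r ?enorm_ge0//.
exact: grad_loss_bound.
Qed.

End ExpectedLoss.

(** * The past of an i.i.d. sequence *)

Section Filtration.
Context (R : realType) (dO dS : measure_display).
Context (Om : measurableType dO) (Xi : measurableType dS) (P : probability Om R).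
Context (D : probability Xi R) (xi : nat -> {RV P >-> Xi}).
Hypothesis iid : iid_samples D xi.
Implicit Type t : nat.

Definition cylinder t (B : nat -> set Xi) : set Om :=
  \bigcap_(i in [set` index_iota 1 t]) (xi i @^-1` B i).

Definition cylinders t : set (set Om) :=
  [set A | exists2 B, (forall i, measurable (B i)) & A = cylinder t B].

(* Om with the sigma-algebra generated by xi 1, .., xi (t - 1); xi t is excluded, hence
   independent of it. *)
Definition past t := g_sigma_algebraType (cylinders t).

Lemma measurable_sample i (B : set Xi) : measurable B -> measurable (xi i @^-1` B).
Proof. by move=> mB; rewrite -[X in measurable X]setTI; exact: measurable_funPT. Qed.

Lemma measurable_cylinder t B : (forall i, measurable (B i)) -> measurable (cylinder t B).
Proof.
by move=> mB; apply: fin_bigcap_measurable => // i _; exact: measurable_sample.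
Qed.

Lemma measurable_past_sample t i : (0 < i < t)%N ->
  measurable_fun [set: past t] (xi i : past t -> Xi).
Proof.
move=> it _ B mB; rewrite setTI; apply: sub_sigma_algebra.
exists (fun j => if j == i then B else setT) => [j|]; first by case: eqP.
apply/seteqP; split=> w /= h.
  by move=> j /=; case: eqP => [->|].
by have := h i; rewrite /= mem_index_iota eqxx; exact.
Qed.

Lemma measurable_past_id t : measurable_fun [set: Om] (id : Om -> past t).
Proof.
apply: (@measurability _ _ Om (past t) setT id (cylinders t)) => //.
by move=> _ [_ [B mB ->] <-]; rewrite setTI; exact: measurable_cylinder.
Qed.

Definition past_rv t : {RV P >-> past t} :=
  HB.pack (id : Om -> past t) (isMeasurableFun.Build _ _ _ _ _ (@measurable_past_id t)).

(** The product formula is used for the indices below [t], and once more for these together with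
    [t]. *)
Lemma cylinder_indep t (C : nat -> set Xi) (B : set Xi) : (0 < t)%N ->
  (forall i, measurable (C i)) -> measurable B ->
  P (cylinder t C `&` xi t @^-1` B) = (P (cylinder t C) * D B)%E.
Proof.
move=> t0 mC mB; have [dist prodE] := iid.
have ge1 : all (leq 1) (index_iota 1 t).
  by apply/allP => i; rewrite mem_index_iota => /andP[].
rewrite [in RHS]/cylinder prodE//; last exact: iota_uniq.
pose C' i := if i == t then B else C i.
rewrite (_ : _ `&` _ = \bigcap_(i in [set` t :: index_iota 1 t]) (xi i @^-1` C' i)).
  rewrite prodE.
  - rewrite big_cons /C' eqxx muleC; congr (_ * _)%E; last exact: dist.
    rewrite big_seq [in RHS]big_seq; apply: eq_bigr => i.
    by rewrite mem_index_iota => /andP[_ /ltn_eqF ->].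
  - by rewrite /= mem_index_iota ltnn andbF iota_uniq.
  - by rewrite /= t0.
  - by move=> i; rewrite /C'; case: ifP.
apply/seteqP; split=> w /=.
  move=> [Cw Bw] i /=; rewrite in_cons => /predU1P[->|it]; first by rewrite /C' eqxx.
  move: (it); rewrite mem_index_iota /C' => /andP[_ /ltn_eqF ->]; exact: Cw.
move=> h; split=> [i it|]; last by have := h t; rewrite /= in_cons /C' !eqxx; exact.
have := h i; rewrite /= in_cons it orbT /C' => /(_ isT).
by move: (it); rewrite /= mem_index_iota => /andP[_ /ltn_eqF ->].
Qed.

(** In [A], both sides are finite measures; they agree on the cylinders, which are closed under
    intersection and generate the past. *)
Lemma past_indep t (A : set (past t)) (B : set Xi) : (0 < t)%N ->
  measurable A -> measurable B ->
  P (past_rv t @^-1` A `&` xi t @^-1` B) = (P (past_rv t @^-1` A) * D B)%E.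
Proof.
move=> t0 mA mB; have mE : measurable (xi t @^-1` B) by exact: measurable_sample.
have DB0 : 0 <= fine (D B) by rewrite fine_ge0.
have DBE : (fine (D B))%:E = D B by rewrite fineK// fin_num_measure.
have mcyl : cylinders t `<=` measurable by move=> _ [C mC ->]; exact: measurable_cylinder.
have cylT : cylinders t setT.
  by exists (fun=> setT) => //; apply/seteqP; split.
have cylI : setI_closed (cylinders t).
  move=> _ _ [B1 mB1 ->] [B2 mB2 ->]; exists (fun i => B1 i `&` B2 i).
    by move=> i; exact: measurableI.
  by rewrite /cylinder -bigcapI; apply: eq_bigcapr => i _; rewrite preimage_setI.
have cylE C : cylinders t C -> mrestr P mE C = mscale (NngNum DB0) P C.
  by move=> [C' mC' ->]; rewrite /mrestr /mscale /= cylinder_indep// DBE muleC.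
have covT : \bigcup_(k in [set: nat]) [set: Om] = setT by apply: bigcup_const; exists 0.
have fin : nat -> (mrestr P mE setT < +oo)%E.
  by move=> _; rewrite /mrestr setTI; apply: (le_lt_trans (probability_le1 P mE)); exact: ltry.
have E : mrestr P mE A = mscale (NngNum DB0) P A.
  exact: (@g_sigma_algebra_measure_unique _ R Om (cylinders t) mcyl (fun=> setT) (fun=> cylT)
    covT (mrestr P mE) (mscale (NngNum DB0) P) cylI cylE fin A mA).
by move: E; rewrite /mrestr /mscale /= DBE muleC.
Qed.

Lemma mean_past t (h : past t * Xi -> R) : (0 < t)%N -> bounded_rv h ->
  mean P (fun w => h (w, xi t w)) = mean P (fun w => mean D (fun s => h (w, s))).
Proof.
move=> t0; apply: (mean_indep (past := past_rv t)) => A B.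
exact: past_indep.
Qed.

End Filtration.

(** * The convex subproblem and its multipliers *)

(** Near [y] the values of [u] may jump up. Moving [y] a fraction [s] towards [x0] gives the center
    of a ball whose points are convex combinations of [y] with points near [x0], where [u] is at
    most [M]; any rational point of that ball will do. *)
Lemma rational_density (R : realType) (n : nat) (D : set 'rV[R]_n) (u : 'rV[R]_n -> R)
    (x0 : 'rV[R]_n) (M : R) : convex_closed D -> convex_on D u ->
  (\forall x \near x0, D x /\ u x <= M) ->
  forall y (e : R), D y -> 0 < e ->
  exists q, [/\ D (ratv R q), `|ratv R q - y| <= e & u (ratv R q) <= u y + e].
Proof.
move=> cD cu /nbhs_ballP[r /= r0]; rewrite -ball_normE /= => DM y e Dy e0.
(* [s * K <= e] controls at once the radius of the ball, the displacement of [y] and the increase of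
   [u]. *)
pose K := r + `|x0 - y| + `|M - u y| + 1.
have K0 : 0 < K by rewrite /K ltr_wpDl// !addr_ge0// ltW.
pose s := Num.min 1 (e / K).
have s0 : 0 < s by rewrite /s lt_min ltr01 divr_gt0.
have s1 : s <= 1 by rewrite /s ge_min lexx.
have sK : s * K <= e by rewrite -ler_pdivlMr// /s ge_min lexx orbT.
have [q qc] := ratv_dense_norm (s *: x0 + (1 - s) *: y) (mulr_gt0 s0 r0).
pose x' := s^-1 *: (ratv R q - (1 - s) *: y).
have qE : ratv R q = s *: x' + (1 - s) *: y.
  by rewrite scalerA divff ?scale1r ?subrK// gt_eqF.
have [Dx' ux'] : D x' /\ u x' <= M.
  apply: DM; rewrite /ball_ /= distrC -(ltr_pM2l s0) -{1}(gtr0_norm s0) -normrZ.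
  rewrite scalerBr scalerA divff ?gt_eqF// scale1r; move: qc.
  by rewrite opprD addrA addrAC.
have s01 : 0 <= s <= 1 by rewrite ltW.
exists q; split.
- by rewrite qE; exact: cD.
- have -> : ratv R q - y = (ratv R q - (s *: x0 + (1 - s) *: y)) + s *: (x0 - y).
    by rewrite -addrA; congr (_ + _); apply/rowP => i; rewrite !mxE; ring.
  rewrite (le_trans (ler_normD _ _))// normrZ gtr0_norm//.
  have := ltW qc; have := mulr_ge0 (ltW s0) (normr_ge0 (M - u y)); move: sK; rewrite /K; lra.
- rewrite qE; have := cu _ _ _ Dx' Dy s01.
  have := ler_wpM2l (ltW s0) ux'; have := ler_wpM2l (ltW s0) (ler_norm (M - u y)).
  have := mulr_ge0 (ltW s0) (normr_ge0 (x0 - y)); have := mulr_ge0 (ltW s0) (ltW r0).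
  move: sK; rewrite /K; lra.
Qed.

Section ExtendedConvex.
Context (R : realType) (n : nat) (phi : 'rV[R]_n -> \bar R).
Hypothesis cphi : convex_ext phi.

(** [fine] sends infinite values to 0, so this is meaningful on [effdom phi] only. *)
Definition finpart (x : 'rV[R]_n) : R := fine (phi x).

Lemma effdom_finpart x : effdom phi x -> phi x = (finpart x)%:E.
Proof.
move=> /= px; rewrite fineK// fin_numElt px andbT; exact: cphi.1.
Qed.

Lemma effdom_le x (r : R) : (phi x <= r%:E)%E -> effdom phi x.
Proof. by move=> /le_lt_trans; apply; exact: ltry. Qed.

Let conv_le x y (l : R) : effdom phi x -> effdom phi y -> 0 <= l <= 1 ->
  (phi (l *: x + (1 - l) *: y) <= (l * finpart x + (1 - l) * finpart y)%:E)%E.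
Proof.
move=> dx dy l01; rewrite EFinD !EFinM -!effdom_finpart//; exact: cphi.2.
Qed.

Lemma convex_closed_effdom : convex_closed (effdom phi).
Proof. by move=> x y l dx dy l01; exact: effdom_le (conv_le dx dy l01). Qed.

Lemma convex_on_effdom : convex_on (effdom phi) finpart.
Proof.
move=> x y l dx dy l01; rewrite -lee_fin -effdom_finpart; first exact: conv_le.
exact: convex_closed_effdom.
Qed.

End ExtendedConvex.

Lemma addrlK (V : zmodType) (x y : V) : x + y - x = y.
Proof. by rewrite addrAC subrr add0r. Qed.

(** * Slater points, multiplier bounds and rational characterizations for one subproblem *)

Section Constraints.
Context (R : realType) (n m : nat) (L G chi rho : R).
Context (ocon : 'I_m -> 'rV[R]_n -> R) (con : 'I_m -> 'rV[R]_n -> 'rV[R]_n -> R).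
Implicit Types (x y z : 'rV[R]_n).

Definition feasible : set 'rV[R]_n := [set x | forall k, ocon k x <= 0].

Definition sur_feasible y : set 'rV[R]_n := [set x | forall k, con k x y <= 0].

Record constraint_hyps : Prop := ConstraintHyps {
  ch_smooth : forall k, Lsmooth_on L setT (ocon k);
  ch_lip : forall k, Lipschitz_on G setT (ocon k);
  ch_mfcq : forall x, feasible x -> exists v : 'rV[R]_n, enorm v = 1 /\
    forall k, - chi <= ocon k x -> dotv (grad (ocon k) x) v <= - rho;
  ch_convex_sur : forall y k, feasible y -> forall x x' l, feasible x -> feasible x' ->
    0 <= l <= 1 ->
    con k (l *: x + (1 - l) *: x') y <= l * con k x y + (1 - l) * con k x' y;
  ch_smooth_sur : forall y k, feasible y -> Lsmooth_on L feasible (con k ^~ y);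
  ch_lip_sur : forall y k, feasible y -> Lipschitz_on G feasible (con k ^~ y);
  ch_grad_sur : forall y k, feasible y -> grad (con k ^~ y) y = grad (ocon k) y;
  ch_sur_at : forall y k, feasible y -> con k y y = ocon k y;
  ch_closed : forall y, feasible y -> convex_closed (sur_feasible y);
  ch_sub : forall y, feasible y -> sur_feasible y `<=` feasible }.

Hypothesis H : constraint_hyps.
Hypotheses (L_gt0 : 0 < L) (G_ge0 : 0 <= G) (rho_gt0 : 0 < rho).
Hypothesis chi_rho : rho / L * (G + rho / 2) <= chi.

Lemma sur_feasible_self y : feasible y -> sur_feasible y y.
Proof. by move=> Xy k; rewrite (ch_sur_at H)//; exact: Xy. Qed.

(* The Slater point is the step of length rho / L along the MFCQ direction. *)
Lemma slater y : feasible y ->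
  exists2 x0, sur_feasible y x0 & forall k, con k x0 y <= - (rho ^+ 2 / (2 * L)).
Proof.
move=> Xy; have [v [v1 hv]] := ch_mfcq H Xy.
have rL0 : 0 < rho / L by rewrite divr_gt0.
have rLL : rho / L * L = rho by rewrite divfK// gt_eqF.
have E2 : rho ^+ 2 / (2 * L) = rho / L * rho / 2 by field; rewrite gt_eqF.
(* The whole segment is needed, since the surrogates are smooth on the feasible set only. By the
   Lipschitz bound and [chi_rho], a constraint below [- chi] cannot become positive within this
   length. *)
have Xs s : 0 <= s <= rho / L -> feasible (y + s *: v).
  move=> /andP[s0 s1] k; have [act|/ltW inact] := leP (- chi) (ocon k y).
    have := @descent_upper R n L setT (ocon k) y (y + s *: v) (ch_smooth H k) (fun _ _ => I).
    rewrite addrlK enormZ v1 mulr1 dotvZr ger0_norm//.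
    have Ls : s * L <= rho by rewrite -rLL ler_pM2r.
    have := ler_wpM2l s0 (hv k act); have := ler_wpM2l s0 Ls; have := Xy k.
    have := mulr_ge0 s0 (ltW rho_gt0); lra.
  have := ch_lip H k (I : setT (y + s *: v)) (I : setT y).
  rewrite addrlK enormZ v1 mulr1 (ger0_norm s0) => h; have := le_trans (ler_norm _) h.
  have := ler_wpM2l G_ge0 s1; have := mulr_gt0 rL0 rho_gt0; move: chi_rho inact; lra.
(* The length [rho / L] minimizes the upper bound [- rho * s + L / 2 * s ^+ 2], and this is the
   minimal value. *)
have hx0 k : con k (y + (rho / L) *: v) y <= - (rho ^+ 2 / (2 * L)).
  have [act|/ltW inact] := leP (- chi) (ocon k y).
    have seg : segment_in feasible y (y + (rho / L) *: v).
      move=> s /andP[s0 s1]; rewrite addrlK scalerA; apply: Xs.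
      by rewrite mulr_ge0 ?(ltW rL0)//= ler_piMl// ltW.
    have := descent_upper (ch_smooth_sur H k Xy) seg.
    rewrite (ch_sur_at H)// (ch_grad_sur H)// addrlK enormZ v1 mulr1 dotvZr gtr0_norm//.
    have := ler_wpM2l (ltW rL0) (hv k act); have := Xy k; rewrite E2.
    have -> : L / 2 * (rho / L) ^+ 2 = (rho / L) * rho / 2 by rewrite -{3}rLL; ring.
    lra.
  have Xr : feasible (y + (rho / L) *: v) by apply: Xs; rewrite lexx ltW.
  have := ch_lip_sur H k Xy Xr Xy.
  rewrite addrlK enormZ v1 mulr1 (gtr0_norm rL0) => h; have := le_trans (ler_norm _) h.
  by rewrite (ch_sur_at H)// E2; move: chi_rho inact; lra.
exists (y + (rho / L) *: v) => // k; apply: le_trans (hx0 k) _.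
by rewrite oppr_le0 divr_ge0 ?sqr_ge0// mulr_ge0// ltW.
Qed.

Section Subproblem.
Context (mu BU : R) (phi : 'rV[R]_n -> R) (reg : 'rV[R]_n -> \bar R) (y xh : 'rV[R]_n).
Hypotheses (mu_ge0 : 0 <= mu) (creg : convex_ext reg) (Xreg : feasible `<=` effdom reg).
Hypotheses (Xy : feasible y) (cphi : strongly_convex mu phi) (dphi : forall x, differentiable phi x).
Hypothesis xh_feas : sur_feasible y xh.
Hypothesis xh_min : forall z, sur_feasible y z ->
  phi xh + finpart reg xh <= phi z + finpart reg z.
Hypothesis gap : forall z, feasible z ->
  phi z + finpart reg z <= phi xh + finpart reg xh + BU.

Let u := finpart reg.

Let Xxh : feasible xh := ch_sub H Xy xh_feas.

Lemma sub_growth z : sur_feasible y z ->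
  phi xh + u xh + mu / 2 * enorm (z - xh) ^+ 2 <= phi z + u z.
Proof.
move=> Cz; apply: (argmin_growth mu_ge0 (ch_closed H Xy) _ cphi xh_feas Cz xh_min).
by apply: convex_on_sub (convex_on_effdom creg) => x /(ch_sub H Xy)/Xreg.
Qed.

Lemma sub_gap_distance : mu / 2 * enorm (y - xh) ^+ 2 <= BU.
Proof.
by have := sub_growth (sur_feasible_self Xy); have := gap Xy; rewrite /u; lra.
Qed.

(** Stationarity in variational form, with test points in the whole domain of [reg]. It contains
    complementary slackness and the subgradient inequality, and it is a system of inequalities
    affine in [lam], as measurable selection requires. *)
Definition is_multiplier (lam : 'rV[R]_m) := (forall k, 0 <= lam 0 k) /\
  forall z, effdom reg z -> 0 <= dotv (grad phi xh) (z - xh) + (u z - u xh) +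
    \sum_k lam 0 k * (con k xh y + dotv (grad (con k ^~ y) xh) (z - xh)).

Let dcon k : differentiable (con k ^~ y) xh.
Proof. by have [+ _] := ch_smooth_sur H k Xy; apply. Qed.

Let con_linear k z : feasible z ->
  con k xh y + dotv (grad (con k ^~ y) xh) (z - xh) <= con k z y.
Proof.
move=> Xz; have := @convex_first_order R n 0 (con k ^~ y) xh z (lexx _) (dcon k).
rewrite !mul0r addr0; apply=> l l01; rewrite !mul0r subr0.
exact: (ch_convex_sur H k Xy Xz Xxh l01).
Qed.

Lemma multiplier_exists : exists lam, is_multiplier lam.
Proof.
have [x0 Cx0 sl] := slater Xy; have Xx0 := ch_sub H Xy Cx0.
have cD := convex_closed_effdom creg; have cu := convex_on_effdom creg.
have r0 : 0 < rho ^+ 2 / (2 * L) by rewrite divr_gt0 ?exprn_gt0// mulr_gt0.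
have [||lam lam0 hlam] := @kkt_multipliers R n m (fun k => con k ^~ y) _ phi u xh x0 cD cu
  (dphi xh) dcon (Xreg Xxh) xh_feas _ (Xreg Xx0).
- by move=> z _ Cz; exact: xh_min.
(* A convex surrogate lies above its linearization, which therefore inherits the Slater bound. *)
- by move=> k; have := con_linear k Xx0; have := sl k; lra.
exists (\row_k lam k); split=> [k|z Dz]; first by rewrite mxE.
by under eq_bigr do rewrite mxE; exact: hlam.
Qed.

Context (lam : 'rV[R]_m).
Hypothesis lamP : is_multiplier lam.

(** Testing with [z = xh] leaves a nonnegative sum of nonpositive terms. *)
Lemma multiplier_slack k : lam 0 k * con k xh y = 0.
Proof.
have [lam0 hlam] := lamP; have := hlam _ (Xreg Xxh).
rewrite !subrr !dotv0r !addr0 add0r.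
under eq_bigr do rewrite dotv0r addr0.
have lc j : 0 <= - (lam 0 j * con j xh y).
  by rewrite oppr_ge0 mulr_ge0_le0.
move=> S0; apply/eqP; rewrite -oppr_eq0; apply/eqP.
have /psumr_eq0P : \sum_j - (lam 0 j * con j xh y) = 0.
  apply/le_anti; rewrite sumrN oppr_le0 S0 /= -sumrN; apply: sumr_ge0 => j _; exact: lc.
by apply.
Qed.

Lemma multiplier_subgradient :
  subdiff reg xh (- (grad phi xh + \sum_k lam 0 k *: grad (con k ^~ y) xh)).
Proof.
have [lam0 hlam] := lamP.
have Exh := effdom_finpart creg (Xreg Xxh).
split=> [|z]; first by rewrite Exh.
have [Dz|Dz] := boolP (reg z < +oo)%E; last first.
  by move: Dz; rewrite -leNgt leye_eq => /eqP ->; rewrite leey.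
rewrite Exh (effdom_finpart creg Dz) -EFinD lee_fin -/u.
have := hlam z Dz; rewrite dotvNl dotvDl dotv_suml.
under eq_bigr do rewrite mulrDr multiplier_slack add0r.
by under [in X in _ -> X]eq_bigr do rewrite dotvZl; lra.
Qed.

(** Test with the Slater point: there each linearized constraint is at most
    [- (rho ^+ 2 / (2 * L))], while convexity and [gap] bound the objective part by [BU]. *)
Lemma multiplier_sum_le : \sum_k lam 0 k <= 2 * L / rho ^+ 2 * BU.
Proof.
have [lam0 hlam] := lamP.
have [x0 Cx0 sl] := slater Xy; have Xx0 := ch_sub H Xy Cx0.
have := hlam _ (Xreg Xx0); set S := \sum_k _ * _.
have : S <= - (rho ^+ 2 / (2 * L)) * \sum_k lam 0 k.
  rewrite mulr_sumr; apply: ler_sum => k _; rewrite mulrC; apply: ler_wpM2r => //.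
  exact: le_trans (con_linear k Xx0) (sl k).
have := gap Xx0; have := @convex_first_order R n mu phi xh x0 mu_ge0 (dphi xh) (cphi x0 xh).
have : 0 <= mu / 2 * enorm (x0 - xh) ^+ 2 by rewrite mulr_ge0 ?sqr_ge0// divr_ge0.
rewrite -/u => h1 h2 h3 h4 h5.
have : rho ^+ 2 / (2 * L) * \sum_k lam 0 k <= BU by lra.
rewrite mulrC -ler_pdivlMr; last by rewrite divr_gt0 ?exprn_gt0// mulr_gt0.
by rewrite invf_div [X in _ <= X]mulrC.
Qed.

Let seg_y : segment_in feasible y xh.
Proof.
move=> s s01; rewrite convexE; apply: (ch_sub H Xy); apply: (ch_closed H Xy) => //.
exact: sur_feasible_self.
Qed.

(** Constraint and surrogate agree to first order at [y], so at [xh] the surrogate exceeds the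
    constraint by at most [L] times the squared distance, [L / 2] from each; slackness holds for the
    surrogate. *)
Lemma multiplier_slack_ge k :
  - (L * enorm (xh - y) ^+ 2) * lam 0 k <= lam 0 k * ocon k xh.
Proof.
have [lam0 _] := lamP.
have h1 := descent_lower (ch_smooth H k) ((fun _ _ => I) : segment_in setT y xh).
have := descent_upper (ch_smooth_sur H k Xy) seg_y.
rewrite (ch_sur_at H)// (ch_grad_sur H)// => h2.
have := ler_wpM2l (lam0 k) (_ : con k xh y - L * enorm (xh - y) ^+ 2 <= ocon k xh).
rewrite mulrBr multiplier_slack; move=> h; have := h _; lra.
Qed.

(** All gradients are moved from [xh] to [y] at the cost of [L] times the distance each; at [y]
    those of a constraint and its surrogate coincide, and only the gradient error of [phi]
    remains. *)
Lemma multiplier_residual (gU : 'rV[R]_n -> 'rV[R]_n) :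
  (forall x z, enorm (gU x - gU z) <= L * enorm (x - z)) -> Lsmooth_on L setT phi ->
  enorm (gU xh + \sum_k lam 0 k *: grad (ocon k) xh -
         (grad phi xh + \sum_k lam 0 k *: grad (con k ^~ y) xh)) <=
  (2 * L + 2 * L * (2 * L / rho ^+ 2 * BU)) * enorm (xh - y) + enorm (grad phi y - gU y).
Proof.
move=> LU [_ Lphi]; have [lam0 _] := lamP.
have -> : gU xh + \sum_k lam 0 k *: grad (ocon k) xh -
         (grad phi xh + \sum_k lam 0 k *: grad (con k ^~ y) xh) =
  (gU xh - gU y) + (grad phi y - grad phi xh) - (grad phi y - gU y) +
  \sum_k lam 0 k *: (grad (ocon k) xh - grad (con k ^~ y) xh).
  under [in RHS]eq_bigr do rewrite scalerBr; rewrite sumrB.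
  by apply/rowP => i; rewrite !mxE; ring.
rewrite (le_trans (enorm_triangle _ _))//.
have hS : enorm (\sum_k lam 0 k *: (grad (ocon k) xh - grad (con k ^~ y) xh)) <=
    2 * L * (2 * L / rho ^+ 2 * BU) * enorm (xh - y).
  rewrite (le_trans (enorm_sum _))//.
  apply: (@le_trans _ _ (\sum_k lam 0 k * (2 * L * enorm (xh - y)))).
    apply: ler_sum => k _; rewrite enormZ ger0_norm// ler_wpM2l//.
    rewrite (_ : _ - _ = (grad (ocon k) xh - grad (ocon k) y) +
      (grad (con k ^~ y) y - grad (con k ^~ y) xh)); last first.
      by rewrite (ch_grad_sur H)// addrA subrK.
    rewrite (le_trans (enorm_triangle _ _))// -mulrA mulr2n mulrDl mul1r lerD//.
      by have [_ +] := ch_smooth H k; apply.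
    by rewrite (enormB xh); have [_ +] := ch_smooth_sur H k Xy; apply.
  rewrite -mulr_suml [leRHS](_ : _ = (2 * L / rho ^+ 2 * BU) * (2 * L * enorm (xh - y))).
    by rewrite ler_wpM2r ?multiplier_sum_le// !mulr_ge0 ?enorm_ge0// ltW.
  by ring.
have h1 := LU xh y; have h2 : enorm (grad phi y - grad phi xh) <= L * enorm (xh - y).
  by rewrite (enormB xh); exact: Lphi.
have := enorm_triangle (gU xh - gU y + (grad phi y - grad phi xh)) (- (grad phi y - gU y)).
have := enorm_triangle (gU xh - gU y) (grad phi y - grad phi xh).
by rewrite enormN; move: hS h1 h2; lra.
Qed.

(** The strict Slater inequalities persist nearby, and [gap] bounds [u] from above because [phi] is
    continuous. *)
Lemma sur_feasible_interior : exists x0 M, \forall x \near x0, sur_feasible y x /\ u x <= M.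
Proof.
have [x0 Cx0 sl] := slater Xy; have Xx0 := ch_sub H Xy Cx0.
exists x0, (phi xh + u xh + BU - (phi x0 - 1)).
have /filter_forall : forall k : 'I_m, nbhs x0 [set x | con k x y < 0].
  move=> k; have ck : {for x0, continuous (con k ^~ y)}.
    by apply: differentiable_continuous; have [+ _] := ch_smooth_sur H k Xy; apply.
  have /cvgr_lt := ck; apply; apply: le_lt_trans (sl k) _.
  by rewrite oppr_lt0 divr_gt0 ?exprn_gt0// mulr_gt0.
have : \forall x \near x0, phi x0 - 1 < phi x.
  have cphi0 : {for x0, continuous phi} by exact: differentiable_continuous.
  by have /cvgr_gt := cphi0; apply; lra.
apply: filterS2 => x h1 h2; have Cx : sur_feasible y x by move=> k; exact: ltW (h2 k).
by split => //; have := gap (ch_sub H Xy Cx); rewrite /u; lra.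
Qed.

(** [D] will be the surrogate feasible set for the minimizer, and the domain of [reg] for the
    multipliers. *)
Lemma objective_density (D : set 'rV[R]_n) (q : 'rV[R]_n -> R) z (e : R) :
  sur_feasible y `<=` D -> D `<=` effdom reg -> convex_closed D -> continuous q -> D z -> 0 < e ->
  exists a, [/\ D (ratv R a), enorm (ratv R a - z) <= e &
    q (ratv R a) + u (ratv R a) <= q z + u z + e].
Proof.
move=> CD Dreg cD cq Dz e0; have [x0 [M xM]] := sur_feasible_interior.
have cu : convex_on D u by apply: convex_on_sub (convex_on_effdom creg).
have /nbhs_ballP[r /= r0] : nbhs z [set x | q x < q z + e / 2].
  by have /cvgr_lt := cq z; apply; lra.
rewrite -ball_normE /= => qr.
pose e' := Num.min (e / 2) (Num.min (r / 2) (e / (n%:R + 1))).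
have n1 : 0 < n%:R + 1 :> R by rewrite ltr_wpDl.
have e'0 : 0 < e' by rewrite /e' !lt_min !divr_gt0.
have e'1 : e' <= e / 2 by rewrite /e' ge_min lexx.
have e'2 : e' <= r / 2 by rewrite /e' !ge_min lexx orbT.
have e'3 : e' * (n%:R + 1) <= e by rewrite -ler_pdivlMr// /e' !ge_min lexx !orbT.
have DM : \forall x \near x0, D x /\ u x <= M.
  by apply: filterS xM => x [/CD].
have [a [Da az ua]] := rational_density cD cu DM Dz e'0.
exists a; split=> //.
  rewrite (le_trans (enorm_le_norm _))// (le_trans _ e'3)// mulrC ler_pM//.
  by rewrite lerDl.
have := qr (ratv R a); rewrite /ball_ /= distrC => h.
have : `|ratv R a - z| < r by lra.
move=> /h; lra.
Qed.

Lemma objective_lt (a : R) : phi xh + u xh < a <->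
  exists q, sur_feasible y (ratv R q) /\ phi (ratv R q) + u (ratv R q) < a.
Proof.
split=> [xa|[q [Cq qa]]]; last exact: le_lt_trans (xh_min Cq) qa.
have cphi' : continuous phi by move=> x; exact: differentiable_continuous.
have CX : sur_feasible y `<=` effdom reg by move=> x /(ch_sub H Xy)/Xreg.
have e0 : 0 < (a - (phi xh + u xh)) / 2 by rewrite divr_gt0// subr_gt0.
have [q [Cq _ h]] := objective_density (@subset_refl _ _) CX (ch_closed H Xy) cphi' xh_feas e0.
by exists q; split => //; move: h; lra.
Qed.

(** A rational point that is optimal up to [e] can be chosen close to [xh] by density, and the
    assumed growth inequality then puts it close to [p]. *)
Lemma minimizer_unique (p : 'rV[R]_n) : 0 < mu ->
  (forall q, sur_feasible y (ratv R q) ->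
    phi xh + u xh + mu / 2 * enorm (ratv R q - p) ^+ 2 <= phi (ratv R q) + u (ratv R q)) ->
  p = xh.
Proof.
move=> mu0 hp; apply/eqP; rewrite -subr_eq0; apply/eqP/enorm_eq0/eqP; rewrite -sqrf_eq0.
apply/eqP/le_anti; rewrite sqr_ge0 andbT.
have cphi' : continuous phi by move=> x; exact: differentiable_continuous.
have CX : sur_feasible y `<=` effdom reg by move=> x /(ch_sub H Xy)/Xreg.
rewrite -subr_ge0 sub0r; apply: (@ge0_affine_lim _ _ (4 / mu + 2)) => e /andP[e0 e1].
have [q [Cq qx h]] := objective_density (@subset_refl _ _) CX (ch_closed H Xy) cphi' xh_feas e0.
have := hp q Cq; have := enorm_sqrD_le (p - ratv R q) (ratv R q - xh).
rewrite addrA subrK (enormB p).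
have : enorm (ratv R q - xh) ^+ 2 <= e.
  rewrite (le_trans _ qx)// expr2 ler_piMl ?enorm_ge0//; exact: le_trans qx e1.
move=> h1 h2 h3; have : mu / 2 * enorm (ratv R q - p) ^+ 2 <= e by lra.
rewrite mulrC -ler_pdivlMr ?divr_gt0// invf_div => h4.
have -> : e * (4 / mu + 2) = 2 * (e * (2 / mu)) + 2 * e by ring.
lra.
Qed.

Lemma is_multiplier_rational (l : 'rV[R]_m) : (forall k, 0 <= l 0 k) ->
  (forall q, effdom reg (ratv R q) ->
    0 <= dotv (grad phi xh) (ratv R q - xh) + (u (ratv R q) - u xh) +
      \sum_k l 0 k * (con k xh y + dotv (grad (con k ^~ y) xh) (ratv R q - xh))) ->
  is_multiplier l.
Proof.
move=> l0 hl; split=> // z Dz.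
pose q z := dotv (z - xh) (grad phi xh) - u xh +
  \sum_k l 0 k * (con k xh y + dotv (z - xh) (grad (con k ^~ y) xh)).
have qE z' : dotv (grad phi xh) (z' - xh) + (u z' - u xh) +
    \sum_k l 0 k * (con k xh y + dotv (grad (con k ^~ y) xh) (z' - xh)) = q z' + u z'.
  rewrite /q dotvC; under eq_bigr do rewrite dotvC; ring.
have cdot v : continuous (fun z => dotv (z - xh) v).
  have -> : (fun z => dotv (z - xh) v) = fun z => dotv z v - dotv xh v.
    by apply/funext => z'; rewrite dotvBl.
  by move=> z'; exact: (cvgB (@dotvr_continuous _ _ v z') (cvg_cst _)).
have csum : continuous (fun z =>
    \sum_k l 0 k * (con k xh y + dotv (z - xh) (grad (con k ^~ y) xh))).
  apply: (@continuous_sum R n _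
    (fun k z => l 0 k * (con k xh y + dotv (z - xh) (grad (con k ^~ y) xh)))) => k z'.
  exact: (cvgM (cvg_cst _) (cvgD (cvg_cst _) (cdot _ z'))).
have cq : continuous q.
  by move=> z'; exact: (cvgD (cvgB (cdot _ z') (cvg_cst _)) (csum z')).
have CX : sur_feasible y `<=` effdom reg by move=> x /(ch_sub H Xy)/Xreg.
rewrite qE; apply: (@ge0_affine_lim _ _ 1) => e /andP[e0 _].
have [a [Da _]] := objective_density CX (@subset_refl _ _) (convex_closed_effdom creg) cq Dz e0.
have := hl a Da; rewrite qE; lra.
Qed.

End Subproblem.

End Constraints.

(** * The two constraint families as one *)

Section Instance.
Context (R : realType) (n J I : nat) (dS : measure_display) (Xi : measurableType dS).
Context (pb : problem R Xi n J I) (sur : surrogates R Xi n J).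

Definition all_con (k : 'I_(J + I)) : 'rV[R]_n -> R :=
  match fintype.split k with inl j => gcon pb j | inr i => hcon pb i end.

(** A convex [h_i] is its own surrogate, so that one constraint theory covers both families. *)
Definition all_sur (k : 'I_(J + I)) (x y : 'rV[R]_n) : R :=
  match fintype.split k with inl j => gcon_sur sur j x y | inr i => hcon pb i x end.

Lemma all_con_lshift j : all_con (lshift I j) = gcon pb j.
Proof. by rewrite /all_con (unsplitK (inl j)). Qed.

Lemma all_con_rshift i : all_con (rshift J i) = hcon pb i.
Proof. by rewrite /all_con (unsplitK (inr i)). Qed.

Lemma XsetE : Xset pb = feasible all_con.
Proof.
apply/seteqP; split=> [x [hx gx] k|x hx]; first by rewrite /all_con; case: (fintype.split k).
split=> [i|j] /=; first by rewrite -all_con_rshift.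
by rewrite -all_con_lshift.
Qed.

Lemma XsurE y : Xsur pb sur y = sur_feasible all_sur y.
Proof.
apply/seteqP; split=> [x [hx gx] k|x hx]; first by rewrite /all_sur; case: (fintype.split k).
split=> [i|j] /=; first by have := hx (rshift J i); rewrite /all_sur (unsplitK (inr i)).
by have := hx (lshift I j); rewrite /all_sur (unsplitK (inl j)).
Qed.

Lemma convex_setP (A : set 'rV[R]_n) : convex_set A -> convex_closed A.
Proof.
move=> cA x y l Ax Ay /andP[l0 l1].
have := cA x y (Itv01 l0 l1); rewrite !inE => /(_ Ax Ay).
by [].
Qed.

Lemma convex_functionP (A : set 'rV[R]_n) (f : 'rV[R]_n -> R) : convex_function A f ->
  forall x y l, A x -> A y -> 0 <= l <= 1 ->
  f (l *: x + (1 - l) *: y) <= l * f x + (1 - l) * f y.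
Proof.
move=> cf x y l Ax Ay /andP[l0 l1].
by have := cf (Itv01 l0 l1) x y; rewrite !inE => /(_ Ax Ay).
Qed.

Context (L G mu chi rho : R).
Hypotheses (L_gt0 : 0 < L) (rho_gt0 : 0 < rho).
Hypothesis wp : well_posed pb.
Hypothesis csub : convex_subproblem pb sur.
Hypothesis hsmooth : forall i, Lsmooth_on L setT (hcon pb i) /\ Lipschitz_on G setT (hcon pb i).
Hypothesis gsmooth : forall j, Lsmooth_on L setT (gcon pb j) /\ Lipschitz_on G setT (gcon pb j).
Hypothesis mfcq : MFCQ pb chi rho.
Hypothesis gsur : gcon_surrogate pb sur L G.

Lemma instance_hyps : constraint_hyps L G chi rho all_con all_sur.
Proof.
have [_ _ ch] := wp; split.
- by move=> k; rewrite /all_con; case: (fintype.split k) => i; [case: (gsmooth i)|case: (hsmooth i)].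
- by move=> k; rewrite /all_con; case: (fintype.split k) => i; [case: (gsmooth i)|case: (hsmooth i)].
- move=> x; rewrite -XsetE => /mfcq[v [v1 gv hv]]; exists v; split => // k.
  by rewrite /all_con; case: (fintype.split k).
- move=> y k; rewrite -XsetE => Xy x x' l Xx Xx' l01; rewrite /all_sur; case: (fintype.split k) => i.
    by have [cg _ _ _ _] := gsur i Xy; exact: (convex_functionP cg).
  exact: (convex_functionP (ch i)).
- move=> y k; rewrite -XsetE => Xy; rewrite /all_sur; case: (fintype.split k) => i.
    by have [] := gsur i Xy.
  by have [[d l] _] := hsmooth i; split=> [x _|x x' _ _]; [exact: d|exact: l].
- move=> y k; rewrite -XsetE => Xy; rewrite /all_sur; case: (fintype.split k) => i.
    by have [] := gsur i Xy.
  by have [_ l] := hsmooth i => x x' _ _; exact: l.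
- move=> y k; rewrite -XsetE => Xy; rewrite /all_sur /all_con; case: (fintype.split k) => i //.
  by have [] := gsur i Xy.
- move=> y k; rewrite -XsetE => Xy; rewrite /all_sur /all_con; case: (fintype.split k) => i //.
  by have [_ _ _ _ [_]] := gsur i Xy.
- move=> y; rewrite -XsetE => Xy; rewrite -XsurE; apply: convex_setP.
  by have [] := csub Xy.
- by move=> y; rewrite -XsetE -XsurE => Xy; have [] := csub Xy.
Qed.

End Instance.

(** * Adding the affine momentum correction to a surrogate *)

Section AffinePerturbation.
Context (R : realType) (n : nat).
Implicit Types (x v y : 'rV[R]_n).

Lemma differentiable_affine (a : R) v x0 x : differentiable (fun y => a * dotv (y - x0) v) x.
Proof.
have -> : (fun y => a * dotv (y - x0) v) =
    \sum_i (fun y : 'rV[R]_n => (a * v 0 i) * (y 0 i - x0 0 i)).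
  apply/funext => y; rewrite fct_sumE mulr_sumr; apply: eq_bigr => i _.
  by rewrite !mxE; ring.
apply: differentiable_sum => i.
apply: (@differentiableM _ _ (cst (a * v 0 i))); first exact: differentiable_cst.
apply: (@differentiableB _ _ _ (fun y : 'rV[R]_n => y 0 i) (cst (x0 0 i))).
  exact: differentiable_coord.
exact: differentiable_cst.
Qed.

Lemma differentiable_add_affine (phi : 'rV[R]_n -> R) (a : R) v x0 x : differentiable phi x ->
  differentiable (fun y => phi y + a * dotv (y - x0) v) x.
Proof. by move=> dphi; exact: (differentiableD dphi (differentiable_affine a v x0 x)). Qed.

Lemma grad_add_affine (phi : 'rV[R]_n -> R) (a : R) v x0 x : differentiable phi x ->
  grad (fun y => phi y + a * dotv (y - x0) v) x = grad phi x + a *: v.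
Proof.
move=> dphi; have dg := differentiable_affine a v x0 x.
have gE : grad (fun y => a * dotv (y - x0) v) x = a *: v.
  apply: (@quadratic_grad _ _ _ _ _ 0) => h.
  by rewrite mul0r !dotvBl dotvDl dotvZl (dotvC v h) normr_le0; apply/eqP; ring.
rewrite -gE; apply/rowP => i; rewrite !mxE; apply: deriveD; exact: diff_derivable.
Qed.

Lemma strongly_convex_add_affine (mu : R) (phi : 'rV[R]_n -> R) (a : R) v x0 :
  strongly_convex mu phi -> strongly_convex mu (fun y => phi y + a * dotv (y - x0) v).
Proof.
move=> cphi x y l l01; have := cphi x y l l01.
rewrite !dotvBl dotvDl !dotvZl; lra.
Qed.

Lemma Lsmooth_add_affine (L : R) (phi : 'rV[R]_n -> R) (a : R) v x0 :
  Lsmooth_on L setT phi -> Lsmooth_on L setT (fun y => phi y + a * dotv (y - x0) v).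
Proof.
move=> [dphi Lphi]; split=> [x _|x y _ _]; first by apply: differentiable_add_affine; exact: dphi.
rewrite !grad_add_affine; [|exact: dphi|exact: dphi].
by rewrite opprD addrACA subrr addr0; exact: Lphi.
Qed.

End AffinePerturbation.

(** * Real estimates *)

Section RealEstimates.
Context (R : realType).

Lemma cbrt_expr3 (a : R) : 0 <= a -> (a `^ (1 / 3)) ^+ 3 = a.
Proof. by move=> a0; rewrite -powR_mulrn ?powR_ge0// -powRrM div1r mulVf ?powRr1// pnatr_eq0. Qed.

Lemma cbrt_sqr (a : R) : 0 <= a -> (a `^ (1 / 3)) ^+ 2 = a `^ (2 / 3).
Proof.
move=> a0; rewrite -powR_mulrn ?powR_ge0// -powRrM; by congr (_ `^ _); field.
Qed.

Lemma le_cbrt (a b : R) : 0 <= a -> a <= b -> a `^ (1 / 3) <= b `^ (1 / 3).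
Proof.
by move=> a0 ab; apply: ge0_ler_powR => //; rewrite ?nnegrE ?divr_ge0// (le_trans a0).
Qed.

Lemma cbrt_ge (a b : R) : 0 <= a -> a ^+ 3 <= b -> a <= b `^ (1 / 3).
Proof.
move=> a0 ab; rewrite -(ler_pXn2r (n := 3))// ?nnegrE ?powR_ge0//.
by rewrite cbrt_expr3// (le_trans _ ab)// exprn_ge0.
Qed.

(** [q] and [q'] are consecutive denominators of the step size. Since [(6 / 5) ^+ 3] exceeds
    [3 / 2], [q' <= 6 / 5 * q], hence [q' * k <= 36 / 25 * q ^+ 2]. The difference of the cubes is
    at least [3 * q ^+ 2 * (q' - q)], and [12 / 25] is [36 / 25] divided by 3. *)
Lemma inv_step_bound (k q q' g2 G2 : R) : 0 < k -> k <= q -> q <= q' ->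
  q' ^+ 3 = q ^+ 3 + g2 -> g2 <= G2 -> 2 * G2 <= q ^+ 3 ->
  q' / k - q / k <= 12 / 25 * G2 / k ^+ 3 * (k / q').
Proof.
move=> k0 kq qq' E g2G G2q.
have q0 : 0 < q by exact: lt_le_trans kq.
have q'0 : 0 < q' by exact: lt_le_trans qq'.
have q'le : q' <= 6 / 5 * q.
  rewrite leNgt; apply/negP => lt; have : (6 / 5 * q) ^+ 3 < q' ^+ 3.
    by rewrite ltrXn2r// ?mulr_ge0// ltW.
  have := exprn_gt0 3 q0; rewrite E exprMn; lra.
rewrite -mulrBl ler_pdivrMr//.
have -> : 12 / 25 * G2 / k ^+ 3 * (k / q') * k = 12 / 25 * G2 / k / q'.
  by field; rewrite !gt_eqF.
rewrite ler_pdivlMr// ler_pdivlMr//.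
have h1 : (q' - q) * (3 * q ^+ 2) <= G2.
  have : (q' - q) * (q' ^+ 2 + q' * q + q ^+ 2) = g2 by rewrite -[g2](addrK (q ^+ 3)) (addrC g2) -E; ring.
  have : (q' - q) * (3 * q ^+ 2) <= (q' - q) * (q' ^+ 2 + q' * q + q ^+ 2).
    by rewrite ler_wpM2l ?subr_ge0//; nra.
  lra.
have h2 : (q' - q) * q' * k <= (q' - q) * (36 / 25 * q ^+ 2).
  rewrite -mulrA ler_wpM2l ?subr_ge0//.
  have : q' * k <= (6 / 5 * q) * (6 / 5 * q).
    by apply: ler_pM => //; rewrite ?(ltW q'0) ?(ltW k0)//; lra.
  lra.
lra.
Qed.

(** The contraction [(1 - b) ^+ 2 <= 1 - 7 / 4 * b] must pay for the growth of the inverse step size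
    and still leave [14 * L ^+ 2]. With [Y = G ^+ 2 / k ^+ 3], the lower bound on [c] gives
    [7 / 4 * c >= 14 * L ^+ 2 + 7 / 12 * Y], and [7 / 12] exceeds [12 / 25]. *)
Lemma potential_step (L G k c eta etap E E' gg Dd N b : R) :
  0 < k -> 0 < eta <= 1 -> 0 <= E -> 0 <= Dd -> b = c * eta ^+ 2 -> 0 <= b <= 1 / 4 ->
  8 * L ^+ 2 + G ^+ 2 / (3 * k ^+ 3) < c ->
  eta^-1 - etap^-1 <= 12 / 25 * G ^+ 2 / k ^+ 3 * eta ->
  E' <= (1 - b) ^+ 2 * E + (2 * b ^+ 2 * gg + 2 * (1 - b) ^+ 2 * L ^+ 2 * (eta ^+ 2 * Dd)) + eta * N ->
  E' / eta <= E / etap - 14 * L ^+ 2 * (eta * E) + 2 * L ^+ 2 * (eta * Dd) +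
    2 * c ^+ 2 * (eta ^+ 3 * gg) + N.
Proof.
move=> k0 /andP[eta0 eta1] E0 D0 bE /andP[b0 b1] cG step hE.
rewrite ler_pdivrMr//; apply: le_trans hE _.
have hGk : G ^+ 2 / (3 * k ^+ 3) = (G ^+ 2 / k ^+ 3) / 3 by field; rewrite gt_eqF.
set Y := G ^+ 2 / k ^+ 3 in hGk; rewrite hGk in cG.
have Y0 : 0 <= Y by rewrite divr_ge0 ?sqr_ge0// exprn_ge0// ltW.
have {}step : eta^-1 <= etap^-1 + 12 / 25 * Y * eta by rewrite /Y; lra.
have h1 : (1 - b) ^+ 2 * E <= E - 7 / 4 * b * E.
  have : 0 <= b * (1 / 4 - b) * E by rewrite !mulr_ge0// subr_ge0.
  lra.
have h2 : E <= E / etap * eta + 12 / 25 * Y * eta ^+ 2 * E.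
  have := ler_wpM2r (mulr_ge0 E0 (ltW eta0)) step.
  rewrite mulrCA mulVf ?gt_eqF// mulr1; lra.
have h3 : 2 * (1 - b) ^+ 2 * L ^+ 2 * (eta ^+ 2 * Dd) <= 2 * L ^+ 2 * (eta ^+ 2 * Dd).
  have : 0 <= L ^+ 2 * (eta ^+ 2 * Dd) * (b * (2 - b)).
    apply: mulr_ge0; first exact: mulr_ge0 (sqr_ge0 L) (mulr_ge0 (sqr_ge0 eta) D0).
    by apply: mulr_ge0 => //; lra.
  lra.
have h4 : 0 <= (eta ^+ 2 * E) * (7 / 4 * c - 14 * L ^+ 2 - 12 / 25 * Y).
  by apply: mulr_ge0; [exact: mulr_ge0 (sqr_ge0 eta) E0|lra].
have -> : 2 * b ^+ 2 * gg = 2 * c ^+ 2 * (eta ^+ 3 * gg) * eta by rewrite bE; ring.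
have h5 : 7 / 4 * b * E = 7 / 4 * (c * eta ^+ 2) * E by rewrite bE.
lra.
Qed.

(** Young's inequality on each term. With [s] the square root of the tolerance it passes from second
    moments to the expected norm. *)
Lemma le_quadratic (K D E s : R) : 0 < s ->
  K * D + E <= (K ^+ 2 + 1) * (D ^+ 2 + E ^+ 2) / s + s / 2.
Proof.
move=> s0; rewrite -(ler_pM2r s0) [leRHS]mulrDl divfK ?gt_eqF//.
have := sqr_ge0 (K * D - s / 2); have := sqr_ge0 (E - s / 2); have := sqr_ge0 D.
by have := sqr_ge0 (K * E); nra.
Qed.

(** [b <= 3 / 2 * a] gives [g / a <= 3 / 2 * (1 - a / b)], and [1 - a / b <= ln (b / a)]. The old
    value [a] is in the denominator because the step size lags one sample behind the gradient. *)
Lemma log_step (a b g : R) : 0 < a -> b = a + g -> 0 <= g -> 2 * g <= a ->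
  g / a <= 3 / 2 * (ln b - ln a).
Proof.
move=> a0 bE g0 ga; have b0 : 0 < b by lra.
have : ln (a / b) <= a / b - 1.
  have := @le_ln1Dx R (a / b - 1); rewrite subrKC; apply.
  by have := divr_gt0 a0 b0; lra.
rewrite lnM ?posrE ?invr_gt0// lnV ?posrE// => h.
have : g / a <= 3 / 2 * (1 - a / b).
  rewrite ler_pdivrMr//.
  have -> : 3 / 2 * (1 - a / b) * a = 3 / 2 * ((b - a) * a / b) by field; rewrite gt_eqF.
  have -> : b - a = g by rewrite bE; ring.
  rewrite mulrA ler_pdivlMr// bE; nra.
lra.
Qed.

End RealEstimates.

(** * Momentum and descent inequalities for a single step *)

Section VectorEstimates.
Context (R : realType) (n : nat).
Implicit Types (e d m g : 'rV[R]_n).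

(** Pathwise form of bounding a variance by a second moment: [- enorm m ^+ 2] is dropped, and the
    remaining cross term is linear in [d - m]. *)
Lemma momentum_error (b : R) e d m :
  enorm ((1 - b) *: e + (d - m)) ^+ 2 <= (1 - b) ^+ 2 * enorm e ^+ 2 + enorm d ^+ 2 +
    dotv ((2 * (1 - b)) *: e - 2 *: m) (d - m).
Proof.
have := dotvv_ge0 m; rewrite !enorm_sqr !(dotvBl, dotvBr, dotvDl, dotvDr, dotvZl, dotvZr).
rewrite (dotvC d e) (dotvC m e) (dotvC m d); lra.
Qed.

Lemma momentum_direction (b : R) g g' :
  enorm (g' - (1 - b) *: g) ^+ 2 <= 2 * b ^+ 2 * enorm g' ^+ 2 + 2 * (1 - b) ^+ 2 * enorm (g' - g) ^+ 2.
Proof.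
have -> : g' - (1 - b) *: g = b *: g' + (1 - b) *: (g' - g).
  by apply/rowP => i; rewrite !mxE; ring.
have := enorm_sqrD_le (b *: g') ((1 - b) *: (g' - g)).
by rewrite !enorm_sqr !(dotvZl, dotvZr); lra.
Qed.

(** The condition on [eta] says that [mu - L * eta / 2] is at least [3 / 4]. *)
Lemma descent_step (L mu eta : R) (gU zt v : 'rV[R]_n) :
  0 < eta -> 2 * L * eta <= 4 * mu - 3 ->
  eta * (dotv (gU - zt) v - mu * enorm v ^+ 2) + L / 2 * (eta ^+ 2 * enorm v ^+ 2) <=
  eta * (enorm (zt - gU) * enorm v - 3 / 4 * enorm v ^+ 2).
Proof.
move=> eta0 etaL; have h := dotv_le_enorm (gU - zt) v.
rewrite (enormB gU) in h.
have -> : L / 2 * (eta ^+ 2 * enorm v ^+ 2) = eta * (L / 2 * eta * enorm v ^+ 2) by ring.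
rewrite -mulrDr ler_wpM2l ?(ltW eta0)//.
have : 0 <= enorm v ^+ 2 * (4 * mu - 3 - 2 * L * eta) by rewrite mulr_ge0 ?sqr_ge0// subr_ge0.
lra.
Qed.

End VectorEstimates.

(** * One run of the algorithm *)

Record parameters_ok (R : realType) (L G mu chi rho kbar w c : R) : Prop := ParametersOk {
  pa_L : 0 < L; pa_w : 0 < w; pa_c : 0 < c; pa_rho : 0 < rho;
  pa_chi : rho / L * (G + rho / 2) <= chi;
  pa_kbar : 0 < kbar <= w `^ (1 / 3);
  pa_c_le : c <= w `^ (2 / 3) / (4 * kbar ^+ 2);
  pa_c_gt : 8 * L ^+ 2 + G ^+ 2 / (3 * kbar ^+ 3) < c;
  pa_mu : 3 / 4 < mu;
  pa_w_ge : Num.max ((2 * L * kbar / (4 * mu - 3)) ^+ 3) (2 * G ^+ 2) <= w }.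

Record problem_ok (R : realType) (n J I : nat) (dS : measure_display)
    (Xi : measurableType dS) (L G mu chi rho : R)
    (pb : problem R Xi n J I) (sur : surrogates R Xi n J) : Prop := ProblemOk {
  po_wp : well_posed pb;
  po_meas : measurable_surrogates pb sur;
  po_csub : convex_subproblem pb sur;
  po_dom : Xset pb `<=` Dset pb;
  po_loss : forall s, Lsmooth_on L setT (loss pb ^~ s) /\ Lipschitz_on G setT (loss pb ^~ s);
  po_h : forall i, Lsmooth_on L setT (hcon pb i) /\ Lipschitz_on G setT (hcon pb i);
  po_g : forall j, Lsmooth_on L setT (gcon pb j) /\ Lipschitz_on G setT (gcon pb j);
  po_mfcq : MFCQ pb chi rho;
  po_lsur : loss_surrogate pb sur mu L;
  po_gsur : gcon_surrogate pb sur L G }.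

Section Run.
Context (R : realType) (n J I : nat) (dS : measure_display) (Xi : measurableType dS).
Context (L G mu chi rho kbar w c BU : R).
Context (pb : problem R Xi n J I) (sur : surrogates R Xi n J).
Hypothesis PA : parameters_ok L G mu chi rho kbar w c.
Hypothesis PO : problem_ok L G mu chi rho pb sur.
Context (S : Type) (xi : nat -> S -> Xi) (x0 : 'rV[R]_n) (x xhat z : nat -> S -> 'rV[R]_n).
Hypothesis run : CoSTA kbar w c xi x xhat z pb sur x0.
Hypothesis Xx0 : Xset pb x0.
Hypothesis gap : bounded_gap kbar w c xi x z pb sur BU.

Local Notation lossgrad s y := (grad (loss pb ^~ s) y).
Local Notation eta := (stepsize kbar w xi x pb).
Local Notation beta := (momentum kbar w c xi x pb).
Local Notation phi := (sub_loss kbar w c xi x z pb sur).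
Local Notation u := (finpart (reg pb)).
Local Notation U := (Uobj pb).

Let wpos := pa_w PA.
Let H := instance_hyps (po_wp PO) (po_csub PO) (po_h PO) (po_g PO) (po_mfcq PO) (po_gsur PO).

Lemma mu_gt0 : 0 < mu. Proof. by have := pa_mu PA; lra. Qed.

Lemma kbar_gt0 : 0 < kbar. Proof. by have /andP[] := pa_kbar PA. Qed.

(** The sign of [G] is not among the assumptions; the unit vector of the MFCQ provides two points at
    distance 1 to which the Lipschitz bound applies. *)
Lemma lipschitz_ge0 : 0 <= G.
Proof.
have [v [v1 _ _]] := po_mfcq PO Xx0.
have [_ /(_ v 0 Logic.I Logic.I)] := po_loss PO point.
by rewrite subr0 v1 mulr1; apply: le_trans.
Qed.

Lemma reg_convex : convex_ext (reg pb). Proof. by have [] := po_wp PO. Qed.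

Lemma feasible_effdom : feasible (all_con pb) `<=` effdom (reg pb).
Proof.
move=> y; rewrite -XsetE => /(po_dom PO)[[]]; rewrite /effdom /= /Fobj.
by case: (reg pb y) => [r|/=|/=] h _ _; rewrite ?ltry ?ltNye.
Qed.

Lemma lossgrad_bound s y : enorm (lossgrad s y) <= G.
Proof. exact: grad_loss_bound (po_loss PO) lipschitz_ge0 y s. Qed.

Lemma UobjE : U = fun y => mean (xi_law pb) (loss pb y).
Proof. by apply/funext => y; rewrite /Uobj unlock. Qed.

Lemma grad_U_lipschitz y y' : enorm (grad U y - grad U y') <= L * enorm (y - y').
Proof.
rewrite UobjE; apply: (grad_mean_lipschitz _ (po_loss PO) lipschitz_ge0) => //.
  by have [] := po_wp PO.
exact: ltW (pa_L PA).
Qed.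

Lemma grad_U_bound y : enorm (grad U y) <= G.
Proof.
rewrite UobjE; apply: (grad_mean_bound _ (po_loss PO) lipschitz_ge0) => //.
by have [] := po_wp PO.
Qed.

Lemma U_descent y y' : U y' <= U y + dotv (grad U y) (y' - y) + L / 2 * enorm (y' - y) ^+ 2.
Proof.
rewrite UobjE; apply: (mean_loss_descent _ (po_loss PO) lipschitz_ge0).
by have [] := po_wp PO.
Qed.

Definition grad_sum t om : R := \sum_(1 <= i < t.+1) enorm (lossgrad (xi i om) (x i om)) ^+ 2.

Lemma grad_sum0 om : grad_sum 0 om = 0. Proof. by rewrite /grad_sum big_geq. Qed.

Lemma grad_sumS t om : grad_sum t.+1 om =
  grad_sum t om + enorm (lossgrad (xi t.+1 om) (x t.+1 om)) ^+ 2.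
Proof. by rewrite /grad_sum big_nat_recr. Qed.

Lemma grad_sum_ge0 t om : 0 <= grad_sum t om.
Proof. by apply: sumr_ge0 => i _; exact: sqr_ge0. Qed.

Lemma lossgrad_sqr_le s y : enorm (lossgrad s y) ^+ 2 <= G ^+ 2.
Proof.
rewrite ler_pXn2r ?nnegrE ?enorm_ge0 ?lipschitz_ge0//; exact: lossgrad_bound.
Qed.

Lemma grad_sum_le t om : grad_sum t om <= t%:R * G ^+ 2.
Proof.
elim: t => [|t IH]; first by rewrite grad_sum0 mul0r.
by rewrite grad_sumS -natr1 mulrDl mul1r lerD// lossgrad_sqr_le.
Qed.

Definition step_root t om : R := (w + grad_sum t om) `^ (1 / 3).

Lemma stepsizeE t om : eta t om = kbar / step_root t om.
Proof. by []. Qed.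

Lemma step_root_cube t om : step_root t om ^+ 3 = w + grad_sum t om.
Proof. by rewrite cbrt_expr3// addr_ge0 ?grad_sum_ge0// ltW. Qed.

Lemma step_root_ge t om : kbar <= step_root t om.
Proof.
have /andP[_ kw] := pa_kbar PA; apply: (le_trans kw); apply: le_cbrt; first exact: ltW.
by rewrite lerDl grad_sum_ge0.
Qed.

Lemma step_root_gt0 t om : 0 < step_root t om.
Proof. exact: lt_le_trans kbar_gt0 (step_root_ge t om). Qed.

Lemma stepsize_gt0 t om : 0 < eta t om.
Proof. by rewrite stepsizeE divr_gt0 ?kbar_gt0 ?step_root_gt0. Qed.

Lemma stepsize_le1 t om : eta t om <= 1.
Proof. by rewrite stepsizeE ler_pdivrMr ?step_root_gt0// mul1r step_root_ge. Qed.

Lemma stepsize01 t om : 0 <= eta t om <= 1.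
Proof. by rewrite stepsize_le1 ltW// stepsize_gt0. Qed.

Lemma stepsize_le t om : eta t om <= kbar / w `^ (1 / 3).
Proof.
rewrite stepsizeE ler_pM2l ?kbar_gt0// lef_pV2 ?posrE ?step_root_gt0 ?powR_gt0//.
by apply: le_cbrt; [exact: ltW|rewrite lerDl grad_sum_ge0].
Qed.

Lemma w_ge_G : 2 * G ^+ 2 <= w.
Proof. by have := pa_w_ge PA; rewrite ge_max => /andP[]. Qed.

Lemma stepsize_L t om : 2 * L * eta t om <= 4 * mu - 3.
Proof.
have m0 : 0 < 4 * mu - 3 by have := pa_mu PA; lra.
have L2 : 0 < 2 * L by rewrite mulr_gt0// (pa_L PA).
have := pa_w_ge PA; rewrite ge_max => /andP[+ _].
move=> /(cbrt_ge (divr_ge0 (mulr_ge0 (ltW L2) (ltW kbar_gt0)) (ltW m0))).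
rewrite ler_pdivrMr// => h; have wr : 0 < w `^ (1 / 3) by rewrite powR_gt0.
apply: (@le_trans _ _ (2 * L * (kbar / w `^ (1 / 3)))).
  by rewrite ler_pM2l// stepsize_le.
by rewrite mulrA ler_pdivrMr// [leRHS]mulrC.
Qed.

Lemma momentum_bounds t om : 0 <= beta t om <= 1 / 4.
Proof.
rewrite /momentum; have c0 := pa_c PA; apply/andP; split.
  by rewrite mulr_ge0 ?sqr_ge0// ltW.
have w23 : 0 < w `^ (2 / 3) by rewrite powR_gt0.
have k2 : 0 < kbar ^+ 2 by rewrite exprn_gt0 ?kbar_gt0.
apply: (@le_trans _ _ (c * (kbar ^+ 2 / w `^ (2 / 3)))).
  rewrite ler_pM2l// -(cbrt_sqr (ltW wpos)) -expr_div_n.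
  by rewrite ler_pXn2r ?nnegrE ?stepsize_le ?divr_ge0 ?powR_ge0 ?(ltW kbar_gt0) ?(ltW (stepsize_gt0 _ _)).
have k4 : 0 < 4 * kbar ^+ 2 by lra.
have := pa_c_le PA; rewrite ler_pdivlMr// => h.
by rewrite mulrA ler_pdivrMr//; lra.
Qed.

Lemma inv_stepsize_step t om :
  (eta t.+1 om)^-1 - (eta t om)^-1 <= 12 / 25 * G ^+ 2 / kbar ^+ 3 * eta t.+1 om.
Proof.
rewrite !stepsizeE !invf_div.
apply: (@inv_step_bound _ _ _ _ (enorm (lossgrad (xi t.+1 om) (x t.+1 om)) ^+ 2)).
- exact: kbar_gt0.
- exact: step_root_ge.
- apply: le_cbrt; first by rewrite addr_ge0 ?grad_sum_ge0// ltW.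
  by rewrite lerD2l grad_sumS lerDl sqr_ge0.
- by rewrite !step_root_cube grad_sumS addrA.
- exact: lossgrad_sqr_le.
- by rewrite step_root_cube (le_trans w_ge_G)// lerDl grad_sum_ge0.
Qed.

Lemma stepsize_log t om : eta t om ^+ 3 * enorm (lossgrad (xi t.+1 om) (x t.+1 om)) ^+ 2 <=
  3 / 2 * kbar ^+ 3 * (ln (w + grad_sum t.+1 om) - ln (w + grad_sum t om)).
Proof.
have wS : 0 < w + grad_sum t om by rewrite ltr_pwDl// grad_sum_ge0.
have := @log_step R _ (w + grad_sum t.+1 om) (enorm (lossgrad (xi t.+1 om) (x t.+1 om)) ^+ 2) wS.
rewrite grad_sumS addrA sqr_ge0 => /(_ erefl isT).
have hg : 2 * enorm (lossgrad (xi t.+1 om) (x t.+1 om)) ^+ 2 <= w + grad_sum t om.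
  have := lossgrad_sqr_le (xi t.+1 om) (x t.+1 om); have := w_ge_G.
  have := grad_sum_ge0 t om; lra.
move=> /(_ hg) => h.
rewrite stepsizeE expr_div_n step_root_cube.
have k3 : 0 < kbar ^+ 3 by rewrite exprn_gt0 ?kbar_gt0.
have := ler_wpM2l (ltW k3) h; lra.
Qed.

Lemma CoSTA_step t om : (1 <= t)%N -> [/\ z t.+1 om = lossgrad (xi t om) (x t om)
                + (1 - beta t om) *: (z t om - lossgrad (xi t om) (x t.-1 om)),
              argmin_on (Xsur pb sur (x t om)) (sub_obj kbar w c xi x z pb sur t om) (xhat t om) &
              x t.+1 om = (1 - eta t om) *: x t om + eta t om *: xhat t om].
Proof. by move=> t1; have [_ _] := run om; apply. Qed.

(** The new iterate is a convex combination of [x t] and [xhat t], both in the convex surrogate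
    feasible set at [x t]. *)
Lemma x_feasible t om : Xset pb (x t om).
Proof.
have [[x0E x1E] _ _] := run om.
case: t => [|t]; first by rewrite x0E.
elim: t => [|t IH]; first by rewrite x1E.
have [_ [Cxh _] ->] := CoSTA_step om (isT : (1 <= t.+1)%N).
move: IH Cxh; rewrite XsurE XsetE => Xx Cxh.
rewrite addrC; apply: (ch_sub H Xx); apply: (ch_closed H Xx) => //.
  exact: (sur_feasible_self H).
exact: stepsize01.
Qed.

Lemma xhat_sur t om : (1 <= t)%N -> sur_feasible (all_sur pb sur) (x t om) (xhat t om).
Proof. by move=> t1; have [_ [+ _] _] := CoSTA_step om t1; rewrite XsurE. Qed.

Lemma x_feas t om : feasible (all_con pb) (x t om).
Proof. by rewrite -XsetE; exact: x_feasible. Qed.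

Lemma xhat_feas t om : (1 <= t)%N -> feasible (all_con pb) (xhat t om).
Proof. by move=> t1; apply: (ch_sub H (x_feas t om)); exact: xhat_sur. Qed.

Lemma phi_strongly_convex t om : strongly_convex mu (phi t om).
Proof.
apply: strongly_convex_add_affine.
by have [+ _] := po_lsur PO => /(_ _ (xi t om) (x_feasible t om))[].
Qed.

Lemma loss_sur_smooth y s : Xset pb y -> Lsmooth_on L setT (fun y' => loss_sur sur y' y s).
Proof. by move=> Xy; have [+ _] := po_lsur PO => /(_ _ s Xy)[]. Qed.

Lemma phi_smooth t om : Lsmooth_on L setT (phi t om).
Proof. by apply: Lsmooth_add_affine; exact: loss_sur_smooth (x_feasible t om). Qed.

Lemma phi_differentiable t om y : differentiable (phi t om) y.
Proof. by have [+ _] := phi_smooth t om; apply. Qed.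

Lemma grad_phi t om y : grad (phi t om) y =
  grad (fun y' => loss_sur sur y' (x t om) (xi t om)) y +
  (1 - beta t om) *: (z t om - lossgrad (xi t om) (x t.-1 om)).
Proof.
rewrite grad_add_affine//.
by have [+ _] := loss_sur_smooth (xi t om) (x_feasible t om); apply.
Qed.

Lemma grad_phi_x t om : (1 <= t)%N -> grad (phi t om) (x t om) = z t.+1 om.
Proof.
move=> t1; have [-> _ _] := CoSTA_step om t1; rewrite grad_phi.
by have [_ ->] := po_lsur PO; last exact: x_feasible.
Qed.

Let objE t om y : feasible (all_con pb) y ->
  sub_obj kbar w c xi x z pb sur t om y = (phi t om y + u y)%:E.
Proof.
by move=> Xy; rewrite /sub_obj (effdom_finpart reg_convex)//; exact: feasible_effdom.
Qed.

Lemma xhat_min t om y : (1 <= t)%N -> sur_feasible (all_sur pb sur) (x t om) y ->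
  phi t om (xhat t om) + u (xhat t om) <= phi t om y + u y.
Proof.
move=> t1 Cy; have [_ [_ min] _] := CoSTA_step om t1.
rewrite -lee_fin -!objE; [|exact: (ch_sub H (x_feas t om))|exact: xhat_feas].
by apply: min; rewrite XsurE.
Qed.

Lemma xhat_gap t om y : (1 <= t)%N -> feasible (all_con pb) y ->
  phi t om y + u y <= phi t om (xhat t om) + u (xhat t om) + BU.
Proof.
move=> t1 Xy; have := gap om t1 (_ : Xset pb y); rewrite XsetE => /(_ Xy).
have -> : ereal_inf (sub_obj kbar w c xi x z pb sur t om @` Xsur pb sur (x t om)) =
    (phi t om (xhat t om) + u (xhat t om))%:E.
  have [_ [Cxh min] _] := CoSTA_step om t1.
  rewrite -objE; last exact: xhat_feas.
  apply/eqP; rewrite eq_le; apply/andP; split.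
    by apply: ereal_inf_lbound; exists (xhat t om).
  by apply: le_ereal_inf_tmp => _ [y' Cy' <-]; exact: min.
by rewrite objE// -EFinB lee_fin; lra.
Qed.

Lemma delta_bound t om : (1 <= t)%N -> mu / 2 * enorm (xhat t om - x t om) ^+ 2 <= BU.
Proof.
move=> t1; rewrite enormB; apply: (sub_gap_distance H (ltW mu_gt0) reg_convex feasible_effdom
  (x_feas t om) (phi_strongly_convex t om) (xhat_sur om t1)).
  by move=> y; exact: xhat_min.
by move=> y; exact: xhat_gap.
Qed.

Local Notation Delta t om := (xhat t om - x t om).
Local Notation err t om := (z t.+1 om - grad U (x t om)).
Let F y := U y + u y.

Lemma x_increment t om : (1 <= t)%N -> x t.+1 om - x t om = eta t om *: Delta t om.
Proof.
move=> t1; have [_ _ ->] := CoSTA_step om t1.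
by apply/rowP => i; rewrite !mxE; ring.
Qed.

(** Strong convexity enters twice, through the growth at the minimizer [xhat t] and the first-order
    bound at [x t], whence [mu] instead of [mu / 2]. The gradient of [phi] at [x t] is [z t.+1], so
    replacing it by [grad U] costs the error term. *)
Lemma F_descent t om : (1 <= t)%N -> F (x t.+1 om) <= F (x t om) +
  eta t om * (enorm (err t om) * enorm (Delta t om) - 3 / 4 * enorm (Delta t om) ^+ 2).
Proof.
move=> t1; have Xx := x_feas t om; have Xxh := xhat_feas om t1.
have cx := feasible_effdom Xx; have cxh := feasible_effdom Xxh.
have hu : u (x t.+1 om) <= (1 - eta t om) * u (x t om) + eta t om * u (xhat t om).
  have [_ _ ->] := CoSTA_step om t1; rewrite addrC.
  have := convex_on_effdom reg_convex cxh cx (stepsize01 t om); lra.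
have hU := U_descent (x t om) (x t.+1 om).
rewrite x_increment// dotvZr enormZ (ger0_norm (ltW (stepsize_gt0 t om))) exprMn in hU.
have h1 : phi t om (xhat t om) + u (xhat t om) + mu / 2 * enorm (Delta t om) ^+ 2 <=
    phi t om (x t om) + u (x t om).
  rewrite (enormB (xhat t om)); apply: (sub_growth H (ltW mu_gt0) reg_convex feasible_effdom Xx
    (phi_strongly_convex t om) (xhat_sur om t1)); first by move=> y; exact: xhat_min.
  exact: (sur_feasible_self H).
have h2 := convex_first_order (ltW mu_gt0) (@phi_differentiable t om (x t om))
  (phi_strongly_convex t om (xhat t om) (x t om)).
rewrite grad_phi_x// in h2.
have h3 := descent_step (grad U (x t om)) (z t.+1 om) (Delta t om) (stepsize_gt0 t om)
  (stepsize_L t om).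
rewrite dotvBl in h3.
have : eta t om * (dotv (z t.+1 om) (Delta t om) + u (xhat t om) - u (x t om) +
    mu * enorm (Delta t om) ^+ 2) <= 0.
  by rewrite pmulr_rle0 ?stepsize_gt0//; lra.
rewrite /F; lra.
Qed.

Definition noise_dir t om : 'rV[R]_n :=
  lossgrad (xi t.+1 om) (x t.+1 om) - (1 - beta t.+1 om) *: lossgrad (xi t.+1 om) (x t om).

Definition noise_mean t om : 'rV[R]_n := grad U (x t.+1 om) - (1 - beta t.+1 om) *: grad U (x t om).

Definition noise_weight t om : 'rV[R]_n := (eta t om)^-1 *:
  ((2 * (1 - beta t.+1 om)) *: err t om - 2 *: noise_mean t om).

(* The cross term left by expanding |err_(t+1)|^2 / eta_t: given the past, it is linear in
   the centred new sample. *)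
Definition noise t om : R := dotv (noise_weight t om) (noise_dir t om - noise_mean t om).

Definition potential t om : R := enorm (err t om) ^+ 2 / eta t.-1 om.

Lemma err_step t om : err t.+1 om = (1 - beta t.+1 om) *: err t om +
  (noise_dir t om - noise_mean t om).
Proof.
have [-> _ _] := CoSTA_step om (isT : (1 <= t.+1)%N).
by rewrite /noise_dir /noise_mean /=; apply/rowP => i; rewrite !mxE; ring.
Qed.

Lemma potential_le t om : (1 <= t)%N -> potential t.+1 om <= potential t om -
  14 * L ^+ 2 * (eta t om * enorm (err t om) ^+ 2) +
  2 * L ^+ 2 * (eta t om * enorm (Delta t om) ^+ 2) +
  2 * c ^+ 2 * (eta t om ^+ 3 * enorm (lossgrad (xi t.+1 om) (x t.+1 om)) ^+ 2) + noise t om.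
Proof.
move=> t1; have e0 := stepsize_gt0 t om.
apply: (@potential_step _ L G kbar c (eta t om) (eta t.-1 om) _ _ _ _ _ (beta t.+1 om)).
- exact: kbar_gt0.
- by rewrite e0 stepsize_le1.
- exact: sqr_ge0.
- exact: sqr_ge0.
- by [].
- exact: momentum_bounds.
- exact: pa_c_gt PA.
- by case: t t1 {e0} => // t _; exact: inv_stepsize_step.
rewrite err_step; apply: le_trans (momentum_error _ _ _ _) _.
have -> : eta t om * noise t om =
    dotv ((2 * (1 - beta t.+1 om)) *: err t om - 2 *: noise_mean t om) (noise_dir t om - noise_mean t om).
  by rewrite /noise /noise_weight dotvZl mulrA divff ?mul1r// gt_eqF.
rewrite lerD2r lerD2l; apply: le_trans (momentum_direction _ _ _) _.
rewrite lerD2l.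
have h : enorm (lossgrad (xi t.+1 om) (x t.+1 om) - lossgrad (xi t.+1 om) (x t om)) <=
    L * (eta t om * enorm (Delta t om)).
  have [[_ Ll] _] := po_loss PO (xi t.+1 om).
  rewrite (le_trans (Ll _ _ Logic.I Logic.I))// x_increment// enormZ ger0_norm// ltW//.
have h2 : enorm (lossgrad (xi t.+1 om) (x t.+1 om) - lossgrad (xi t.+1 om) (x t om)) ^+ 2 <=
    L ^+ 2 * (eta t om ^+ 2 * enorm (Delta t om) ^+ 2).
  rewrite -!exprMn ler_pXn2r ?nnegrE ?enorm_ge0//.
  exact: le_trans (enorm_ge0 _) h.
have h3 : 0 <= 2 * (1 - beta t.+1 om) ^+ 2 by rewrite mulr_ge0 ?sqr_ge0.
by have := ler_wpM2l h3 h2; rewrite !mulrA.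
Qed.

Context (B1 : R).
Hypothesis F1gap : (Fobj pb x0 - Fstar pb <= B1%:E)%E.

Lemma F_gap y : Xset pb y -> F x0 - F y <= B1.
Proof.
have FE y' : Xset pb y' -> Fobj pb y' = (F y')%:E.
  rewrite XsetE => /feasible_effdom h; by rewrite /Fobj (effdom_finpart reg_convex)// EFinD.
move=> Xy; rewrite -lee_fin EFinB -!FE//; apply: le_trans F1gap.
apply: leeB => //; apply: ereal_inf_lbound; by exists y.
Qed.

Definition sq_error t om : R := enorm (Delta t om) ^+ 2 + enorm (err t om) ^+ 2.

Lemma weighted_sum_le T om :
  \sum_(1 <= t < T.+1) eta t om * sq_error t om <=
  4 * (B1 + (8 * L ^+ 2)^-1 * (potential 1 om +
    3 * c ^+ 2 * kbar ^+ 3 * (ln (w + grad_sum T.+1 om) - ln (w + grad_sum 1 om)) +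
    \sum_(1 <= t < T.+1) noise t om)).
Proof.
set a := (8 * L ^+ 2)^-1.
have L2 : 0 < L ^+ 2 by rewrite exprn_gt0// (pa_L PA).
have aE : a * L ^+ 2 = 1 / 8 by rewrite /a invfM -mulrA mulVf ?gt_eqF// mulr1 div1r.
have a0 : 0 < a by rewrite invr_gt0; lra.
suff : F (x T.+1 om) + a * potential T.+1 om +
    4^-1 * \sum_(1 <= t < T.+1) eta t om * sq_error t om <=
    F (x 1 om) + a * (potential 1 om +
    3 * c ^+ 2 * kbar ^+ 3 * (ln (w + grad_sum T.+1 om) - ln (w + grad_sum 1 om)) +
    \sum_(1 <= t < T.+1) noise t om).
  have := F_gap (x_feasible T.+1 om); have [[_ ->] _ _] := run om.
  have : 0 <= a * potential T.+1 om.
    by rewrite mulr_ge0 ?(ltW a0)// divr_ge0 ?sqr_ge0// ltW// stepsize_gt0.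
  lra.
elim: T => [|T IH].
  by rewrite !big_geq// subrr !mulr0 !addr0.
rewrite big_nat_recr//= [\sum_(1 <= t < T.+2) noise t om]big_nat_recr//=.
have hF := F_descent om (isT : (1 <= T.+1)%N).
have hA := ler_wpM2l (ltW a0) (potential_le om (isT : (1 <= T.+1)%N)).
have hl := ler_wpM2l (ltW (mulr_gt0 a0 (mulr_gt0 (ltr0n _ 2) (exprn_gt0 2 (pa_c PA)))))
  (stepsize_log T.+1 om).
set e := eta T.+1 om in hF hA hl *; have e0 : 0 < e by exact: stepsize_gt0.
rewrite /sq_error in IH *.
set D := enorm (Delta T.+1 om) in hF hA *; set E := enorm (err T.+1 om) in hF hA *.
(* As [a * L ^+ 2 = 1 / 8], the quadratic terms, including the quarter of [sq_error], add up to [e]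
   times [E * D - D ^+ 2 / 4 - 3 / 2 * E ^+ 2], that is, [- (E - D / 2) ^+ 2 - E ^+ 2 / 2]. *)
have key : 0 <= e * (E - D / 2) ^+ 2 by rewrite mulr_ge0 ?sqr_ge0// ltW.
have key2 : 0 <= e * E ^+ 2 by rewrite mulr_ge0 ?sqr_ge0// ltW.
have hA1 : a * (14 * L ^+ 2 * (e * E ^+ 2)) = 14 / 8 * (e * E ^+ 2).
  by rewrite -[14 * _ * _]mulrA mulrCA [a * (_ * _)]mulrA aE; ring.
have hA2 : a * (2 * L ^+ 2 * (e * D ^+ 2)) = 2 / 8 * (e * D ^+ 2).
  by rewrite -[2 * _ * _]mulrA mulrCA [a * (_ * _)]mulrA aE; ring.
lra.
Qed.

Lemma stepsize_ge t om T : (t <= T)%N -> kbar / (w + T%:R * G ^+ 2) `^ (1 / 3) <= eta t om.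
Proof.
move=> tT; rewrite stepsizeE ler_pM2l ?kbar_gt0//.
have wT : 0 < w + T%:R * G ^+ 2 by rewrite ltr_pwDl// mulr_ge0// sqr_ge0.
rewrite lef_pV2 ?posrE ?step_root_gt0 ?powR_gt0//.
apply: le_cbrt; first by rewrite addr_ge0 ?grad_sum_ge0// ltW.
by rewrite lerD2l (le_trans (grad_sum_le t om))// ler_wpM2r ?sqr_ge0// ler_nat.
Qed.

Lemma potential1_le om : potential 1 om <= 4 * G ^+ 2 * (w `^ (1 / 3) / kbar).
Proof.
have e0 : eta 0 om = kbar / w `^ (1 / 3) by rewrite stepsizeE /step_root grad_sum0 addr0.
rewrite /potential /= e0 invf_div ler_wpM2r ?divr_ge0 ?powR_ge0 ?(ltW kbar_gt0)//.
(* [x 0 = x 1], and [z 1] is the gradient there for the first sample, so the momentum correction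
   vanishes. *)
have -> : z 2 om = lossgrad (xi 1 om) (x 1 om).
  have [-> _ _] := CoSTA_step om (isT : (1 <= 1)%N).
  by have [_ -> _] := run om; rewrite /= subrr scaler0 addr0.
have h : enorm (lossgrad (xi 1 om) (x 1 om) - grad U (x 1 om)) <= 2 * G.
  rewrite (le_trans (enorm_triangle _ _))// enormN mulr_natl mulr2n lerD//.
    exact: lossgrad_bound.
  exact: grad_U_bound.
have -> : 4 * G ^+ 2 = (2 * G) ^+ 2 by ring.
by rewrite ler_pXn2r ?nnegrE ?enorm_ge0// mulr_ge0// lipschitz_ge0.
Qed.

Lemma unweighted_sum_le T om :
  \sum_(1 <= t < T.+1) sq_error t om <=
  4 * ((w + T%:R * G ^+ 2) `^ (1 / 3) / kbar) * (B1 + (8 * L ^+ 2)^-1 *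
    (4 * G ^+ 2 * (w `^ (1 / 3) / kbar) +
    3 * c ^+ 2 * kbar ^+ 3 * (ln (w + T.+1%:R * G ^+ 2) - ln w) +
    \sum_(1 <= t < T.+1) noise t om)).
Proof.
have wT : 0 < (w + T%:R * G ^+ 2) `^ (1 / 3).
  by rewrite powR_gt0// ltr_pwDl// mulr_ge0// sqr_ge0.
set q := _ `^ (1 / 3) in wT *; have k0 := kbar_gt0.
have kq : 0 < kbar / q by rewrite divr_gt0.
rewrite -(ler_pM2l kq).
apply: (@le_trans _ _ (\sum_(1 <= t < T.+1) eta t om * sq_error t om)).
  rewrite mulr_sumr big_nat [leRHS]big_nat; apply: ler_sum => t /andP[_ tT].
  rewrite ler_wpM2r ?stepsize_ge//; first by rewrite addr_ge0 ?sqr_ge0.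
apply: le_trans (weighted_sum_le T om) _.
have -> Y : kbar / q * (4 * (q / kbar) * Y) = 4 * Y by field; rewrite !gt_eqF.
rewrite ler_pM2l// lerD2l.
have a0 : 0 < (8 * L ^+ 2)^-1 by rewrite invr_gt0 mulr_gt0// exprn_gt0// (pa_L PA).
rewrite ler_pM2l// lerD2r; apply: lerD; first exact: potential1_le.
have c0 := pa_c PA; rewrite ler_wpM2l ?mulr_ge0 ?sqr_ge0 ?exprn_ge0 ?(ltW k0) ?(ltW c0)//.
apply: lerB.
  rewrite ler_ln ?posrE ?lerD2l ?grad_sum_le// ltr_pwDl ?grad_sum_ge0//.
  by rewrite mulr_ge0 ?sqr_ge0.
by rewrite ler_ln ?posrE ?lerDl ?grad_sum_ge0// ltr_pwDl// grad_sum_ge0.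
Qed.

(** Crude and growing with [t]; its purpose is to make errors and noise bounded at each fixed
    time. *)
Lemma z_bound t om : (1 <= t)%N -> enorm (z t om) <= 2 * t%:R * G.
Proof.
have G0 := lipschitz_ge0; elim: t => // -[|t] IH _.
  have [_ -> _] := run om; apply: le_trans (lossgrad_bound _ _) _; lra.
have [-> _ _] := CoSTA_step om (isT : (1 <= t.+1)%N).
rewrite (le_trans (enorm_triangle _ _))//.
have /andP[b0 b1] := momentum_bounds t.+1 om.
rewrite enormZ ger0_norm; last by lra.
have h1 := lossgrad_bound (xi t.+1 om) (x t.+1 om).
have h2 := lossgrad_bound (xi t.+1 om) (x t.+1.-1 om).
have h3 := enorm_triangle (z t.+1 om) (- lossgrad (xi t.+1 om) (x t.+1.-1 om)).
rewrite enormN in h3.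
have : (1 - beta t.+1 om) * enorm (z t.+1 om - lossgrad (xi t.+1 om) (x t.+1.-1 om)) <=
    enorm (z t.+1 om - lossgrad (xi t.+1 om) (x t.+1.-1 om)).
  by rewrite ler_piMl ?enorm_ge0//; lra.
have := IH isT; rewrite -[t.+2%:R]natr1; lra.
Qed.

Lemma err_bound t om : enorm (err t om) <= (2 * t.+1%:R + 1) * G.
Proof.
rewrite (le_trans (enorm_triangle _ _))// enormN.
have := z_bound om (isT : (1 <= t.+1)%N); have := grad_U_bound (x t om); lra.
Qed.

Lemma delta_sqr_le t om : (1 <= t)%N -> enorm (Delta t om) ^+ 2 <= 2 / mu * BU.
Proof.
move=> t1; have := delta_bound om t1; have m0 := mu_gt0.
by rewrite mulrC -ler_pdivlMr ?divr_gt0// invf_div mulrC.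
Qed.

Definition run_multiplier t om (lam : 'rV[R]_(J + I)) :=
  is_multiplier (all_sur pb sur) (phi t om) (reg pb) (x t om) (xhat t om) lam.

Definition multiplier_bound : R := 2 * L / rho ^+ 2 * BU.

(* Stationarity of the subproblem, solved for the subgradient of u. *)
Definition run_subgrad t om (lam : 'rV[R]_(J + I)) : 'rV[R]_n :=
  - (grad (phi t om) (xhat t om) +
     \sum_k lam 0 k *: grad (all_sur pb sur k ^~ (x t om)) (xhat t om)).

Section Multiplier.
Context (t : nat) (om : S) (lam : 'rV[R]_(J + I)).
Hypotheses (t1 : (1 <= t)%N) (lamP : run_multiplier t om lam).

Lemma run_multiplier_sum : \sum_k lam 0 k <= multiplier_bound.
Proof.
apply: (multiplier_sum_le H (pa_L PA) lipschitz_ge0 (pa_rho PA) (pa_chi PA) (ltW mu_gt0)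
  feasible_effdom (x_feas t om) (phi_strongly_convex t om) (phi_differentiable t om)
  (xhat_sur om t1) _ lamP).
by move=> y; exact: xhat_gap.
Qed.

Lemma run_subgradP : subdiff (reg pb) (xhat t om) (run_subgrad t om lam).
Proof.
exact: (multiplier_subgradient H reg_convex feasible_effdom (x_feas t om) (xhat_sur om t1) lamP).
Qed.

Lemma run_residual :
  enorm (grad U (xhat t om) + \sum_j lam 0 (lshift I j) *: grad (gcon pb j) (xhat t om) +
    \sum_i lam 0 (rshift J i) *: grad (hcon pb i) (xhat t om) + run_subgrad t om lam) <=
  (2 * L + 2 * L * multiplier_bound) * enorm (Delta t om) + enorm (err t om).
Proof.
have := multiplier_residual H (pa_L PA) lipschitz_ge0 (pa_rho PA) (pa_chi PA) (ltW mu_gt0)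
  feasible_effdom (x_feas t om) (phi_strongly_convex t om) (phi_differentiable t om)
  (xhat_sur om t1) (fun y => @xhat_gap t om y t1) lamP grad_U_lipschitz (phi_smooth t om).
rewrite grad_phi_x// big_split_ord /=.
under eq_bigr do rewrite all_con_lshift.
by under [X in _ + (_ + X)]eq_bigr do rewrite all_con_rshift; rewrite addrA.
Qed.

Let slack_part (I' : finType) (f : I' -> 'I_(J + I)) :
  \sum_i lam 0 (f i) <= \sum_k lam 0 k ->
  - (L * multiplier_bound * enorm (Delta t om) ^+ 2) <=
  \sum_i lam 0 (f i) * all_con pb (f i) (xhat t om) <= 0.
Proof.
move=> fle; have [lam0 _] := lamP; apply/andP; split; last first.
  by apply: sumr_le0 => i _; rewrite mulr_ge0_le0//; exact: xhat_feas.
apply: (@le_trans _ _ (\sum_i - (L * enorm (Delta t om) ^+ 2) * lam 0 (f i))); last first.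
  apply: ler_sum => i _.
  exact: (multiplier_slack_ge H feasible_effdom (x_feas t om) (xhat_sur om t1) lamP).
rewrite -mulr_sumr mulNr lerN2 [leRHS]mulrAC ler_wpM2l//.
  by rewrite mulr_ge0 ?sqr_ge0// ltW// (pa_L PA).
exact: le_trans fle run_multiplier_sum.
Qed.

Lemma run_slack_g : - (L * multiplier_bound * enorm (Delta t om) ^+ 2) <=
  \sum_j lam 0 (lshift I j) * gcon pb j (xhat t om) <= 0.
Proof.
have [lam0 _] := lamP; under eq_bigr do rewrite -all_con_lshift.
apply: slack_part; rewrite big_split_ord /= lerDl; exact: sumr_ge0.
Qed.

Lemma run_slack_h : - (L * multiplier_bound * enorm (Delta t om) ^+ 2) <=
  \sum_i lam 0 (rshift J i) * hcon pb i (xhat t om) <= 0.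
Proof.
have [lam0 _] := lamP; under eq_bigr do rewrite -all_con_rshift.
apply: slack_part; rewrite big_split_ord /= lerDr; exact: sumr_ge0.
Qed.

End Multiplier.

(** * Measurability of the iterates *)

End Run.

Lemma random_vector_lipschitz (R : realType) (n m : nat) (K : R) d (T : measurableType d)
    (g : 'rV[R]_n -> 'rV[R]_m) (V : T -> 'rV[R]_n) :
  (forall y y', enorm (g y - g y') <= K * enorm (y - y')) -> random_vector V ->
  random_vector (fun w => g (V w)).
Proof.
move=> gK mV; apply/random_vectorP => i.
apply: (@measurable_comp_continuous _ _ _ _ (fun y => g y 0 i)) => //.
apply: (@lipschitz_continuous _ _ K) => y y'; apply: le_trans (gK y y').
by have := coord_le_enorm (g y - g y') i; rewrite !mxE.
Qed.

(** * Measurability of surrogates and gradients along random points *)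

Section SurrogateMeasurability.
Context (R : realType) (n J I : nat) (dS : measure_display) (Xi : measurableType dS).
Context (L G mu chi rho : R) (pb : problem R Xi n J I) (sur : surrogates R Xi n J).
Hypothesis PO : problem_ok L G mu chi rho pb sur.
Context d (T : measurableType d).
Implicit Types (V W : T -> 'rV[R]_n) (zeta : T -> Xi).

Lemma all_con_continuous k : continuous (all_con pb k).
Proof.
move=> y; apply: differentiable_continuous; rewrite /all_con.
by case: (fintype.split k) => i; [have [[+ _] _] := po_g PO i|have [[+ _] _] := po_h PO i]; apply.
Qed.

Lemma measurable_Xset : measurable (Xset pb : set (borel R n)).
Proof.
rewrite XsetE /feasible; apply: measurable_all => k; apply: measurable_le_set => //.
apply: (@measurable_comp_continuous _ _ (borel R n) _ (all_con pb k) id).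
  exact: all_con_continuous.
exact: measurable_id.
Qed.

Lemma measurable_loss_sur W V zeta : random_vector W -> random_vector V ->
  measurable_fun setT zeta -> (forall w, Xset pb (V w)) ->
  measurable_fun setT (fun w => loss_sur sur (W w) (V w) (zeta w)).
Proof.
move=> mW mV mz XV; have [ml _] := po_meas PO.
have mD : measurable ([set: borel R n] `*` (Xset pb : set (borel R n)) `*` [set: Xi]).
  by apply: measurableX => //; apply: measurableX => //; exact: measurable_Xset.
have mp : measurable_fun setT
    (fun w => ((W w : borel R n, V w : borel R n), zeta w)).
  by apply: measurable_fun_pair => //; exact: measurable_fun_pair.
apply: (measurable_comp mD _ ml mp).
by move=> _ [w _ <-]; split => //; split => //; exact: XV.
Qed.

Lemma measurable_all_sur k W V : random_vector W -> random_vector V ->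
  (forall w, Xset pb (V w)) -> measurable_fun setT (fun w => all_sur pb sur k (W w) (V w)).
Proof.
move=> mW mV XV; rewrite /all_sur; case: (fintype.split k) => i; last first.
  apply: (@measurable_comp_continuous _ _ _ _ (hcon pb i)) => // y.
  by apply: differentiable_continuous; have [[+ _] _] := po_h PO i; apply.
have [_ /(_ i) mg] := po_meas PO.
have mD : measurable ([set: borel R n] `*` (Xset pb : set (borel R n))).
  by apply: measurableX => //; exact: measurable_Xset.
have mp : measurable_fun setT (fun w => (W w : borel R n, V w : borel R n)).
  exact: measurable_fun_pair.
apply: (measurable_comp mD _ mg mp).
by move=> _ [w _ <-]; split => //; exact: XV.
Qed.

(** The gradient is read off the surrogate at its base point, since joint measurability is assumed
    for the surrogate, with an unrestricted first argument. *)
Lemma random_vector_lossgrad V zeta : random_vector V -> measurable_fun setT zeta ->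
  (forall w, Xset pb (V w)) -> random_vector (fun w => grad (loss pb ^~ (zeta w)) (V w)).
Proof.
move=> mV mz XV; have [smooth gradE] := po_lsur PO.
under eq_fun do rewrite -gradE//.
apply: (@random_vector_grad _ _ _ _ (fun w y => loss_sur sur y (V w) (zeta w)) V).
  by move=> w; have [_ [+ _]] := smooth _ (zeta w) (XV w); apply.
move=> v; apply: measurable_loss_sur => //.
by apply: random_vectorD => //; exact: random_vector_cst.
Qed.

Lemma random_vector_grad_all_sur k W V : random_vector W -> random_vector V ->
  (forall w, Xset pb (V w)) -> (forall w, Xset pb (W w)) ->
  random_vector (fun w => grad (all_sur pb sur k ^~ (V w)) (W w)).
Proof.
move=> mW mV XV XW.
apply: (@random_vector_grad _ _ _ _ (fun w y => all_sur pb sur k y (V w)) W) => [w|v].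
  have H := instance_hyps (po_wp PO) (po_csub PO) (po_h PO) (po_g PO) (po_mfcq PO) (po_gsur PO).
  have XVw := XV w; have XWw := XW w; rewrite XsetE in XVw XWw.
  by have [+ _] := ch_smooth_sur H k XVw; apply.
apply: measurable_all_sur => //.
by apply: random_vectorD => //; exact: random_vector_cst.
Qed.

End SurrogateMeasurability.

Section MeasurableRun.
Context (R : realType) (n J I : nat) (dS : measure_display) (Xi : measurableType dS).
Context (L G mu chi rho kbar w c BU : R).
Context (pb : problem R Xi n J I) (sur : surrogates R Xi n J).
Hypothesis PA : parameters_ok L G mu chi rho kbar w c.
Hypothesis PO : problem_ok L G mu chi rho pb sur.
Context d (S : measurableType d).
Context (xi : nat -> S -> Xi) (x0 : 'rV[R]_n) (x xhat z : nat -> S -> 'rV[R]_n).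
Hypothesis run : CoSTA kbar w c xi x xhat z pb sur x0.
Hypothesis Xx0 : Xset pb x0.
Hypothesis gap : bounded_gap kbar w c xi x z pb sur BU.

Local Notation lossgrad s y := (grad (loss pb ^~ s) y).
Local Notation eta := (stepsize kbar w xi x pb).
Local Notation beta := (momentum kbar w c xi x pb).
Local Notation phi := (sub_loss kbar w c xi x z pb sur).
Local Notation u := (finpart (reg pb)).

Let H := instance_hyps (po_wp PO) (po_csub PO) (po_h PO) (po_g PO) (po_mfcq PO) (po_gsur PO).
Let Xx t om : Xset pb (x t om) := x_feasible PA PO run Xx0 t om.
Let Xf t om : feasible (all_con pb) (x t om) := x_feas PA PO run Xx0 t om.
Let G0 : 0 <= G := lipschitz_ge0 PO Xx0.

Section Step.
Context (t : nat).
Hypotheses (t1 : (1 <= t)%N) (mxi : measurable_fun setT (xi t)).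
Hypotheses (mx : random_vector (x t)) (mxp : random_vector (x t.-1)) (mz : random_vector (z t)).
Hypothesis meta : measurable_fun setT (eta t.-1).

Let mbeta : measurable_fun setT (beta t).
Proof. by apply: measurable_funM => //; exact: measurable_funX. Qed.

Let mcorr : random_vector (fun om => z t om - lossgrad (xi t om) (x t.-1 om)).
Proof. by apply: random_vectorB => //; exact: (random_vector_lossgrad PO). Qed.

Lemma random_vector_z_step : random_vector (z t.+1).
Proof.
rewrite (_ : z t.+1 = fun om => lossgrad (xi t om) (x t om) +
    (1 - beta t om) *: (z t om - lossgrad (xi t om) (x t.-1 om))).
  apply: random_vectorD; first exact: (random_vector_lossgrad PO).
  by apply: random_vectorZ => //; exact: measurable_funB.
by apply/funext => om; have [-> _ _] := CoSTA_step run om t1.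
Qed.

Let mphi W : random_vector W -> measurable_fun setT (fun om => phi t om (W om)).
Proof.
move=> mW; apply: measurable_funD; first exact: (measurable_loss_sur PO).
apply: measurable_funM; first exact: measurable_funB.
by apply: measurable_dotv => //; exact: random_vectorB.
Qed.

Let mfeas q : measurable [set om | sur_feasible (all_sur pb sur) (x t om) (ratv R q)].
Proof.
apply: measurable_all => k; apply: measurable_le_set => //.
by apply: (measurable_all_sur PO) => //; exact: random_vector_cst.
Qed.

Let opt om := phi t om (xhat t om) + u (xhat t om).

(** By density the optimal value is the infimum over the feasible rational points, so its strict
    sublevel sets are countable unions. *)
Let mopt : measurable_fun setT opt.
Proof.
apply: measurable_fun_of_lt => a.
rewrite (_ : [set _ | _] = [set om | exists q,
    sur_feasible (all_sur pb sur) (x t om) (ratv R q) /\ phi t om (ratv R q) + u (ratv R q) < a]).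
  apply: measurable_ex => q; apply: measurableI; first exact: mfeas.
  apply: measurable_lt_set => //; apply: measurable_funD => //.
  by apply: mphi; exact: random_vector_cst.
apply/seteqP; split=> om /=;
  by rewrite (objective_lt H (pa_L PA) G0 (pa_rho PA) (pa_chi PA) (reg_convex PO)
    (@feasible_effdom _ _ _ _ _ _ _ _ _ _ _ _ _ PO) (Xf t om)
    (phi_differentiable PA PO run Xx0 t om) (xhat_sur run om t1)
    (fun y => @xhat_min _ _ _ _ _ _ _ _ _ _ _ _ _ _ _ _ PA PO _ _ _ _ _ _ run Xx0 t om y t1)
    (fun y => @xhat_gap _ _ _ _ _ _ _ _ _ _ _ _ _ _ _ _ _ PA PO _ _ _ _ _ _ run Xx0 gap t om y t1)).
Qed.

Let mindic q : measurable_fun setT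
  (\1_[set om | sur_feasible (all_sur pb sur) (x t om) (ratv R q)] : S -> R).
Proof. exact: measurable_indic. Qed.

(* xhat t is the only point that satisfies the strong convexity growth inequality at all the
   rational points of the surrogate feasible set. *)
Lemma random_vector_xhat_step : random_vector (xhat t).
Proof.
pose C q := [set om | sur_feasible (all_sur pb sur) (x t om) (ratv R q)].
(* The indicator voids the inequality at rational points that are infeasible for this outcome. *)
pose F (q : 'rV[rat]_n) om (p : 'rV[R]_n) := \1_(C q) om *
  (opt om + mu / 2 * enorm (ratv R q - p) ^+ 2 - (phi t om (ratv R q) + u (ratv R q))).
apply: (@measurable_unique_solution _ _ _ _ _ F).
- move=> q om p.
  exact: (cvgM (cvg_cst _) (cvgB (cvgD (cvg_cst _) (cvgM (cvg_cst _)
    (@enorm_subr_continuous _ _ _ p))) (cvg_cst _))).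
- move=> q p; apply: measurable_funM; first exact: mindic.
  apply: measurable_funB; last first.
    by apply: measurable_funD => //; apply: mphi; exact: random_vector_cst.
  exact: measurable_funD.
- move=> q om; rewrite /F indicE; have [|_] := boolP (om \in C q); last by rewrite mul0r.
  rewrite inE mul1r subr_le0 => Cq.
  by apply: (sub_growth H (ltW (mu_gt0 PA)) (reg_convex PO) (@feasible_effdom _ _ _ _ _ _ _ _ _ _ _ _ _ PO)
    (Xf t om) (phi_strongly_convex PA PO run Xx0 t om) (xhat_sur run om t1)
    (fun y => xhat_min PA PO run Xx0 t1) Cq).
- move=> om p Fp.
  apply: (minimizer_unique H (pa_L PA) G0 (pa_rho PA) (pa_chi PA) (reg_convex PO)
    (@feasible_effdom _ _ _ _ _ _ _ _ _ _ _ _ _ PO) (Xf t om)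
    (phi_differentiable PA PO run Xx0 t om) (xhat_sur run om t1)
    (fun y => xhat_gap PA PO run Xx0 gap om t1) (mu_gt0 PA)) => q Cq.
  have := Fp q; rewrite /F indicE mem_set// mul1r subr_le0; exact.
Qed.

Let mxhat := random_vector_xhat_step.

Let Xxhat om : Xset pb (xhat t om).
Proof. by rewrite XsetE; exact: (xhat_feas PA PO run Xx0). Qed.

Lemma measurable_grad_sum_step :
  measurable_fun setT (fun om => grad_sum pb xi x t.-1 om) -> measurable_fun setT (grad_sum pb xi x t).
Proof.
move=> mg; rewrite (_ : grad_sum pb xi x t =
    fun om => grad_sum pb xi x t.-1 om + enorm (lossgrad (xi t om) (x t om)) ^+ 2).
  apply: measurable_funD => //; apply: measurable_funX; apply: measurable_enorm.
  exact: (random_vector_lossgrad PO).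
by apply/funext => om; case: t t1 => // t' _; rewrite grad_sumS.
Qed.

Lemma random_vector_x_step : measurable_fun setT (eta t) -> random_vector (x t.+1).
Proof.
move=> me; rewrite (_ : x t.+1 = fun om => (1 - eta t om) *: x t om + eta t om *: xhat t om).
  by apply: random_vectorD; apply: random_vectorZ => //; exact: measurable_funB.
by apply/funext => om; have [_ _ ->] := CoSTA_step run om t1.
Qed.

Let mgphi : random_vector (fun om => grad (phi t om) (xhat t om)).
Proof.
apply: (@random_vector_grad _ _ _ _ (phi t) (xhat t)) => [om|v].
  exact: (phi_differentiable PA PO run Xx0).
by apply: mphi; apply: random_vectorD => //; exact: random_vector_cst.
Qed.

Let mgsur k : random_vector (fun om => grad (all_sur pb sur k ^~ (x t om)) (xhat t om)).
Proof. exact: (random_vector_grad_all_sur PO). Qed.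

Lemma random_vector_run_subgrad (lam : S -> 'rV[R]_(J + I)) : random_vector lam ->
  random_vector (fun om => run_subgrad kbar w c pb sur xi x xhat z t om (lam om)).
Proof.
move=> mlam; apply: random_vectorN; apply: random_vectorD => //.
apply: random_vector_sum => k; apply: random_vectorZ => //.
by move/random_vectorP : mlam; apply.
Qed.

Lemma multiplier_selection : exists2 lam : S -> 'rV[R]_(J + I), random_vector lam &
  forall om, run_multiplier kbar w c pb sur xi x xhat z t om (lam om).
Proof.
pose a (q : 'rV[rat]_n) om := dotv (grad (phi t om) (xhat t om)) (ratv R q - xhat t om) +
  (u (ratv R q) - u (xhat t om)).
pose cv (q : 'rV[rat]_n) om : 'rV[R]_(J + I) := \row_k (all_sur pb sur k (xhat t om) (x t om) +
  dotv (grad (all_sur pb sur k ^~ (x t om)) (xhat t om)) (ratv R q - xhat t om)).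
have mq (q : 'rV[rat]_n) : random_vector (fun om => ratv R q - xhat t om).
  by apply: random_vectorB => //; exact: random_vector_cst.
have ma q : measurable_fun setT (a q).
  apply: measurable_funD; first exact: measurable_dotv.
  (* With no measurability of [u] at hand, its value at [xhat t] is recovered as the optimal value
     minus [phi]. *)
  apply: measurable_funB => //; rewrite (_ : (fun _ => _) = fun om => opt om - phi t om (xhat t om)).
    by apply: measurable_funB => //; exact: mphi.
  by apply/funext => om; rewrite /opt addrAC subrr add0r.
have mcv q : random_vector (cv q).
  apply/random_vectorP => k; under eq_fun do rewrite mxE.
  apply: measurable_funD; last exact: measurable_dotv.
  exact: (measurable_all_sur PO).
pose F (i : 'I_(J + I) + 'rV[rat]_n) om (l : 'rV[R]_(J + I)) := match i with
  | inl k => - l 0 k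
  | inr q => if `[< effdom (reg pb) (ratv R q) >] then - (a q om + dotv l (cv q om)) else 0 end.
have [|||om|lam mlam Flam] := @measurable_selection _ _ _ _ _ F.
- move=> [k|q] om l; first exact: (cvgN (@coord_continuous _ _ _ _ _ l)).
  rewrite /F; case: (asbool _); last by apply: cst_continuous.
  exact: (cvgN (cvgD (cvg_cst _) (@dotvr_continuous _ _ _ l))).
- move=> [k|q] l /=; first exact: measurable_cst.
  case: asboolP => _; last exact: measurable_cst.
  apply: measurable_funN; apply: measurable_funD => //; apply: measurable_dotv => //.
  exact: random_vector_cst.
- move=> [k|q] om l l' r _ _ r01 /=; first by rewrite !mxE; lra.
  by case: asboolP => _; rewrite ?dotvDl ?dotvZl; lra.
- have [l [l0 lP]] := multiplier_exists H (pa_L PA) G0 (pa_rho PA) (pa_chi PA) (reg_convex PO)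
    (@feasible_effdom _ _ _ _ _ _ _ _ _ _ _ _ _ PO) (Xf t om)
    (phi_differentiable PA PO run Xx0 t om) (xhat_sur run om t1)
    (fun y => xhat_min PA PO run Xx0 t1).
  exists l => -[k|q] /=; first by rewrite oppr_le0.
  case: asboolP => // Dq; rewrite oppr_le0; have := lP _ Dq; congr (_ <= _ + _).
  by apply: eq_bigr => k _; rewrite mxE.
exists lam => // om.
apply: (is_multiplier_rational H (pa_L PA) G0 (pa_rho PA) (pa_chi PA) (reg_convex PO)
    (@feasible_effdom _ _ _ _ _ _ _ _ _ _ _ _ _ PO) (Xf t om)
    (phi_differentiable PA PO run Xx0 t om) (fun y => xhat_gap PA PO run Xx0 gap om t1)).
  by move=> k; have := Flam (inl k) om; rewrite /= oppr_le0.
move=> q Dq; have := Flam (inr q) om; rewrite /=; case: asboolP => // _; rewrite oppr_le0.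
by congr (_ <= _ + _); apply: eq_bigr => k _; rewrite mxE.
Qed.

End Step.

Lemma measurable_stepsize t : measurable_fun setT (grad_sum pb xi x t) ->
  measurable_fun setT (eta t).
Proof.
move=> mg; rewrite (_ : eta t = fun om => kbar * (w + grad_sum pb xi x t om) `^ (- (1 / 3))).
  apply: measurable_funM => //.
  by apply: (measurableT_comp (measurable_powR (- (1 / 3)))); exact: measurable_funD.
by apply/funext => om; rewrite stepsizeE powRN.
Qed.

(** The horizon [N] is there for the sigma-algebra of the past, over which only finitely many
    samples are known to be measurable. *)
Lemma iterates_measurable (N t : nat) : (1 <= t <= N)%N ->
  (forall i, (1 <= i <= N)%N -> measurable_fun setT (xi i)) ->
  [/\ random_vector (x t), random_vector (x t.-1), random_vector (z t) &
      measurable_fun setT (grad_sum pb xi x t.-1)].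
Proof.
move=> tN mxi; case: t tN => // t; elim: t => [|t IH] tN.
  have E0 : x 0 = fun=> x0 by apply/funext => om; have [[]] := run om.
  have E1 : x 1 = fun=> x0 by apply/funext => om; have [[]] := run om.
  have Ez : z 1 = fun om => lossgrad (xi 1 om) (x 0 om) by apply/funext => om; have [] := run om.
  rewrite Ez /= E0 E1; split; try exact: random_vector_cst.
    apply: (random_vector_lossgrad PO) => //; first exact: random_vector_cst.
    exact: mxi.
  rewrite (_ : grad_sum pb xi x 0 = fun=> 0); first exact: measurable_cst.
  by apply/funext => om; rewrite grad_sum0.
have tN' : (0 < t.+1 <= N)%N by case/andP: tN => _ /ltnW.
have [mx mxp mz mg] := IH tN'; have mxt := mxi _ tN'.
have t1 : (1 <= t.+1)%N by [].
have mg' := measurable_grad_sum_step t1 mxt mx mg.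
have me := measurable_stepsize mg; have me' := measurable_stepsize mg'.
split=> //; first exact: (random_vector_x_step t1 mxt mx mxp mz me me').
exact: (random_vector_z_step t1 mxt mx mxp mz me).
Qed.

Section AtTime.
Context (N t : nat).
Hypotheses (tN : (1 <= t <= N)%N) (mxi : forall i, (1 <= i <= N)%N -> measurable_fun setT (xi i)).

Let t1 : (1 <= t)%N. Proof. by case/andP: tN. Qed.

Lemma random_vector_x : random_vector (x t).
Proof. by have [] := iterates_measurable tN mxi. Qed.

Lemma random_vector_z : random_vector (z t.+1).
Proof.
have [mx mxp mz mg] := iterates_measurable tN mxi.
exact: (random_vector_z_step t1 (mxi tN) mx mxp mz (measurable_stepsize mg)).
Qed.

Lemma measurable_eta : measurable_fun setT (eta t).
Proof.
have [mx mxp mz mg] := iterates_measurable tN mxi.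
exact/measurable_stepsize/(measurable_grad_sum_step t1 (mxi tN) mx mg).
Qed.

Lemma random_vector_xhat : random_vector (xhat t).
Proof.
have [mx mxp mz mg] := iterates_measurable tN mxi.
exact: (random_vector_xhat_step t1 (mxi tN) mx mxp mz (measurable_stepsize mg)).
Qed.

Lemma random_vector_x_next : random_vector (x t.+1).
Proof.
have [mx mxp mz mg] := iterates_measurable tN mxi.
exact: (random_vector_x_step t1 (mxi tN) mx mxp mz (measurable_stepsize mg) measurable_eta).
Qed.

Lemma run_multiplier_selection : exists2 lam : S -> 'rV[R]_(J + I), random_vector lam &
  forall om, run_multiplier kbar w c pb sur xi x xhat z t om (lam om).
Proof.
have [mx mxp mz mg] := iterates_measurable tN mxi.
exact: (multiplier_selection t1 (mxi tN) mx mxp mz (measurable_stepsize mg)).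
Qed.

Lemma measurable_run_subgrad (lam : S -> 'rV[R]_(J + I)) : random_vector lam ->
  random_vector (fun om => run_subgrad kbar w c pb sur xi x xhat z t om (lam om)).
Proof.
have [mx mxp mz mg] := iterates_measurable tN mxi.
exact: (random_vector_run_subgrad t1 (mxi tN) mx mxp mz (measurable_stepsize mg)).
Qed.

End AtTime.

End MeasurableRun.

(** * Measurability of the noise weights and of the squared error *)

Section NoiseMeasurability.
Context (R : realType) (n J I : nat) (dS : measure_display) (Xi : measurableType dS).
Context (L G mu chi rho kbar w c BU : R).
Context (pb : problem R Xi n J I) (sur : surrogates R Xi n J).
Hypothesis PA : parameters_ok L G mu chi rho kbar w c.
Hypothesis PO : problem_ok L G mu chi rho pb sur.
Context d (S : measurableType d).
Context (xi : nat -> S -> Xi) (x0 : 'rV[R]_n) (x xhat z : nat -> S -> 'rV[R]_n).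
Hypothesis run : CoSTA kbar w c xi x xhat z pb sur x0.
Hypothesis Xx0 : Xset pb x0.
Hypothesis gap : bounded_gap kbar w c xi x z pb sur BU.
Context (t : nat).
Hypotheses (t1 : (1 <= t)%N) (mxi : forall i, (1 <= i <= t)%N -> measurable_fun setT (xi i)).

Let tt : (1 <= t <= t)%N. Proof. by rewrite t1 leqnn. Qed.

Let mx := random_vector_x PA PO run Xx0 gap tt mxi.
Let mxn := random_vector_x_next PA PO run Xx0 gap tt mxi.
Let me := measurable_eta PA PO run Xx0 gap tt mxi.

Lemma random_vector_err : random_vector (fun om => z t.+1 om - grad (Uobj pb) (x t om)).
Proof.
apply: random_vectorB; first exact: (random_vector_z PA PO run Xx0 gap tt mxi).
exact: (random_vector_lipschitz (grad_U_lipschitz PA PO Xx0)).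
Qed.

Lemma measurable_momentum_next : measurable_fun setT (fun om => 1 - momentum kbar w c xi x pb t.+1 om).
Proof.
apply: measurable_funB => //; apply: measurable_funM => //; exact: measurable_funX.
Qed.

Lemma random_vector_noise_mean : random_vector (noise_mean kbar w c pb xi x t).
Proof.
apply: random_vectorB; first exact: (random_vector_lipschitz (grad_U_lipschitz PA PO Xx0)).
apply: random_vectorZ; first exact: measurable_momentum_next.
exact: (random_vector_lipschitz (grad_U_lipschitz PA PO Xx0)).
Qed.

Lemma random_vector_noise_weight : random_vector (noise_weight kbar w c pb xi x z t).
Proof.
apply: random_vectorZ.
  rewrite (_ : (fun om => _) = (fun r => r `^ (-1)) \o stepsize kbar w xi x pb t).
    exact: (measurableT_comp (measurable_powR (-1))).
  apply/funext => om /=; rewrite powR_inv1//; apply: ltW.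
  exact: (stepsize_gt0 pb PA).
apply: random_vectorB; last by apply: random_vectorZ => //; exact: random_vector_noise_mean.
apply: random_vectorZ; last exact: random_vector_err.
by apply: measurable_funM => //; exact: measurable_momentum_next.
Qed.

Lemma measurable_sq_error : measurable_fun setT (sq_error pb x xhat z t).
Proof.
apply: measurable_funD; apply: measurable_funX; apply: measurable_enorm; last exact: random_vector_err.
by apply: random_vectorB => //; exact: (random_vector_xhat PA PO run Xx0 gap tt mxi).
Qed.

End NoiseMeasurability.

(** * Expected error and KKT residuals *)

Section RunExpectation.
Context (R : realType) (n J I : nat) (dS : measure_display) (Xi : measurableType dS).
Context (L G mu chi rho kbar w c BU B1 : R).
Context (pb : problem R Xi n J I) (sur : surrogates R Xi n J).
Hypothesis PA : parameters_ok L G mu chi rho kbar w c.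
Hypothesis PO : problem_ok L G mu chi rho pb sur.
Context (dO : measure_display) (Om : measurableType dO) (P : probability Om R).
Context (xi : nat -> {RV P >-> Xi}) (x0 : 'rV[R]_n) (x xhat z : nat -> Om -> 'rV[R]_n).
Hypothesis iid : iid_samples (xi_law pb) xi.
Hypothesis run : CoSTA kbar w c xi x xhat z pb sur x0.
Hypothesis Xx0 : Xset pb x0.
Hypothesis gap : bounded_gap kbar w c xi x z pb sur BU.

Local Notation lossgrad s y := (grad (loss pb ^~ s) y).
Local Notation beta := (momentum kbar w c xi x pb).
Local Notation U := (Uobj pb).
Local Notation wt := (noise_weight kbar w c pb xi x z).
Local Notation mn := (noise_mean kbar w c pb xi x).

Let G0 : 0 <= G := lipschitz_ge0 PO Xx0.

Section Noise.
Context (t : nat).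
Hypothesis t1 : (1 <= t)%N.

Let Q := past xi t.+1.

(** The noise with the fresh sample split off as a separate argument; all other factors are
    functions of the first [t] samples. *)
Let h (p : Q * Xi) : R := dotv (wt t p.1)
  (lossgrad p.2 (x t.+1 p.1) - (1 - beta t.+1 p.1) *: lossgrad p.2 (x t p.1) - mn t p.1).

Let tt : (1 <= t <= t)%N. Proof. by rewrite t1 leqnn. Qed.

Let mxi i : (1 <= i <= t)%N -> measurable_fun [set: Q] (xi i : Q -> Xi).
Proof. by move=> it; exact: measurable_past_sample. Qed.

(* [Q] has carrier [Om], so the run is also a run on [Q]. *)
Let xiQ : nat -> Q -> Xi := fun i => xi i.
Let xQ : nat -> Q -> 'rV[R]_n := x.
Let xhatQ : nat -> Q -> 'rV[R]_n := xhat.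
Let zQ : nat -> Q -> 'rV[R]_n := z.
Let runQ : CoSTA kbar w c xiQ xQ xhatQ zQ pb sur x0 := run.
Let gapQ : bounded_gap kbar w c xiQ xQ zQ pb sur BU := gap.

Let mx : random_vector (xQ t) := random_vector_x PA PO runQ Xx0 gapQ tt mxi.
Let mxn : random_vector (xQ t.+1) := random_vector_x_next PA PO runQ Xx0 gapQ tt mxi.
Let mb := measurable_momentum_next PA PO runQ Xx0 gapQ t1 mxi.
Let mmean := random_vector_noise_mean PA PO runQ Xx0 gapQ t1 mxi.
Let mweight := random_vector_noise_weight PA PO runQ Xx0 gapQ t1 mxi.

Let mh : measurable_fun setT h.
Proof.
have m1 : @random_vector R _ (Q * Xi)%type n (fun p => xQ t p.1) by exact: (measurableT_comp mx).
have m2 : @random_vector R _ (Q * Xi)%type n (fun p => xQ t.+1 p.1).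
  exact: (measurableT_comp mxn).
have m3 : @random_vector R _ (Q * Xi)%type n (fun p => noise_weight kbar w c pb xiQ xQ zQ t p.1).
  exact: (measurableT_comp mweight).
have m4 : @random_vector R _ (Q * Xi)%type n (fun p => noise_mean kbar w c pb xiQ xQ t p.1).
  exact: (measurableT_comp mmean).
have m5 : measurable_fun setT (fun p : Q * Xi => 1 - momentum kbar w c xiQ xQ pb t.+1 p.1).
  exact: (measurableT_comp mb).
have X1 (p : Q * Xi) : Xset pb (xQ t p.1) by exact: (x_feasible PA PO runQ Xx0).
have X2 (p : Q * Xi) : Xset pb (xQ t.+1 p.1) by exact: (x_feasible PA PO runQ Xx0).
apply: (measurable_dotv m3); apply: (fun m => random_vectorB m m4); apply: random_vectorB.
  exact: (random_vector_lossgrad PO m2 _ X2).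
apply: (random_vectorZ m5); exact: (random_vector_lossgrad PO m1 _ X1).
Qed.

Let scaled_le (a : R) (v : 'rV[R]_n) (M : R) : 0 <= a <= 1 -> enorm v <= M -> enorm (a *: v) <= M.
Proof.
move=> /andP[a0 a1] vM; rewrite enormZ ger0_norm// (le_trans _ vM)//.
by rewrite ler_piMl// enorm_ge0.
Qed.

Let b01 om : 0 <= 1 - beta t.+1 om <= 1.
Proof. by have /andP[] := momentum_bounds pb PA xi x t.+1 om; lra. Qed.

Let mn_le om : enorm (mn t om) <= 2 * G.
Proof.
rewrite (le_trans (enorm_triangle _ _))// enormN mulr_natl mulr2n lerD//.
  exact: (grad_U_bound PO Xx0).
by apply: scaled_le => //; exact: (grad_U_bound PO Xx0).
Qed.

Let wt_le om : enorm (wt t om) <=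
  (w + t%:R * G ^+ 2) `^ (1 / 3) / kbar * (2 * ((2 * t.+1%:R + 1) * G) + 2 * (2 * G)).
Proof.
have e0 := stepsize_gt0 pb PA xi x t om.
have wT : 0 < (w + t%:R * G ^+ 2) `^ (1 / 3).
  by rewrite powR_gt0// ltr_pwDl ?(pa_w PA)// mulr_ge0// sqr_ge0.
rewrite enormZ ger0_norm ?invr_ge0 ?(ltW e0)//.
apply: ler_pM; rewrite ?invr_ge0 ?(ltW e0) ?enorm_ge0//.
  rewrite -[leRHS]invf_div lef_pV2 ?posrE//; last by rewrite divr_gt0// (kbar_gt0 PA).
  exact: (stepsize_ge PA PO xi x Xx0).
rewrite (le_trans (enorm_triangle _ _))// enormN lerD//.
  rewrite -scalerA enormZ ger0_norm// ler_pM2l//.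
  by apply: scaled_le => //; exact: (err_bound PA PO run Xx0).
by rewrite enormZ ger0_norm// ler_pM2l.
Qed.

Let dir_le (om : Om) s :
  enorm (lossgrad s (x t.+1 om) - (1 - beta t.+1 om) *: lossgrad s (x t om) - mn t om) <=
  G + G + 2 * G.
Proof.
rewrite (le_trans (enorm_triangle _ _))// [enorm (- mn t om)]enormN lerD//.
rewrite (le_trans (enorm_triangle _ _))// enormN lerD//; first exact: (lossgrad_bound PO Xx0).
by apply: scaled_le => //; exact: (lossgrad_bound PO Xx0).
Qed.

Let bh : bounded_rv h.
Proof.
split; first exact: mh.
exists ((w + t%:R * G ^+ 2) `^ (1 / 3) / kbar * (2 * ((2 * t.+1%:R + 1) * G) + 2 * (2 * G)) *
  (G + G + 2 * G)) => -[om s].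
apply: (le_trans (normr_dotv_le _ _)).
exact: (ler_pM (enorm_ge0 _) (enorm_ge0 _) (wt_le om) (dir_le om s)).
Qed.

Lemma bounded_rv_noise : @bounded_rv _ Om R (noise kbar w c pb xi x z t).
Proof.
split; last by have [_ [M hM]] := bh; exists M => om; exact: (hM (om, xi t.+1 om)).
have m : measurable_fun [set: Om] (fun om : Om => h (om : Q, xi t.+1 om)).
  apply: (measurableT_comp mh); apply: measurable_fun_pair; first exact: measurable_past_id.
  exact: measurable_funPT.
exact: m.
Qed.

(** With the past frozen, averaging over the fresh sample turns both loss gradients into [grad U],
    and [noise_mean] cancels them. *)
Lemma mean_noise : mean P (noise kbar w c pb xi x z t) = 0.
Proof.
rewrite [LHS](mean_past iid (t := t.+1) (h := h))//.
rewrite -[RHS](mean_cst P); congr (mean P _); apply/funext => om; rewrite /h /=.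
set y' := x t.+1 om; set y := x t om; set a := 1 - _; set v := wt t om.
have intf : forall y, (xi_law pb).-integrable setT (EFin \o loss pb y) by have [] := po_wp PO.
have bg y0 := bounded_rv_grad_loss intf (po_loss PO) G0 y0 v.
have bc y0 r : bounded_rv (fun s => r * dotv (lossgrad s y0) v).
  by apply: bounded_rvM => //; exact: bounded_rv_cst.
have mE y0 : mean (xi_law pb) (fun s => dotv (lossgrad s y0) v) = dotv (grad U y0) v.
  rewrite (UobjE pb) (dotv_grad_mean intf (po_loss PO) G0)//; exact: ltW (pa_L PA).
under eq_fun do rewrite dotvC !dotvBl dotvZl.
rewrite meanB; [|exact: bounded_rvB|exact: bounded_rv_cst].
by rewrite meanB// meanZ// !mE mean_cst dotvZl subrr.
Qed.

End Noise.

Let mxiT N i : (1 <= i <= N)%N -> measurable_fun [set: Om] (xi i).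
Proof. by move=> _; exact: measurable_funPT. Qed.

Lemma bounded_rv_sq_error t : (1 <= t)%N -> @bounded_rv _ Om R (sq_error pb x xhat z t).
Proof.
move=> t1; split; first exact: (measurable_sq_error PA PO run Xx0 gap t1 (@mxiT t)).
exists (2 / mu * BU + ((2 * t.+1%:R + 1) * G) ^+ 2) => om.
rewrite ger0_norm ?addr_ge0 ?sqr_ge0//; apply: lerD.
  exact: (delta_sqr_le PA PO run Xx0 gap).
have e := err_bound PA PO run Xx0 t om.
by rewrite ler_pXn2r// nnegrE; [exact: enorm_ge0|exact: le_trans (enorm_ge0 _) e].
Qed.

Hypothesis F1gap : (Fobj pb x0 - Fstar pb <= B1%:E)%E.

Definition error_budget (T : nat) : R :=
  4 * ((w + T%:R * G ^+ 2) `^ (1 / 3) / kbar) * (B1 + (8 * L ^+ 2)^-1 *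
    (4 * G ^+ 2 * (w `^ (1 / 3) / kbar) +
    3 * c ^+ 2 * kbar ^+ 3 * (ln (w + T.+1%:R * G ^+ 2) - ln w))).

Lemma mean_sq_error_sum T :
  \sum_(0 <= t < T) mean P (sq_error pb x xhat z t.+1) <= error_budget T.
Proof.
have bS t : @bounded_rv _ Om R (sq_error pb x xhat z t.+1) by exact: bounded_rv_sq_error.
have bN t : @bounded_rv _ Om R (noise kbar w c pb xi x z t.+1) by exact: bounded_rv_noise.
rewrite -(mean_sum P _ _ bS).
set A := 4 * ((w + T%:R * G ^+ 2) `^ (1 / 3) / kbar).
set a := (8 * L ^+ 2)^-1.
have bSum : bounded_rv (fun om => \sum_(0 <= i < T) noise kbar w c pb xi x z i.+1 om).
  exact: bounded_rv_sum.
apply: (@le_trans _ _ (mean P (fun om => error_budget T +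
    A * a * \sum_(0 <= i < T) noise kbar w c pb xi x z i.+1 om))).
  apply: mean_le; first exact: bounded_rv_sum.
    apply: bounded_rvD; first exact: bounded_rv_cst.
    by apply: bounded_rvM => //; exact: bounded_rv_cst.
  move=> om; have := unweighted_sum_le PA PO run Xx0 F1gap T om.
  rewrite !big_add1 /= -/A -/a /error_budget -/A -/a => h; apply: le_trans h _.
  by rewrite le_eqVlt; apply/orP; left; apply/eqP; ring.
rewrite meanD; [|exact: bounded_rv_cst|]; last first.
  by apply: bounded_rvM => //; exact: bounded_rv_cst.
rewrite mean_cst meanZ// mean_sum// big1 ?mulr0 ?addr0// => t _.
exact: mean_noise.
Qed.

Lemma exists_small_error T : (1 <= T)%N -> exists2 t, (1 <= t <= T)%N &
  T%:R * mean P (sq_error pb x xhat z t) <= error_budget T.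
Proof.
move=> T1; apply: contrapT => noT; have := mean_sq_error_sum T; apply/negP; rewrite -ltNge.
have T0 : 0 < T%:R :> R by rewrite ltr0n.
have -> : error_budget T = \sum_(0 <= t < T) error_budget T / T%:R.
  by rewrite sumr_const_nat subn0 -[RHS]mulr_natr divfK// gt_eqF.
case: T T1 noT T0 => // T _ noT T0; rewrite !big_mkord; apply: ltr_sum => [|i _].
  by apply/hasP; exists ord0; rewrite ?mem_index_enum.
rewrite ltr_pdivrMr// mulrC ltNge; apply/negP => h.
by apply: noT; exists i.+1; rewrite ?ltn_ord.
Qed.

(** The first summand brings the Young bound on the residual down to the square root of [eps], the
    second the complementarity gap to [eps]; for a nonnegative multiplier bound one condition covers
    both. *)
Definition kkt_constant : R :=
  2 * ((2 * L + 2 * L * multiplier_bound L rho BU) ^+ 2 + 1) + L * multiplier_bound L rho BU.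

Lemma small_error_eps_KKT (t : nat) (eps : R) : (1 <= t)%N -> 0 < eps ->
  kkt_constant * mean P (sq_error pb x xhat z t) <= eps ->
  exists (lam : Om -> 'rV[R]_J) (nu : Om -> 'rV[R]_I), eps_KKT P pb eps (xhat t) lam nu.
Proof.
move=> t1 eps0 small; have tt : (1 <= t <= t)%N by rewrite t1 leqnn.
have [lam mlam lamP] := run_multiplier_selection PA PO run Xx0 gap tt (@mxiT t).
have mxh := random_vector_xhat PA PO run Xx0 gap tt (@mxiT t).
have bsq := bounded_rv_sq_error t1.
set B := multiplier_bound L rho BU in small *.
have lam0 om k : 0 <= lam om 0 k by have [] := lamP om.
(* [BU] carries no sign by assumption, but a multiplier at any one outcome has a nonnegative sum
   below this bound. *)
have B0 : 0 <= B.
  apply: le_trans (run_multiplier_sum PA PO run Xx0 gap t1 (lamP point)).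
  by apply: sumr_ge0 => k _; exact: lam0.
have LB0 : 0 <= L * B by rewrite mulr_ge0// ltW// (pa_L PA).
have sq0 om : 0 <= sq_error pb x xhat z t om by rewrite addr_ge0 ?sqr_ge0.
have msq0 : 0 <= mean P (sq_error pb x xhat z t).
  by rewrite -(mean_cst P 0); apply: mean_le => //; exact: bounded_rv_cst.
have mlamk k : measurable_fun setT (fun om => lam om 0 k) by move/random_vectorP : mlam; exact.
have mg : random_vector (fun om => \sum_j lam om 0 (lshift I j) *: grad (gcon pb j) (xhat t om)).
  apply: random_vector_sum => j; apply: random_vectorZ => //.
  apply: (@random_vector_lipschitz _ _ _ L) => // y y'.
  by have [[_ +] _] := po_g PO j; apply.
have mh : random_vector (fun om => \sum_i lam om 0 (rshift J i) *: grad (hcon pb i) (xhat t om)).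
  apply: random_vector_sum => i; apply: random_vectorZ => //.
  apply: (@random_vector_lipschitz _ _ _ L) => // y y'.
  by have [[_ +] _] := po_h PO i; apply.
have mv := measurable_run_subgrad PA PO run Xx0 gap tt (@mxiT t) mlam.
have mU : random_vector (fun om => grad U (xhat t om)).
  exact: (random_vector_lipschitz (grad_U_lipschitz PA PO Xx0)).
have bY : @bounded_rv _ Om R (fun om => L * B * sq_error pb x xhat z t om).
  by apply: bounded_rvM => //; exact: bounded_rv_cst.
have slack (X : Om -> R) : measurable_fun setT X ->
    (forall om, - (L * B * enorm (xhat t om - x t om) ^+ 2) <= X om <= 0) ->
    ((- eps)%:E <= 'E_P[X])%E.
  move=> mX Xle.
  have Xle' om : - (L * B * sq_error pb x xhat z t om) <= X om <= 0.
    have /andP[h ->] := Xle om; rewrite andbT (le_trans _ h)// lerN2 ler_wpM2l// lerDl sqr_ge0//.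
  have bX : bounded_rv X.
    apply: (bounded_rv_le mX _ bY) => om; have /andP[h1 h2] := Xle' om.
    by rewrite ler0_norm// lerNl.
  rewrite expectation_mean// lee_fin.
  apply: (@le_trans _ _ (mean P (fun om => - (L * B * sq_error pb x xhat z t om)))).
    under eq_fun do rewrite -mulNr; rewrite meanZ// mulNr lerN2.
    apply: le_trans small; rewrite ler_wpM2r// /kkt_constant -/B lerDr.
    by rewrite mulr_ge0// addr_ge0// sqr_ge0.
  apply: mean_le => //; first exact: bounded_rvN.
  by move=> om; have /andP[] := Xle' om.
have gc j : continuous (gcon pb j).
  by move=> y; apply: differentiable_continuous; have [[+ _] _] := po_g PO j; apply.
have hc i : continuous (hcon pb i).
  by move=> y; apply: differentiable_continuous; have [[+ _] _] := po_h PO i; apply.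
exists (fun om => \row_j lam om 0 (lshift I j)), (fun om => \row_i lam om 0 (rshift J i)); split.
- split=> //; apply/random_vectorP => k; under eq_fun do rewrite mxE; exact: mlamk.
- move=> om; split; first by rewrite XsetE; exact: (xhat_feas PA PO run Xx0).
    by move=> j; rewrite mxE.
  by move=> i; rewrite mxE.
- exists (fun om => run_subgrad kbar w c pb sur xi x xhat z t om (lam om)); split=> //.
    by move=> om; exact: (run_subgradP PA PO run Xx0 t1 (lamP om)).
  set r := (X in 'E_P[X]%E).
  have s0 : 0 < Num.sqrt eps by rewrite sqrtr_gt0.
  set a := (2 * L + 2 * L * B) ^+ 2 + 1.
  have rle om : r om <= a * sq_error pb x xhat z t om / Num.sqrt eps + Num.sqrt eps / 2.
    apply: le_trans (le_quadratic _ _ _ s0); rewrite /r.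
    under eq_bigr do rewrite mxE.
    under [X in _ + X + _]eq_bigr do rewrite mxE.
    exact: (run_residual PA PO run Xx0 gap t1 (lamP om)).
  have mr : measurable_fun setT r.
    apply: measurable_enorm; apply: random_vectorD => //; apply: random_vectorD.
      apply: random_vectorD => //; move: mg; congr random_vector; apply/funext => om.
      by apply: eq_bigr => j _; rewrite mxE.
    move: mh; congr random_vector; apply/funext => om.
    by apply: eq_bigr => j _; rewrite mxE.
  have b1 : bounded_rv (fun om => a * sq_error pb x xhat z t om / Num.sqrt eps).
    apply: bounded_rvM; last exact: bounded_rv_cst.
    by apply: bounded_rvM => //; exact: bounded_rv_cst.
  have b2 : bounded_rv (fun om => a * sq_error pb x xhat z t om / Num.sqrt eps + Num.sqrt eps / 2).
    by apply: bounded_rvD => //; exact: bounded_rv_cst.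
  have br : bounded_rv r.
    by apply: (bounded_rv_le mr _ b2) => om; rewrite ger0_norm ?enorm_ge0.
  rewrite expectation_mean// lee_fin.
  apply: (le_trans (mean_le P br b2 rle)).
  rewrite meanD//; last exact: bounded_rv_cst.
  rewrite mean_cst; under eq_fun do rewrite mulrAC; rewrite meanZ//.
  have h : 2 * a * mean P (sq_error pb x xhat z t) <= eps.
    by apply: le_trans small; rewrite ler_wpM2r// /kkt_constant -/B -/a lerDl.
  rewrite -lerBrDr -(ler_pM2r s0) mulrAC divfK ?gt_eqF// mulrBl -expr2 sqr_sqrtr ?(ltW eps0)//.
  have -> : Num.sqrt eps / 2 * Num.sqrt eps = eps / 2.
    by rewrite mulrAC -expr2 sqr_sqrtr// ltW.
  lra.
- apply: slack => [|om].
    apply: measurable_sum => j; apply: measurable_funM.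
      by under eq_fun do rewrite mxE; exact: mlamk.
    exact: measurable_comp_continuous.
  under eq_bigr do rewrite mxE.
  exact: (run_slack_g PA PO run Xx0 gap t1 (lamP om)).
- apply: slack => [|om].
    apply: measurable_sum => i; apply: measurable_funM.
      by under eq_fun do rewrite mxE; exact: mlamk.
    exact: measurable_comp_continuous.
  under eq_bigr do rewrite mxE.
  exact: (run_slack_h PA PO run Xx0 gap t1 (lamP om)).
Qed.
End RunExpectation.

(** * Iteration count *)

Section Rate.
Context (R : realType) (L G kbar w c B1 : R).
Hypotheses (w0 : 0 < w) (kbar0 : 0 < kbar).

(** With [y] of the order of the cube root of [T], [w + T * G ^+ 2] is at most
    [(w + 2 * G ^+ 2) * y ^+ 3]; the 3 in [d] comes from [T + 1 <= 3 * y ^+ 3]. *)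
Lemma error_budget_growth : exists2 A : R, 0 < A & forall (T : nat) (y : R), 1 <= y ->
  T%:R <= 2 * y ^+ 3 -> error_budget L G kbar w c B1 T <= A * y * (1 + ln y).
Proof.
set a := (8 * L ^+ 2)^-1; have a0 : 0 <= a by rewrite invr_ge0 mulr_ge0 ?sqr_ge0.
have g0 : 0 <= G ^+ 2 by exact: sqr_ge0.
have cb (r : R) : 0 <= r `^ (1 / 3) by exact: powR_ge0.
set r := (w + 2 * G ^+ 2) `^ (1 / 3).
set b0 := a * (4 * G ^+ 2 * (w `^ (1 / 3) / kbar)).
have b00 : 0 <= b0 by rewrite mulr_ge0// mulr_ge0 ?divr_ge0 ?cb ?(ltW kbar0)//; lra.
set b1 := a * (3 * c ^+ 2 * kbar ^+ 3).
have b10 : 0 <= b1.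
  by rewrite mulr_ge0// mulr_ge0 ?exprn_ge0 ?(ltW kbar0)//; have := sqr_ge0 c; lra.
set d := ln (w + 3 * G ^+ 2) - ln w.
have w3 : 0 < w + 3 * G ^+ 2 by rewrite ltr_pwDl// mulr_ge0.
have d0 : 0 <= d by rewrite subr_ge0 ler_ln ?posrE// lerDl mulr_ge0.
have r0 : 0 <= r by exact: cb.
have rk0 : 0 <= 4 * (r / kbar) by rewrite mulr_ge0// divr_ge0// ltW.
set e : R := `|B1| + b0 + b1 * d + 3 * b1.
have e0 : 0 <= e.
  by apply: addr_ge0; [apply: addr_ge0; [exact: addr_ge0|exact: mulr_ge0]|exact: mulr_ge0].
exists (4 * (r / kbar) * e + 1) => [|T y y1 Ty]; first by rewrite ltr_wpDl// mulr_ge0.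
have y0 : 0 < y by lra.
have y3 : 1 <= y ^+ 3 by rewrite exprn_ege1.
have ln0 : 0 <= ln y by rewrite ln_ge0.
have yl0 : 0 <= y * (1 + ln y) by rewrite mulr_ge0 ?addr_ge0// ltW.
have hr : (w + T%:R * G ^+ 2) `^ (1 / 3) <= r * y.
  have ry0 : 0 <= r * y by rewrite mulr_ge0// ltW.
  have gw (k : R) : 0 <= k -> 0 <= w + k * G ^+ 2.
    by move=> k0; apply: addr_ge0; [exact: ltW|exact: mulr_ge0].
  rewrite -(ler_pXn2r (n := 3)) ?nnegrE// exprMn /r (cbrt_expr3 (gw _ (ler0n _ T))).
  rewrite (cbrt_expr3 (gw _ (ler0n _ 2))).
  have := ler_wpM2r g0 Ty; have := ler_wpM2l (ltW w0) y3.
  rewrite mulr1 => h1 h2; rewrite [leRHS]mulrDl; apply: lerD => //.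
  by rewrite [leRHS]mulrAC.
have hl : ln (w + T.+1%:R * G ^+ 2) - ln w <= d + 3 * ln y.
  have -> : 3 * ln y = ln (y ^+ 3) by rewrite lnXn// mulr_natl.
  have -> : d + ln (y ^+ 3) = ln ((w + 3 * G ^+ 2) * y ^+ 3) - ln w.
    by rewrite lnM ?posrE ?exprn_gt0// /d addrAC.
  have wT : 0 < w + T.+1%:R * G ^+ 2.
    by apply: ltr_pwDl => //; exact: mulr_ge0.
  rewrite lerD2r ler_ln ?posrE//; last by apply: mulr_gt0 => //; exact: exprn_gt0.
  rewrite mulrDl; apply: lerD; first exact: ler_peMr (ltW w0) y3.
  by rewrite mulrAC ler_wpM2r// -natr1; move: Ty y3; lra.
rewrite /error_budget -/a.
have h : B1 + a * (4 * G ^+ 2 * (w `^ (1 / 3) / kbar) +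
    3 * c ^+ 2 * kbar ^+ 3 * (ln (w + T.+1%:R * G ^+ 2) - ln w)) <= e * (1 + ln y).
  rewrite mulrDr -/b0 [a * (_ * (_ - _))]mulrA -/b1.
  have := ler_wpM2l b10 hl; have := ler_norm B1.
  have : 0 <= (`|B1| + b0 + b1 * d) * ln y.
    by apply: mulr_ge0 => //; apply: addr_ge0; [exact: addr_ge0|exact: mulr_ge0].
  rewrite /e; move: (ln _ - ln w) b10 => D; clear; lra.
apply: (@le_trans _ _ (4 * (r * y / kbar) * (e * (1 + ln y)))).
  apply: (le_trans (ler_wpM2l _ h)).
    by rewrite mulr_ge0// divr_ge0// ltW.
  apply: ler_wpM2r; first by apply: mulr_ge0 => //; exact: addr_ge0.
  by rewrite ler_pM2l// ler_pM2r// invr_gt0.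
have -> : 4 * (r * y / kbar) * (e * (1 + ln y)) = 4 * (r / kbar) * e * (y * (1 + ln y)).
  by field; rewrite gt_eqF.
by rewrite -[(_ + 1) * y * _]mulrA ler_wpM2r// lerDl.
Qed.

(** For [T] near [y ^+ 3] it suffices that [K * A * (1 + ln y) <= eps * y ^+ 2]. As [q] solves
    [eps * q ^+ 2 = l] and [ln q <= l], the choice [y = N * q] works for a large constant [N];
    cubing [q] gives both exponents [3 / 2]. *)
Lemma iteration_count (K : R) : 0 <= K -> exists2 C : R, 0 < C & forall eps : R, 0 < eps < 1 ->
  exists T : nat, [/\ (1 <= T)%N,
    T%:R <= C * eps `^ (- (3 / 2)) * ln (expR 1 / eps) `^ (3 / 2) &
    K * error_budget L G kbar w c B1 T <= eps * T%:R].
Proof.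
move=> K0; have [A A0 hA] := error_budget_growth.
(* The 3 counts the summands of [1 + ln N + ln q], each at most [N * l]; the added 1 makes [N] at
   least 1. *)
set N := 3 * K * A + 1.
have N1 : 1 <= N by rewrite lerDr !mulr_ge0// ltW.
exists (2 * N ^+ 3) => [|eps /andP[eps0 eps1]]; first by rewrite mulr_gt0// exprn_gt0//; lra.
set l := ln (expR 1 / eps).
have lE : l = 1 - ln eps by rewrite /l ln_div ?posrE ?expR_gt0// expRK.
have lneps : ln eps <= 0 by rewrite ln_le0// ltW.
have l1 : 1 <= l by lra.
have l0 : 0 < l by lra.
pose q := eps `^ (- (1 / 2)) * l `^ (1 / 2).
have q0 : 0 < q by rewrite mulr_gt0// powR_gt0.
have q3 : q ^+ 3 = eps `^ (- (3 / 2)) * l `^ (3 / 2).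
  rewrite exprMn -!powR_mulrn ?powR_ge0// -!powRrM.
  by congr (_ `^ _ * _ `^ _); field.
have q2 : eps * q ^+ 2 = l.
  rewrite exprMn -!powR_mulrn ?powR_ge0// -!powRrM.
  have -> : - (1 / 2) * 2 = -1 :> R by field.
  have -> : 1 / 2 * 2 = 1 :> R by field.
  by rewrite powR_inv1 ?ltW// powRr1 ?ltW// mulrA divff ?mul1r// gt_eqF.
have q1 : 1 <= q.
  rewrite -(ler_pXn2r (n := 2))// ?nnegrE ?(ltW q0)// expr1n.
  rewrite -(ler_pM2l eps0) q2; lra.
have lnq : ln q <= l.
  rewrite lnM ?posrE ?powR_gt0// !ln_powR.
  by have := ln_sublinear l0; lra.
have y1 : 1 <= N * q by rewrite mulr_ege1.
have y31 : 1 <= (N * q) ^+ 3 by rewrite exprn_ege1.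
have y30 : 0 <= (N * q) ^+ 3 by lra.
have /andP[Tlo Thi] := truncn_itv y30.
(* Rounding up keeps [T] above [y ^+ 3] and, as [y] is at least 1, below [2 * y ^+ 3]. *)
exists (Num.truncn ((N * q) ^+ 3)).+1.
have T2 : (Num.truncn ((N * q) ^+ 3)).+1%:R <= 2 * (N * q) ^+ 3 by rewrite -natr1; lra.
split=> //; first by rewrite -mulrA -q3 -mulrA -exprMn.
apply: (@le_trans _ _ (eps * (N * q) ^+ 3)); last by rewrite ler_wpM2l// ltW.
apply: (le_trans (ler_wpM2l K0 (hA _ _ y1 T2))).
have lnN : ln N <= N by apply: ltW; apply: ln_sublinear; lra.
have lnNq : 1 + ln (N * q) <= 3 * (N * l).
  by rewrite lnM ?posrE//; [nra|lra].
have -> : eps * (N * q) ^+ 3 = N * (N * q) * (N * l) by rewrite -q2; ring.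
have NKA : 3 * K * A <= N by rewrite lerDl.
have y0 : 0 <= N * q by lra.
have Nl : 0 <= N * l by nra.
have h1 : K * (A * (N * q) * (1 + ln (N * q))) <= K * (A * (N * q) * (3 * (N * l))).
  by rewrite ler_wpM2l// ler_wpM2l// mulr_ge0// ltW.
apply: (le_trans h1).
have -> : K * (A * (N * q) * (3 * (N * l))) = 3 * K * A * ((N * q) * (N * l)) by ring.
by rewrite -[N * (N * q) * _]mulrA ler_wpM2r// mulr_ge0.
Qed.

End Rate.

Theorem theorem2 (R : realType) (n J I : nat)
    (L G sigma mu chi rho B1 BU kbar w c : R)
    (L_gt0 : 0 < L) (w_gt0 : 0 < w) (c_gt0 : 0 < c)
    (chi_ge0 : 0 <= chi) (rho_gt0 : 0 < rho)
    (chi_rho : rho / L * (G + rho / 2) <= chi)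
    (kbar_w : 0 < kbar <= w `^ (1 / 3))
    (c_le : c <= w `^ (2 / 3) / (4 * kbar ^+ 2))
    (c_gt : 8 * L ^+ 2 + G ^+ 2 / (3 * kbar ^+ 3) < c)
    (mu_gt : 3 / 4 < mu)
    (w_ge : Num.max ((2 * L * kbar / (4 * mu - 3)) ^+ 3) (2 * G ^+ 2) <= w) :
  exists C p : R, [/\ 0 < C, 0 < p &
  forall (dS : measure_display) (Xi : measurableType dS)
    (pb : problem R Xi n J I) (sur : surrogates R Xi n J)
    (dO : measure_display) (Om : measurableType dO) (P : probability Om R)
    (xi : nat -> {RV P >-> Xi})
    (x0 : 'rV[R]_n) (x xhat z : nat -> Om -> 'rV[R]_n),
  (* standing assumptions *)
  well_posed pb ->
  iid_samples (xi_law pb) xi ->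
  measurable_surrogates pb sur ->
  convex_subproblem pb sur ->
  CoSTA kbar w c xi x xhat z pb sur x0 ->
  (* (i) *)
  Xset pb `<=` Dset pb ->
  (* (ii) *)
  (-oo < Fstar pb)%E -> Xset pb x0 -> (Fobj pb x0 - Fstar pb <= B1%:E)%E ->
  (* (iii) *)
  (forall s, Lsmooth_on L setT (loss pb ^~ s) /\
             Lipschitz_on G setT (loss pb ^~ s)) ->
  (* (iv) *)
  (forall i, Lsmooth_on L setT (hcon pb i) /\ Lipschitz_on G setT (hcon pb i)) ->
  (forall j, Lsmooth_on L setT (gcon pb j) /\ Lipschitz_on G setT (gcon pb j)) ->
  (* (v) *)
  bounded_variance pb sigma ->
  (* (vi) *)
  MFCQ pb chi rho ->
  (* (vii) *)
  loss_surrogate pb sur mu L ->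
  (* (viii) *)
  gcon_surrogate pb sur L G ->
  (* (ix) *)
  bounded_gap kbar w c xi x z pb sur BU ->
  forall eps : R, 0 < eps < 1 ->
  exists (t : nat) (lam : Om -> 'rV[R]_J) (nu : Om -> 'rV[R]_I),
    [/\ (1 <= t)%N,
        t%:R <= C * eps `^ (- (3 / 2)) * ln (expR 1 / eps) `^ p &
        eps_KKT P pb eps (xhat t) lam nu]].
Proof.
have PA : parameters_ok L G mu chi rho kbar w c by [].
have /andP[kbar0 _] := kbar_w.
(* [C] is fixed before any run is given, when the sign of the multiplier bound is still unknown;
   hence the absolute value. *)
set K := `|kkt_constant L rho BU|.
have [C C0 hC] := iteration_count L G c B1 w_gt0 kbar0 (normr_ge0 (kkt_constant L rho BU)).
exists C, (3 / 2); split=> //.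
move=> dS Xi pb sur dO Om P xi x0 x xhat z wp iid ms cs run dom _ Xx0 F1 lo ho go _ mf ls gs gap eps eps01.
have PO : problem_ok L G mu chi rho pb sur by [].
have /andP[eps0 _] := eps01.
have [T [T1 TC hT]] := hC _ eps01.
have [t /andP[t1 tT] err] := exists_small_error PA PO iid run Xx0 gap F1 T1.
have m0 : 0 <= mean P (sq_error pb x xhat z t).
  by apply: Rintegral_ge0 => om _; rewrite addr_ge0 ?sqr_ge0.
have [|lam [nu kkt]] := small_error_eps_KKT PA PO (P := P) run Xx0 gap t1 eps0 _.
  apply: (@le_trans _ _ (K * mean P (sq_error pb x xhat z t))); first by rewrite ler_wpM2r// ler_norm.
  have T0 : 0 < T%:R :> R by rewrite ltr0n.
  rewrite -(ler_pM2r T0) -mulrA (mulrC (mean _ _)); apply: le_trans hT.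
  by apply: ler_wpM2l; rewrite ?normr_ge0.
by exists t, lam, nu; split=> //; apply: le_trans TC; rewrite ler_nat.
Qed.
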